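(* Let $a_0,a_1,a_2,\dots$ be commuting indeterminates, $a(z)=\sum_{n\ge 0}a_nz^{n-1}$, and let $\sigma_a^+=\sum_F\varphi^+(Y_F)X_F$ be the series associated with the Birkhoff factorisation defined in the context. Put $\mathsf{C}=\sigma_a^+|_{z=1}$ and $\mathsf{D}=\operatorname{Res}_{z=0}\sigma_a^+$ (residue taken coefficientwise). For a plane forest $G$ let $a_G$ be the product, over all vertices $v$ of $G$, of $a_{c(v)}$, where $c(v)$ is the number of children of $v$. Then, with $C_G=\sum_{G'\le G}X_{G'}$ (sum over the Tamari order on plane forests): (i) $\mathsf{C}=\sum_G a_G\,C_G$ (sum over all plane forests) and $\mathsf{D}=\sum_T a_T\,C_T$ (sum over all plane trees), and both series have all their homogeneous components in (the image of) $\mathbf{Sym}$, with scalars extended to $\mathbb{C}[a_0,a_1,\dots]$. (ii) For every $n\ge 1$ and every partition $\lambda=(\lambda_1,\dots,\lambda_\ell)$ of $n-1$, set $a_\lambda=a_0^{\,n-\ell}a_{\lambda_1}\cdots a_{\lambda_\ell}$ and $$\mathsf{D}_\lambda=\sum_{a_T=a_\lambda}C_T ,$$ the sum over plane trees $T$ with $n$ vertices such that $a_T=a_\lambda$. Then $\mathsf{D}_\lambda$ lies in $\mathbf{Sym}_n$, and, regarded as an element of the descent algebra of the symmetric group $\mathfrak{S}_n$, it is a Lie quasi-idempotent. As an element of $\mathbb{C}[\mathfrak{S}_n]$ it is a multiplicity-free sum of elements of the Poincaré–Birkhoff–Witt basis of the Lie module $\mathrm{Lie}(n)$, namely $$\mathsf{D}_\lambda=\sum_{a_T=a_\lambda}\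 \sum_{\sigma\ \text{admissible for } t_T} t_T(\sigma).$$
   Context: **Plane forests.** Plane (ordered) rooted trees and forests; $|F|$ is the number of vertices; $B_+(F)$ is the tree obtained by grafting the trees of $F$, in order, on a common root. Vertices of a forest are labelled $1,\dots,n$ in postorder (children from left to right, then parent; trees from left to right). Write $i<_Fj$ if $i$ is a proper descendant of $j$. **$\mathcal{H}_{NCK}$ and its dual.** $\mathcal{H}_{NCK}$ has basis $Y_F$ ($F$ plane forests), graded by $|F|$, product = concatenation of forests, coproduct $\Delta Y_F=\sum_u Y_{F_{(1)}}\otimes Y_{F_{(2)}}$, the sum over words $u\in\{1,2\}^{|F|}$ with $i<_Fj\Rightarrow u_i\le u_j$, where $F_{(k)}$ is the restriction of $F$ to the vertices $i$ with $u_i=k$. $X_F$ is the dual basis of the graded dual $\mathcal{H}_{NCK}^*$, whose product is dual to $\Delta$. Infinite sums of $X_F$ are taken in the completion. **Embedding of $\mathbf{Sym}$.** $\mathbf{Sym}=\mathbb{C}\langle S_1,S_2,\dots\rangle$ (noncommutative symmetric functions, $S_0=1$, $\deg S_n=n$) is embedded in $\mathcal{H}_{NCK}^*$ by $S_n=\sum_{|F|=n}X_F$. For a composition $I=(i_1,\dots,i_r)$, $S^I=S_{i_1}\cdots S_{i_r}$ and $R_I=\sum_{J\le I}(-1)^{\ell(I)-\ell(J)}S^J$, where $J\le I$ means that $I$ is a refinement of $J$, and $\ell$ is the number of parts. $\mathbf{Sym}_n$ is identified with the descent algebra of $\mathfrak{S}_n$ by sending $R_I$ to the sum of all permutations $\sigma$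 (written as words) whose descent set is $\{i_1,i_1+i_2,\dots,i_1+\cdots+i_{r-1}\}$. **Birkhoff factorisation.** Let $K=\mathbb{C}[a_0,a_1,\dots]$, $\mathcal{A}=K((z))$ (Laurent series), $\mathcal{A}_+=z^{-1}K[z^{-1}]$, $\mathcal{A}_-=K[[z]]$. Let $\varphi$ be the character of $\mathcal{H}_{NCK}$ with $\varphi(Y_F)=a(z)^{|F|}$, so that $\sigma_a:=\sum_n a(z)^nS_n=\sum_F\varphi(Y_F)X_F$. Its Birkhoff factorisation is the unique pair of characters $\varphi^\pm:\mathcal{H}_{NCK}\to\mathcal{A}$ with $\varphi^+=\varphi^-\star\varphi$ (convolution product) and $\varphi^\pm(Y_F)\in\mathcal{A}_\pm$ for $F\neq\emptyset$. One sets $\sigma_a^\pm=\sum_F\varphi^\pm(Y_F)X_F$, so $\sigma_a^+=\sigma_a^-\sigma_a$. **Tamari order.** On plane trees with a fixed number of vertices, $T'$ covers $T$ if, for some vertex $x$ of $T$ that is neither the root nor a leaf, $T'$ is obtained by cutting off the leftmost subtree of $x$ and grafting it on the parent of $x$, immediately to the left of $x$; the Tamari order is the reflexive transitive closure. On forests, $F\le G$ iff $B_+(F)\le B_+(G)$. **Lie idempotents.** $\mathfrak{S}_n$ acts on words of length $n$ on the right by $(w_1\cdots w_n)\cdot\sigma=w_{\sigma(1)}\cdots w_{\sigma(n)}$. A Lie idempotent is an idempotent of $\mathbb{C}[\mathfrak{S}_n]$ acting as a projector onto the degree-$n$ component of the free Lie algebra. A Lie quasi-idempotent is an element having a nonzero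 scalar multiple that is a Lie idempotent. **PBW basis of $\mathrm{Lie}(n)$.** $\mathrm{Lie}(n)\subset\mathbb{C}[\mathfrak{S}_n]$ is spanned by the complete bracketings of standard words. For a complete binary tree $t$ with $n$ leaves and $\sigma\in\mathfrak{S}_n$, $t(\sigma)$ denotes the bracketing of shape $t$ with leaves labelled $\sigma(1),\dots,\sigma(n)$ from left to right, expanded as a combination of permutations (words). The labelling $\sigma$ is admissible for $t$ if at each internal node the smallest label below it is in its left subtree and the greatest label is in its right subtree; the $t(\sigma)$ with $\sigma$ admissible form the PBW basis. For a plane tree $T=B_+(F)$ with $n$ vertices, $t_T$ is the complete binary tree with $n$ leaves whose $n-1$ internal nodes form the binary tree on the vertices of $F$ in which the left child of a vertex is its leftmost child in $F$ and the right child is its next sibling to the right in $F$ (roots of $F$ being siblings of each other, the binary root being the first root of $F$). *)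

(* Defs.v *)
From HB Require Import structures.
From Stdlib Require Import Relations.Relation_Operators.
From mathcomp Require Import all_boot all_order all_algebra all_fingroup.
From mathcomp Require Import finmap boolp classical_sets functions cardinality.
From mathcomp Require Import fsbigop reals complex.
From mathcomp.multinomials Require Import monalg.
From mathcomp Require Import zify.

Set Implicit Arguments.
Unset Strict Implicit.
Unset Printing Implicit Defensive.

Import Order.TTheory GRing.Theory Num.Theory.
Local Open Scope ring_scope.

Inductive ptree : Type := Bplus of seq ptree.
Notation forest := (seq ptree).

Fixpoint tree_encode (t : ptree) : GenTree.tree unit :=
  let: Bplus F := t in GenTree.Node 0 (map tree_encode F).
Fixpoint tree_decode (g : GenTree.tree unit) : ptree :=
  if g is GenTree.Node _ s then Bplus (map tree_decode s) else Bplus [::].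

Lemma tree_encodeK : cancel tree_encode tree_decode.
Proof.
move=> t; move: t; fix IH 1 => -[F] /=; congr Bplus.
by elim: F => [//|t F IHF] /=; rewrite IH IHF.
Qed.

HB.instance Definition _ := Countable.copy ptree (can_type tree_encodeK).

Fixpoint tsize (t : ptree) : nat := let: Bplus F := t in (sumn (map tsize F)).+1.
Definition fsize (F : forest) : nat := sumn (map tsize F).

(* Vertices are labelled 0, ..., |F| - 1 in postorder, so that the root of a
   tree t carries the label (tsize t).-1 and all smaller labels lie below it. *)

Definition forest_below (below : ptree -> rel nat) :=
  fix fb (F : forest) (i j : nat) : bool :=
    if F is t :: F' then
      if (i < tsize t)%N && (j < tsize t)%N then below t i j
      else [&& (tsize t <= i)%N, (tsize t <= j)%N
             & fb F' (i - tsize t)%N (j - tsize t)%N]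
    else false.

Fixpoint tree_below (t : ptree) (i j : nat) : bool :=
  let: Bplus F := t in
  if j == fsize F then (i < fsize F)%N else forest_below tree_below F i j.

(* [fbelow F i j] : i is a proper descendant of j in F. *)
Definition fbelow : forest -> rel nat := forest_below tree_below.

(* [frestrict F m] : restriction of F to the vertices whose label i has
   [nth false m i] true; the children of a deleted vertex take its place. *)
Definition forest_restrict (restrict : ptree -> bitseq -> forest) :=
  fix fr (F : forest) (m : bitseq) : forest :=
    if F is t :: F' then
      restrict t (take (tsize t) m) ++ fr F' (drop (tsize t) m)
    else [::].

Fixpoint tree_restrict (t : ptree) (m : bitseq) : forest :=
  let: Bplus F := t in
  let G := forest_restrict tree_restrict F (take (fsize F) m) in
  if nth false m (fsize F) then [:: Bplus G] else G.

Definition frestrict : forest -> bitseq -> forest :=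
  forest_restrict tree_restrict.

(* A linear map H_NCK -> A is given by its values on the basis Y_F, i.e. by a
   function [forest -> A].  The same functions represent the series
   sum_F (x F) X_F of the completion of H_NCK^* with coefficients in A; the
   product dual to the coproduct is then the convolution product. *)

(* A word over {1,2} is a tuple of booleans, false standing for 1. *)
Definition ncompat (F : forest) (u : bitseq) : bool :=
  [forall i : 'I_(fsize F), forall j : 'I_(fsize F),
     fbelow F i j ==> (nth false u i <= nth false u j)%N].

Definition conv (A : nzRingType) (x y : forest -> A) : forest -> A :=
  fun F => \sum_(u : (fsize F).-tuple bool | ncompat F u)
             x (frestrict F (map negb u)) * y (frestrict F u).

Definition is_character (A : nzRingType) (x : forest -> A) : Prop :=
  x [::] = 1 /\ forall F G, x (F ++ G) = x F * x G.

Definition X1 (A : nzRingType) : forest -> A := fun F => (nilp F)%:R.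

Definition hcomp (A : nzRingType) (n : nat) (x : forest -> A) : forest -> A :=
  fun F => if fsize F == n then x F else 0.

Definition compositions (n : nat) : set (seq nat) :=
  [set I : seq nat | 0%N \notin I /\ sumn I = n]%classic.

(* J <= I : I is obtained by replacing each part of J by a composition of it. *)
Definition coarser (J I : seq nat) : Prop :=
  exists Is : seq (seq nat), I = flatten Is /\ J = map sumn Is.

Definition Scomplete (A : nzRingType) (n : nat) : forest -> A :=
  fun F => (fsize F == n)%:R.

Definition SI (A : nzRingType) (I : seq nat) : forest -> A :=
  foldr (fun i x => conv (Scomplete A i) x) (X1 A) I.

Definition RI (A : nzRingType) (I : seq nat) : forest -> A :=
  fun F => \sum_(J \in [set J : seq nat | compositions (sumn I) J /\ coarser J I]%classic)
             (-1) ^+ (size I - size J) * SI A J F.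

(* The homogeneous component Sym_n, with scalars extended to A. *)
Definition in_Sym (A : nzRingType) (n : nat) (x : forest -> A) : Prop :=
  exists c : seq nat -> A,
    forall F, x F = \sum_(I \in compositions n) c I * SI A I F.

Inductive tamari_cover : ptree -> ptree -> Prop :=
| TamariHere L s cs R :
    tamari_cover (Bplus (L ++ Bplus (s :: cs) :: R))
                 (Bplus (L ++ s :: Bplus cs :: R))
| TamariBelow L t t' R :
    tamari_cover t t' -> tamari_cover (Bplus (L ++ t :: R)) (Bplus (L ++ t' :: R)).

Definition tamari_le : ptree -> ptree -> Prop := clos_refl_trans ptree tamari_cover.

Definition forest_le (F G : forest) : Prop := tamari_le (Bplus F) (Bplus G).

(* C_G, the sum of the X_F for F <= G *)
Definition CX (A : nzRingType) (G : forest) : forest -> A :=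
  fun F => `[< forest_le F G >]%:R.

Record laurent (K : comNzRingType) := Laurent {
  lcoef : int -> K;
  lcoef_bounded : exists N : int, forall m, m < N -> lcoef m = 0 }.

Section LaurentRing.
Context {K : comNzRingType}.
Implicit Types (f g h : laurent K) (m : int).

HB.instance Definition _ := gen_eqMixin (laurent K).
HB.instance Definition _ := gen_choiceMixin (laurent K).

Lemma laurentP f g : lcoef f =1 lcoef g -> f = g.
Proof.
case: f g => [f pf] [g pg] /= /funext fg.
by subst g; congr Laurent; exact: Prop_irrelevance.
Qed.

Lemma lbound f : exists a : nat, forall m, m < - a%:Z -> lcoef f m = 0.
Proof.
have [N HN] := lcoef_bounded f; exists `|N|%N => m hm; apply: HN.
by lia.
Qed.

Definition lmul_coef (u v : int -> K) : int -> K :=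
  fun m => \sum_(i \in [set: int]%classic) u i * v (m - i).

Lemma lmul_coef_lt (u v : int -> K) (a b : nat) m :
    (forall i, i < - a%:Z -> u i = 0) -> (forall i, i < - b%:Z -> v i = 0) ->
  m < - (a + b)%N%:Z -> lmul_coef u v m = 0.
Proof.
move=> u0 v0 hm; apply: fsbig1 => i _.
have [hi|hi] := ltP i (- a%:Z); first by rewrite u0 ?mul0r.
by rewrite v0 ?mulr0 //; lia.
Qed.

Lemma lmul_coefE (u v : int -> K) (a b n k : nat) :
    (forall i, i < - a%:Z -> u i = 0) -> (forall i, i < - b%:Z -> v i = 0) ->
    (k < n)%N ->
  lmul_coef u v (k%:Z - (a + b)%N%:Z) =
  ((\poly_(i < n) u (i%:Z - a%:Z)) * (\poly_(i < n) v (i%:Z - b%:Z)))`_k.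
Proof.
move=> u0 v0 kn; rewrite coefM /lmul_coef.
rewrite (fsbigE [seq i%:Z - a%:Z | i <- iota 0 k.+1]).
- rewrite big_map -[iota 0 k.+1]/(index_iota 0 k.+1) big_mkord.
  apply: eq_big => [i|i _]; first by rewrite in_setT.
  rewrite !coef_poly.
  have ik := ltn_ord i.
  rewrite (_ : (i < n)%N); last lia.
  rewrite (_ : (k - i < n)%N); last lia.
  by congr (_ * v _); lia.
- by rewrite map_inj_uniq ?iota_uniq // => i j; lia.
- by [].
move=> i _ hi.
have [h1|h1] := ltP i (- a%:Z); first by rewrite u0 ?mul0r.
rewrite v0 ?mulr0 //.
have [//|h2] := ltP (k%:Z - (a + b)%N%:Z - i) (- b%:Z).
case/negP: hi; apply/mapP; exists (absz (i + a%:Z)); last lia.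
by rewrite mem_iota; lia.
Qed.

Fact lmul_bounded f g :
  exists N : int, forall m, m < N -> lmul_coef (lcoef f) (lcoef g) m = 0.
Proof.
have [a ha] := lbound f; have [b hb] := lbound g.
by exists (- (a + b)%N%:Z) => m; exact: lmul_coef_lt.
Qed.

Definition lmul f g : laurent K := Laurent (lmul_bounded f g).

Fact lconst_bounded (c : K) :
  exists N : int, forall m : int, m < N -> (if m == 0 then c else 0) = 0.
Proof. by exists 0 => m; case: eqP => // ->. Qed.
Definition lconst (c : K) : laurent K := Laurent (lconst_bounded c).

Fact ladd_bounded f g :
  exists N : int, forall m, m < N -> lcoef f m + lcoef g m = 0.
Proof.
have [a ha] := lbound f; have [b hb] := lbound g.
exists (- (a + b)%N%:Z) => m hm.
by rewrite ha ?hb ?addr0 //; lia.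
Qed.
Definition ladd f g : laurent K := Laurent (ladd_bounded f g).

Fact lopp_bounded f : exists N : int, forall m, m < N -> - lcoef f m = 0.
Proof. by have [N hN] := lcoef_bounded f; exists N => m /hN ->; rewrite oppr0. Qed.
Definition lopp f : laurent K := Laurent (lopp_bounded f).

Fact laddA : associative ladd.
Proof. by move=> f g h; apply: laurentP => m /=; rewrite addrA. Qed.
Fact laddC : commutative ladd.
Proof. by move=> f g; apply: laurentP => m /=; rewrite addrC. Qed.
Fact ladd0 : left_id (lconst 0) ladd.
Proof. by move=> f; apply: laurentP => m /=; rewrite if_same add0r. Qed.
Fact laddN : left_inverse (lconst 0) lopp ladd.
Proof. by move=> f; apply: laurentP => m /=; rewrite if_same addNr. Qed.

HB.instance Definition _ := GRing.isZmodule.Build (laurent K)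
  laddA laddC ladd0 laddN.


Fact lmulC : commutative lmul.
Proof.
move=> f g; apply: laurentP => m /=.
have [a ha] := lbound f; have [b hb] := lbound g.
have [hm|hm] := ltP m (- (a + b)%N%:Z).
  by rewrite (lmul_coef_lt ha hb) // (lmul_coef_lt hb ha) // addnC.
have -> : m = (absz (m + (a + b)%N%:Z))%:Z - (a + b)%N%:Z by lia.
set k := absz _; rewrite (lmul_coefE ha hb (ltnSn k)).
by rewrite [in RHS]addnC (lmul_coefE hb ha (ltnSn k)) mulrC.
Qed.

Fact lmul1 : left_id (lconst 1) lmul.
Proof.
move=> f; apply: laurentP => m /=; rewrite /lmul_coef.
rewrite (fsbigE [:: 0]) //=.
  by rewrite big_cons big_nil in_setT eqxx mul1r subr0 addr0.
by move=> i _; rewrite inE => /negPf ->; rewrite mul0r.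
Qed.

Fact lmulDl : left_distributive lmul ladd.
Proof.
move=> f g h; apply: laurentP => m.
have [a ha] := lbound f; have [b hb] := lbound g; have [c hc] := lbound h.
have haw i : i < - (a + b)%N%:Z -> lcoef f i = 0 by move=> ?; apply: ha; lia.
have hbw i : i < - (a + b)%N%:Z -> lcoef g i = 0 by move=> ?; apply: hb; lia.
have hab i : i < - (a + b)%N%:Z -> lcoef (ladd f g) i = 0.
  by move=> hi /=; rewrite haw ?hbw ?addr0.
rewrite /=.
have [hm|hm] := ltP m (- (a + b + c)%N%:Z).
  by rewrite (lmul_coef_lt hab hc) // (lmul_coef_lt haw hc) //
    (lmul_coef_lt hbw hc) // addr0.
have -> : m = (absz (m + (a + b + c)%N%:Z))%:Z - (a + b + c)%N%:Z by lia.
set k := absz _.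
rewrite (lmul_coefE hab hc (ltnSn k)) (lmul_coefE haw hc (ltnSn k)).
rewrite (lmul_coefE hbw hc (ltnSn k)) -coefD -mulrDl; congr ((polyseq (_ * _))`_k).
by apply/polyP => i; rewrite coefD !coef_poly; case: ifP; rewrite ?addr0.
Qed.

Fact lmulA : associative lmul.
Proof.
move=> f g h; apply: laurentP => m.
have [a ha] := lbound f; have [b hb] := lbound g; have [c hc] := lbound h.
have hab i : i < - (a + b)%N%:Z -> lcoef (lmul f g) i = 0.
  exact: lmul_coef_lt.
have hbc i : i < - (b + c)%N%:Z -> lcoef (lmul g h) i = 0.
  exact: lmul_coef_lt.
rewrite /=.
have [hm|hm] := ltP m (- (a + b + c)%N%:Z).
  by rewrite (lmul_coef_lt ha hbc) ?addnA // (lmul_coef_lt hab hc).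
have -> : m = (absz (m + (a + b + c)%N%:Z))%:Z - (a + b + c)%N%:Z by lia.
set k := absz _.
rewrite (lmul_coefE hab hc (ltnSn k)) -addnA (lmul_coefE ha hbc (ltnSn k)).
set P := \poly_(i < _) lcoef f _; set Q := \poly_(i < k.+1) lcoef g (i%:Z - b%:Z).
set S := \poly_(i < _) lcoef h _.
have -> : (P * \poly_(i < k.+1) lcoef (lmul g h) (i%:Z - (b + c)%N%:Z))`_k
          = (P * (Q * S))`_k.
  rewrite !coefM; apply: eq_bigr => i _; congr (_ * _).
  rewrite coef_poly ltnS leq_subr /=.
  by apply: (lmul_coefE hb hc); rewrite ltnS leq_subr.
rewrite mulrA !coefM; apply: eq_bigr => i _; congr (_ * _).
by rewrite [RHS]coef_poly ltn_ord /=; apply/esym/(lmul_coefE ha hb)/ltn_ord.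
Qed.

Fact lone_neq0 : lconst 1 != 0.
Proof.
apply/eqP => /(congr1 (fun f => lcoef f 0)) /= /eqP.
by rewrite oner_eq0.
Qed.

HB.instance Definition _ := GRing.Zmodule_isComNzRing.Build (laurent K)
  lmulA lmulC lmul1 lmulDl lone_neq0.

End LaurentRing.

Notation apoly k := {malg k[{cmonom nat}]}.

Definition avar (k : comNzRingType) (n : nat) : apoly k := << ucm n >>.

Definition aseries_coef (k : comNzRingType) (m : int) : apoly k :=
  if m + 1 is Posz n then avar k n else 0.

Fact aseries_bounded (k : comNzRingType) :
  exists N : int, forall m, m < N -> aseries_coef k m = 0.
Proof. by exists (-1) => m hm; rewrite /aseries_coef; case E: (m + 1) => //; lia. Qed.

(* a(z) = sum_n a_n z^(n-1) *)
Definition aseries (k : comNzRingType) : laurent (apoly k) :=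
  Laurent (aseries_bounded k).

Definition aphi (k : comNzRingType) : forest -> laurent (apoly k) :=
  fun F => aseries k ^+ fsize F.

(* z^-1 K[z^-1]: only finitely many coefficients of negative index are nonzero
   because those of a Laurent series vanish far enough to the left. *)
Definition in_Aplus (K : comNzRingType) (f : laurent K) : Prop :=
  forall m, 0 <= m -> lcoef f m = 0.

Definition in_Aminus (K : comNzRingType) (f : laurent K) : Prop :=
  forall m, m < 0 -> lcoef f m = 0.

Definition is_birkhoff (K : comNzRingType) (phi phim phip : forest -> laurent K) : Prop :=
  [/\ is_character phim, is_character phip,
      forall F, phip F = conv phim phi F
    & forall F, F <> [::] -> in_Aplus (phip F) /\ in_Aminus (phim F)].

(* Value at z = 1, for a series with finitely many nonzero coefficients. *)
Definition eval1 (K : comNzRingType) (f : laurent K) : K :=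
  \sum_(m \in [set: int]%classic) lcoef f m.

Definition residue (K : comNzRingType) (f : laurent K) : K := lcoef f (-1).

Fixpoint child_counts (t : ptree) : seq nat :=
  let: Bplus F := t in size F :: flatten (map child_counts F).

Definition aforest (k : comNzRingType) (G : forest) : apoly k :=
  \prod_(c <- flatten (map child_counts G)) avar k c.

Notation galg k n := {ffun 'S_n -> k}.

(* Permutations are multiplied as functions, sigma tau = sigma \o tau, which is
   [tau * sigma] in the group {perm _}. *)
Definition gmul (k : comNzRingType) (n : nat) (x y : galg k n) : galg k n :=
  [ffun s => \sum_(p : 'S_n * 'S_n | (p.2 * p.1)%g == s) x p.1 * y p.2].

Definition perm_word (n : nat) (s : 'S_n) : seq 'I_n := [seq s i | i <- enum 'I_n].

Definition descents (w : seq nat) : seq nat :=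
  [seq i <- iota 1 (size w).-1 | (nth 0%N w i < nth 0%N w i.-1)%N].

(* i_1, i_1 + i_2, ..., i_1 + ... + i_(r-1) *)
Definition comp_descents (I : seq nat) : seq nat :=
  [seq sumn (take j I) | j <- iota 1 (size I).-1].

Definition descent_class (k : comNzRingType) (n : nat) (I : seq nat) : galg k n :=
  [ffun s => (descents (map val (perm_word s)) == comp_descents I)%:R].

(* x lies in Sym_n and d is the corresponding element of the descent algebra,
   under R_I |-> sum of the permutations with descent set comp_descents I. *)
Definition descent_image (k : comNzRingType) (n : nat)
    (x : forest -> k) (d : galg k n) : Prop :=
  exists r : seq nat -> k,
    (forall F, x F = \sum_(I \in compositions n) r I * RI k I F) /\
    (forall s, d s = \sum_(I \in compositions n) r I * descent_class k n I s).

Notation ncpoly k A := {malg k[{fmonom A}]}.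

Definition ncword (k : comNzRingType) (A : choiceType) (w : seq A) : ncpoly k A :=
  << FMonom w >>.

Definition homogeneous (k : comNzRingType) (A : choiceType) (n : nat)
    (p : ncpoly k A) : Prop :=
  forall w : {fmonom A}, w \in msupp p -> size w = n.

Definition lie_bracket (k : comNzRingType) (A : choiceType) (p q : ncpoly k A) :
  ncpoly k A := p * q - q * p.

Inductive free_lie (k : comNzRingType) (A : choiceType) : ncpoly k A -> Prop :=
| FreeLieLetter (a : A) : free_lie (ncword k [:: a])
| FreeLie0 : free_lie 0
| FreeLieLin (c : k) p q : free_lie p -> free_lie q -> free_lie (c *: p + q)
| FreeLieBracket p q : free_lie p -> free_lie q -> free_lie (lie_bracket p q).

(* w_1 ... w_n . s = w_(s 1) ... w_(s n), meaningful when w has length n *)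
Definition word_act (A : Type) (n : nat) (w : seq A) (s : 'S_n) : seq A :=
  pmap (onth w) (map val (perm_word s)).

Definition ncact (k : comNzRingType) (A : choiceType) (n : nat)
    (p : ncpoly k A) (x : galg k n) : ncpoly k A :=
  \sum_(w <- msupp p) \sum_(s : 'S_n) (p@_w * x s) *: ncword k (word_act w s).

Definition lie_idempotent (k : comNzRingType) (n : nat) (e : galg k n) : Prop :=
  gmul e e = e /\
  forall (A : choiceType) (p : ncpoly k A),
    (homogeneous n p /\ free_lie p) <->
    exists2 q : ncpoly k A, homogeneous n q & p = ncact q e.

Definition lie_quasi_idempotent (k : comNzRingType) (n : nat) (x : galg k n) : Prop :=
  exists2 c : k, c != 0 & lie_idempotent [ffun s => c * x s].

Inductive btree : Type := BLeaf | BNode of btree & btree.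

Fixpoint leaves (t : btree) : nat :=
  if t is BNode l r then (leaves l + leaves r)%N else 1%N.

(* The labels of the leaves from left to right are given by a word. *)
Fixpoint bracketing (k : comNzRingType) (A : choiceType) (t : btree) (w : seq A) :
    ncpoly k A :=
  if t is BNode l r then
    lie_bracket (bracketing k l (take (leaves l) w))
                (bracketing k r (drop (leaves l) w))
  else ncword k w.

Fixpoint admissible_labels (t : btree) (w : seq nat) : bool :=
  if t is BNode l r then
    let wl := take (leaves l) w in
    let wr := drop (leaves l) w in
    [&& has (fun x => all (fun y => x <= y)%N w) wl,
        has (fun x => all (fun y => y <= x)%N w) wr,
        admissible_labels l wl & admissible_labels r wr]
  else true.

Definition admissible (n : nat) (t : btree) (s : 'S_n) : bool :=
  admissible_labels t (map val (perm_word s)).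

Definition bracket_perm (k : comNzRingType) (n : nat) (t : btree) (s : 'S_n) :
    galg k n :=
  [ffun r => (bracketing k t (perm_word s))@_(FMonom (perm_word r))].

(* Binary tree of a plane forest: the left child of a vertex is its leftmost
   child and the right child its next sibling, completed with leaves. *)
Definition forest_binary (tb : ptree -> btree -> btree) : forest -> btree :=
  foldr tb BLeaf.

Fixpoint tree_binary (t : ptree) (next : btree) : btree :=
  let: Bplus F := t in BNode (forest_binary tree_binary F) next.

Definition lie_tree (T : ptree) : btree :=
  let: Bplus F := T in forest_binary tree_binary F.

Definition is_partition (m : nat) (l : seq nat) : bool :=
  [&& sorted geq l, 0%N \notin l & sumn l == m].

Definition apartition (k : comNzRingType) (n : nat) (l : seq nat) : apoly k :=
  avar k 0 ^+ (n - size l) * \prod_(c <- l) avar k c.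

Definition trees_of_type (k : comNzRingType) (n : nat) (l : seq nat) : set ptree :=
  [set T : ptree | tsize T = n /\ aforest k [:: T] = apartition k n l]%classic.

Definition Dpart (k : comNzRingType) (n : nat) (l : seq nat) : forest -> k :=
  fun F => \sum_(T \in trees_of_type k n l) CX k [:: T] F.

Definition pbw_sum (k : comNzRingType) (n : nat) (l : seq nat) : galg k n :=
  [ffun r => \sum_(T \in trees_of_type k n l)
               \sum_(s : 'S_n | admissible (lie_tree T) s)
                 bracket_perm k (lie_tree T) s r].

(* Main.v *)
From HB Require Import structures.
From Stdlib Require Import Relations.Relation_Operators.
Require Import Defs.
From mathcomp Require Import all_boot all_order all_algebra all_fingroup.
From mathcomp Require Import finmap boolp classical_sets.
From mathcomp Require Import fsbigop reals complex.
From mathcomp.multinomials Require Import monalg.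
From mathcomp Require Import zify.

Set Implicit Arguments.
Unset Strict Implicit.
Unset Printing Implicit Defensive.

Import Order.TTheory GRing.Theory Num.Theory.
Local Open Scope ring_scope.

(** Part (i). Both factors of a Birkhoff factorisation are unique
    ([birkhoff_unique]), so it suffices to exhibit phi^+ in two ways.

    On forests, phi^+ is multiplicative and phi^+(B_+(H)) is the pole part of
    a(z) phi^+(H).  If G has g trees and contributes a_G z^(-g) to phi^+(H), the
    term a_i z^(i-1) of a(z) turns it into a_i a_G z^(-(g-i)-1), which is the
    contribution of the forest obtained by grafting the last i trees of G on a
    new root; the terms with i > g are those without a pole.  Iterating this
    from the leaves to the roots produces each forest above H in the Tamari
    order exactly once ([mem_up], [up_uniq]), whence
    phi^+(F) = sum over G >= F of a_G z^(-k), k being the number of trees of G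
    ([birkhoff_aplus]).  At z = 1 this gives the sum of the a_G C_G, and the
    residue keeps the forests with a single tree.

    In Sym, the equation sigma^+ = sigma^- sigma_a can be solved on the S^I with
    scalar coefficients, by reading the last part of I and splitting off a pole
    part at each step ([bminus], [bplus], [Ssum_sigma]).  Both series therefore
    have their components in Sym, and so has D_lambda, which is the coefficient
    of the monomial a_lambda in the residue ([Dpart_expand]).

    Part (ii).  The coefficients of the S^I depend neither on forests nor on
    words, so the same factorisation may be studied with S_n acting on words: a
    function on words with values in noncommutative polynomials, multiplied by
    splitting a word into two complementary subwords in all ways.  There
    sigma_a maps w to a^|w| w.  Taking the derivative by the first letter y of
    sigma^+ = sigma^- sigma_a shows that Q_y = (d_y sigma^+) (sigma^+)^-1 has at
    most a simple pole, and it has no other terms because sigma^+ - 1 consists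
    of negative powers; so Q_y is concentrated in z^-1.  The conjugates
    E_x = sigma^+ x (sigma^+)^-1 satisfy d_y E_x = [Q_y, E_x], and the
    derivative by the last letter shows that Q_y(w), for y w = u x, is the z^-1
    part of a E_x(u) ([word_lax]).  These two recursions have a unique solution,
    and they are those of the admissible bracketings: in the commutator, the
    first letter y goes to the left factor, the last letter x to the right one,
    and the other letters are split arbitrarily ([wplus_pbsum]).  Comparing
    coefficients of a_lambda gives D_lambda as a multiplicity-free sum of
    elements of the PBW basis ([dcoef_shuf], [dperm_pbw]).  Under the
    identification of Sym with the descent algebra, S^I is the sum of the words
    increasing along the blocks of I; Moebius inversion for refinement relates
    this to the R_I ([sum_ribbon], [sum_coars_descents]).

    Let d be the element D_lambda of the group algebra.  Lie polynomials are
    primitive ([lie_primitive]), so the S^I with at least two parts kill those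
    of degree n and d acts on them by the scalar c, the coefficient of S_n in
    D_lambda.  As d sends every word to a Lie polynomial, d d = c d
    ([gmul_dperm]), and d / c is a Lie idempotent as soon as c is nonzero.  If c
    vanished, d would have square zero, hence trace zero in the regular
    representation, and so would its coefficient at the identity
    ([gmul_sqr0]).  But that coefficient is the value of D_lambda on the tree
    without branching, which is the least element of the Tamari order: it counts
    all trees of type lambda ([dperm1]), and there is at least one
    ([tree_of_type_exists]). *)

(** * Convolution rings *)

(** A graded coproduct given by the list of cuts of each basis element.
    Coassociativity and the counit laws are stated for sums over cuts, which is
    the form in which the convolution product uses them. *)
Record coalg := Coalg {
  cocarrier :> eqType;
  cosz : cocarrier -> nat;
  cocut : cocarrier -> seq (cocarrier * cocarrier);
  cosz_cut : forall x, all (fun p => cosz p.1 + cosz p.2 == cosz x)%N (cocut x);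
  cocutA : forall (V : nmodType) (h : cocarrier -> cocarrier -> cocarrier -> V) x,
    \sum_(p <- cocut x) \sum_(q <- cocut p.1) h q.1 q.2 p.2 =
    \sum_(p <- cocut x) \sum_(q <- cocut p.2) h p.1 q.1 q.2;
  cocut1l : forall (V : nmodType) (h : cocarrier -> V) x,
    \sum_(p <- cocut x | cosz p.1 == 0%N) h p.2 = h x;
  cocut1r : forall (V : nmodType) (h : cocarrier -> V) x,
    \sum_(p <- cocut x | cosz p.2 == 0%N) h p.1 = h x }.

Definition cfun (C : coalg) (B : Type) := C -> B.

Section ConvolutionRing.
Context {C : coalg} {B : pzRingType}.
Implicit Types (f g h : cfun C B).

HB.instance Definition _ := gen_eqMixin (cfun C B).
HB.instance Definition _ := gen_choiceMixin (cfun C B).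

Definition cadd f g : cfun C B := fun x => f x + g x.
Definition copp f : cfun C B := fun x => - f x.
Definition czero : cfun C B := fun=> 0.
Definition cone : cfun C B := fun x => (cosz x == 0%N)%:R.
Definition cmul_body f g : cfun C B := fun x => \sum_(p <- cocut x) f p.1 * g p.2.
(* Locked, so that unification does not compare convolution products by
   unfolding the sums. *)
Fact cmul_key : unit. Proof. by []. Qed.
Definition cmul := locked_with cmul_key cmul_body.
Canonical cmul_unlockable := [unlockable of cmul].

Fact caddA : associative cadd.
Proof. by move=> f g h; apply/funext => x; apply: addrA. Qed.
Fact caddC : commutative cadd.
Proof. by move=> f g; apply/funext => x; apply: addrC. Qed.
Fact cadd0 : left_id czero cadd.
Proof. by move=> f; apply/funext => x; apply: add0r. Qed.
Fact caddN : left_inverse czero copp cadd.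
Proof. by move=> f; apply/funext => x; apply: addNr. Qed.
HB.instance Definition _ := GRing.isZmodule.Build (cfun C B)
  caddA caddC cadd0 caddN.

Fact cmulA : associative cmul.
Proof.
move=> f g h; apply/funext => x; rewrite unlock /cmul_body.
under eq_bigr do rewrite mulr_sumr.
under [RHS]eq_bigr do rewrite mulr_suml.
rewrite (cocutA (fun a b c => f a * g b * h c)).
by apply: eq_bigr => p _; apply: eq_bigr => q _; rewrite mulrA.
Qed.
Fact cmul1l : left_id cone cmul.
Proof.
move=> f; apply/funext => x; rewrite unlock /cmul_body /cone -[RHS](cocut1l f) [RHS]big_mkcond.
by apply: eq_bigr => p _; case: eqP => _; rewrite ?mul1r ?mul0r.
Qed.
Fact cmul1r : right_id cone cmul.
Proof.
move=> f; apply/funext => x; rewrite unlock /cmul_body /cone -[RHS](cocut1r f) [RHS]big_mkcond.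
by apply: eq_bigr => p _; case: eqP => _; rewrite ?mulr1 ?mulr0.
Qed.
Fact cmulDl : left_distributive cmul cadd.
Proof.
move=> f g h; apply/funext => x; rewrite unlock /cmul_body /cadd -big_split /=.
by apply: eq_bigr => p _; rewrite mulrDl.
Qed.
Fact cmulDr : right_distributive cmul cadd.
Proof.
move=> f g h; apply/funext => x; rewrite unlock /cmul_body /cadd -big_split /=.
by apply: eq_bigr => p _; rewrite mulrDr.
Qed.
HB.instance Definition _ := GRing.Zmodule_isPzRing.Build (cfun C B)
  cmulA cmul1l cmul1r cmulDl cmulDr.

Lemma cmulE f g x : (f * g) x = \sum_(p <- cocut x) f p.1 * g p.2.
Proof. by rewrite /GRing.mul /= unlock. Qed.
Lemma cfunD f g x : (f + g) x = f x + g x. Proof. by []. Qed.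
Lemma cfunB f g x : (f - g) x = f x - g x. Proof. by []. Qed.
Lemma cfun1 x : (1 : cfun C B) x = (cosz x == 0%N)%:R. Proof. by []. Qed.
Lemma cfun_sum (J : Type) (r : seq J) (P : pred J) (F : J -> cfun C B) x :
  (\sum_(j <- r | P j) F j) x = \sum_(j <- r | P j) F j x.
Proof. by elim/big_rec2: _ => // j u v _ <-. Qed.

Lemma cfun_expr0 g k x : (forall y, cosz y = 0%N -> g y = 0) ->
  (cosz x < k)%N -> (g ^+ k) x = 0.
Proof.
move=> g0; elim: k x => [//|k IH] x xk; rewrite exprS cmulE.
rewrite big_seq big1 // => p /(allP (cosz_cut x))/eqP sp.
have [p0|p0] := eqVneq (cosz p.1) 0%N; first by rewrite g0 ?mul0r.
by rewrite IH ?mulr0 //; lia.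
Qed.

(** A function with value 1 on the elements of size 0 is invertible: its
    geometric series is finite at each element. *)
Lemma cfun_inverse f : (forall y, cosz y = 0%N -> f y = 1) ->
  exists g, [/\ f * g = 1, g * f = 1
    & forall x, exists N, g x = (\sum_(k < N) (1 - f) ^+ k) x].
Proof.
move=> f1; pose e := 1 - f.
have e0 y : cosz y = 0%N -> e y = 0.
  by move=> hy; rewrite /e cfunB cfun1 hy eqxx f1 // subrr.
pose s N : cfun C B := \sum_(k < N) e ^+ k.
have sE N x : (cosz x < N)%N -> s N x = s (cosz x).+1 x.
  move=> xN; rewrite /s !cfun_sum (big_ord_widen N (fun k => (e ^+ k) x) xN).
  rewrite [RHS]big_mkcond; apply: eq_bigr => i _ /=.
  by case: ltnP => // xi; apply: cfun_expr0.
pose g : cfun C B := fun x => s (cosz x).+1 x.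
have fE : f = 1 - e by rewrite /e opprB addrCA subrr addr0.
have tel N : (1 - e) * s N = 1 - e ^+ N /\ s N * (1 - e) = 1 - e ^+ N.
  rewrite /s; elim: N => [|N [IH1 IH2]].
    by rewrite big_ord0 mulr0 mul0r expr0 subrr.
  rewrite big_ord_recr /=; split.
    by rewrite mulrDr IH1 mulrBl mul1r -exprS addrA subrK.
  by rewrite mulrDl IH2 mulrBr mulr1 -exprSr addrA subrK.
exists g; split.
- apply/funext => x; rewrite cmulE.
  transitivity ((f * s (cosz x).+1) x).
    rewrite cmulE big_seq [RHS]big_seq; apply: eq_bigr => p.
    by move=> /(allP (cosz_cut x))/eqP sp; rewrite /g sE //; lia.
  by rewrite fE (tel _).1 cfunB cfun_expr0 ?subr0.
- apply/funext => x; rewrite cmulE.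
  transitivity ((s (cosz x).+1 * f) x).
    rewrite cmulE big_seq [RHS]big_seq; apply: eq_bigr => p.
    by move=> /(allP (cosz_cut x))/eqP sp; rewrite /g sE //; lia.
  by rewrite fE (tel _).2 cfunB cfun_expr0 ?subr0.
by move=> x; exists (cosz x).+1.
Qed.

End ConvolutionRing.

(** * Cuts of plane forests *)

Lemma forest_ind (P : forest -> Prop) :
  P [::] -> (forall H F, P H -> P F -> P (Bplus H :: F)) -> forall F, P F.
Proof.
move=> P0 PB; have PT : forall t F, P F -> P (t :: F).
  fix IH 1 => -[H] F PF; apply: PB => //.
  by elim: H => [//|t H IHH]; apply: IH.
by elim=> [//|t F IHF]; apply: PT.
Qed.

Section ForestFold.
Variables (T : Type) (z : T) (g : forest -> T -> T -> T).

Fixpoint tfold (t : ptree) (r : T) : T :=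
  let: Bplus H := t in g H (foldr tfold z H) r.
Definition ffold : forest -> T := foldr tfold z.

End ForestFold.

Lemma fsize_cons H F : fsize (Bplus H :: F) = (fsize H + fsize F).+1.
Proof. by []. Qed.

Lemma fsize_cat F G : fsize (F ++ G) = (fsize F + fsize G)%N.
Proof. by rewrite /fsize map_cat sumn_cat. Qed.

Lemma fsize0 F : (fsize F == 0%N) = (F == [::]).
Proof. by case: F => // -[H] F. Qed.

(** The pairs (pruned part, trunk) of the admissible cuts: either the root of
    the first tree is pruned with all its descendants, or it stays. *)
Definition tcuts (H : forest) (cH : seq (forest * forest)) :=
  ([:: Bplus H], [::]) :: [seq (p.1, [:: Bplus p.2]) | p <- cH].

Definition fcuts : forest -> seq (forest * forest) :=
  ffold [:: ([::], [::])] (fun H cH cF =>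
    [seq (p.1 ++ q.1, p.2 ++ q.2) | p <- tcuts H cH, q <- cF]).

Arguments fcuts : simpl never.

Lemma fcuts_cons H F :
  fcuts (Bplus H :: F) =
  [seq (p.1 ++ q.1, p.2 ++ q.2) | p <- tcuts H (fcuts H), q <- fcuts F].
Proof. by []. Qed.

(** The words of the coproduct, in the order of the cuts in [fcuts]. *)
Definition fmasks : forest -> seq bitseq :=
  ffold [:: [::]] (fun H mH mF =>
    [seq m1 ++ m2 | m1 <- nseq (fsize H).+1 false :: [seq rcons m true | m <- mH],
                    m2 <- mF]).

Lemma fmasks_cons H F :
  fmasks (Bplus H :: F) =
  [seq m1 ++ m2 | m1 <- nseq (fsize H).+1 false :: [seq rcons m true | m <- fmasks H],
                  m2 <- fmasks F].
Proof. by []. Qed.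

Lemma ncompatP F u :
  reflect (forall i j, (i < fsize F)%N -> (j < fsize F)%N -> fbelow F i j ->
             (nth false u i <= nth false u j)%N)
          (ncompat F u).
Proof.
apply: (iffP forallP) => [h i j hi hj|h i].
  by have /forallP/(_ (Ordinal hj))/implyP := h (Ordinal hi).
by apply/forallP => j; apply/implyP; apply: h.
Qed.

Lemma fbelow_lt F i j : fbelow F i j -> (i < fsize F)%N.
Proof.
elim: F i j => [//|t F IH] i j; rewrite /fbelow /=.
case: ifP => [/andP[hi _] _|_ /and3P[h1 _ /IH]]; first by rewrite /fsize /=; lia.
by rewrite /fsize /=; lia.
Qed.

(** Compatibility with the root of the first tree says that its letter is 2, or
    that all letters below it are 1: this is the recursion of the cuts. *)
Lemma ncompat_cons H F m b m2 : size m = fsize H -> size m2 = fsize F ->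
  ncompat (Bplus H :: F) (rcons m b ++ m2) =
  [&& b || all negb m, ncompat H m & ncompat F m2].
Proof.
move=> sm sm2.
have n1 i : (i < fsize H)%N -> nth false (rcons m b ++ m2) i = nth false m i.
  by move=> hi; rewrite nth_cat size_rcons sm ltnS ltnW // nth_rcons sm hi.
have n2 : nth false (rcons m b ++ m2) (fsize H) = b.
  by rewrite nth_cat size_rcons sm ltnSn nth_rcons sm ltnn eqxx.
have n3 i : nth false (rcons m b ++ m2) ((fsize H).+1 + i) = nth false m2 i.
  by rewrite nth_cat size_rcons sm ltnNge leq_addr /= addnC addnK.
apply/ncompatP/and3P => [h|[h1 /ncompatP h2 /ncompatP h3] i j].
  split.
  - case: b h n1 n2 n3 => //= h n1 n2 n3; apply/(all_nthP false) => i.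
    rewrite sm => hi.
    have := h i (fsize H); rewrite n1 // n2 fsize_cons /fbelow /= -/(fsize H).
    rewrite !ltnS (ltnW hi) leqnn eqxx hi leq_addr /=.
    rewrite (leq_trans (ltnW hi)) ?leq_addr //.
    by move=> /(_ isT isT isT); case: nth.
  - apply/ncompatP => i j hi hj hij.
    have := h i j; rewrite !n1 //; apply; rewrite ?fsize_cons; try lia.
    by rewrite /fbelow /= -/(fsize H) !ltnS (ltnW hi) (ltnW hj) /= (ltn_eqF hj).
  - apply/ncompatP => i j hi hj hij.
    have := h ((fsize H).+1 + i)%N ((fsize H).+1 + j)%N; rewrite !n3; apply;
      rewrite ?fsize_cons; try lia.
    by rewrite /fbelow /= -/(fsize H) [(_ + i < _)%N]ltnNge !leq_addr /= !addKn.
rewrite fsize_cons /fbelow /= -/(fsize H) => hi hj.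
case: ifP => [/andP[hi1 hj1]|_].
  case: eqP => [-> hi2|/eqP hj2].
    rewrite n2 n1 //; case: (b) h1 => /=; first by case: nth.
    by move=> /(all_nthP false)/(_ i); rewrite sm => /(_ hi2); case: nth.
  have hj3 : (j < fsize H)%N by rewrite ltn_neqAle hj2.
  have [hi2|hi2] := ltnP i (fsize H); first by rewrite !n1 //; apply: h2.
  move=> bij; have ei : i = fsize H by apply/eqP; rewrite eqn_leq hi2 andbT -ltnS.
  by move: (fbelow_lt bij); rewrite ei ltnn.
move=> /and3P[hi1 hj1]; move=> hb.
rewrite -(subnKC hi1) -(subnKC hj1) !n3; apply: h3 => //; last lia.
  by lia.
Qed.

Lemma nseq_rcons (T : Type) n (x : T) : rcons (nseq n x) x = nseq n.+1 x.
Proof. by rewrite -cats1 -(nseqD _ 1) addn1. Qed.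

Lemma fmasks_size F m : m \in fmasks F -> size m = fsize F.
Proof.
elim/forest_ind: F m => [|H F IH IF] m; first by rewrite inE => /eqP ->.
rewrite fmasks_cons => /allpairsP[[m1 m2]] /= [h1 /IF s2 ->].
rewrite size_cat s2 fsize_cons -addSn; congr addn.
move: h1; rewrite inE => /orP[/eqP ->|/mapP[m' /IH <- ->]]; first by rewrite /= size_nseq.
by rewrite size_rcons.
Qed.

Lemma mem_fmasks F m : (m \in fmasks F) = (size m == fsize F) && ncompat F m.
Proof.
elim/forest_ind: F m => [|H F IH IF] m.
  rewrite inE -size_eq0 /=; case: eqP => //= _.
  by apply/esym/ncompatP.
apply/idP/andP => [hm|[/eqP sm]].
  have sm := fmasks_size hm; split; first exact/eqP.
  move: hm; rewrite fmasks_cons => /allpairsP[[m1 m2]] /= [h1 h2 em].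
  have s2 := fmasks_size h2.
  move: h2; rewrite IF s2 eqxx /= => c2.
  move: h1; rewrite inE => /orP[/eqP e1|/mapP[m' h' e1]].
    move: em; rewrite e1 -[false :: _]/(nseq (fsize H).+1 false) -nseq_rcons.
    move=> ->; rewrite ncompat_cons ?size_nseq // c2 andbT all_nseq orbT /=.
    by apply/ncompatP => i j hi hj; rewrite !nth_nseq hi hj.
  rewrite em e1 ncompat_cons ?(fmasks_size h') // c2 andbT /=.
  by have := IH m'; rewrite h' => /esym/andP[].
rewrite -[m](cat_take_drop (fsize H).+1).
have : size (take (fsize H).+1 m) = (fsize H).+1.
  by rewrite size_takel // sm fsize_cons; lia.
have : size (drop (fsize H).+1 m) = fsize F.
  by rewrite size_drop sm fsize_cons; lia.
move: (take _ _) (drop _ _) => m1 m2 s2.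
case/lastP: m1 => // m' b; rewrite size_rcons => -[s1].
rewrite ncompat_cons // => /and3P[hb h1 h2].
rewrite fmasks_cons; apply/allpairsP; exists (rcons m' b, m2) => /=.
rewrite IF s2 eqxx h2; split=> //.
case: b hb => /= hb; rewrite inE; apply/orP.
  by right; apply: map_f; rewrite IH s1 eqxx.
left; apply/eqP; rewrite -[false :: _]/(nseq (fsize H).+1 false) -nseq_rcons.
congr rcons; rewrite -s1; move: hb; elim: (m') => //= b s IHs /andP[/negbTE -> /IHs <-].
by [].
Qed.

Lemma fmasks_uniq F : uniq (fmasks F).
Proof.
elim/forest_ind: F => [//|H F IH IF]; rewrite fmasks_cons.
apply: allpairs_uniq => //.
  rewrite cons_uniq map_inj_uniq ?IH ?andbT; last by move=> a b /rcons_inj[].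
  apply/mapP => -[m _]; rewrite -nseq_rcons.
  by move=> /rcons_inj[].
have s1 (m : bitseq) : m \in nseq (fsize H).+1 false :: [seq rcons m true | m <- fmasks H] ->
   size m = (fsize H).+1.
  rewrite inE => /orP[/eqP ->|/mapP[m' /fmasks_size <- ->]]; rewrite /= ?size_nseq ?size_rcons //.
move=> a b /allpairsP[a' [ha _ ->]] /allpairsP[b' [hb _ ->]].
rewrite /uncurry => /eqP; rewrite eqseq_cat; last by rewrite (s1 _ ha) (s1 _ hb).
by move=> /andP[/eqP -> /eqP ->].
Qed.

Lemma frestrict_cons H F m b m2 : size m = fsize H ->
  frestrict (Bplus H :: F) (rcons m b ++ m2) =
  (if b then [:: Bplus (frestrict H m)] else frestrict H m) ++ frestrict F m2.
Proof.
move=> sm; rewrite /frestrict /=.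
rewrite (_ : take _ _ = rcons m b); last by rewrite take_size_cat // size_rcons sm.
rewrite (_ : drop _ _ = m2); last by rewrite drop_size_cat // size_rcons sm.
rewrite nth_rcons sm ltnn eqxx.
by rewrite (_ : take _ _ = m) // -cats1 -/(fsize H) take_size_cat.
Qed.

Lemma frestrict_nseq F b : frestrict F (nseq (fsize F) b) = if b then F else [::].
Proof.
elim/forest_ind: F => [|H F IH IF]; first by case: b.
rewrite fsize_cons -addSn nseqD -(addn1 (fsize H)) nseqD cats1.
rewrite frestrict_cons ?size_nseq // IH IF.
by case: b {IH IF}.
Qed.

Lemma sum_fmasks (V : nmodType) (h : forest -> forest -> V) F :
  \sum_(m <- fmasks F) h (frestrict F (map negb m)) (frestrict F m) =
  \sum_(p <- fcuts F) h p.1 p.2.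
Proof.
elim/forest_ind: F h => [|H F IH IF] h; first by rewrite !big_seq1.
rewrite fmasks_cons fcuts_cons !big_allpairs_dep /tcuts !big_cons !big_map.
congr (_ + _).
  rewrite -[RHS](IF (fun a b => h (Bplus H :: a) b)); apply: eq_bigr => m _.
  rewrite -nseq_rcons map_cat map_rcons map_nseq !frestrict_cons ?size_nseq //=.
  by rewrite !frestrict_nseq.
rewrite -[RHS](IH (fun a b => \sum_(q <- fcuts F) h (a ++ q.1) (Bplus b :: q.2))).
rewrite big_seq [RHS]big_seq; apply: eq_bigr => m /fmasks_size sm.
rewrite -[RHS](IF (fun a b => h (_ ++ a) (_ :: b))); apply: eq_bigr => m2 _.
by rewrite map_cat map_rcons !frestrict_cons ?size_map.
Qed.

(** Reading a compatible word in postorder amounts to choosing a cut, the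
    letters 2 marking the trunk. *)
Lemma convE (A : nzRingType) (x y : forest -> A) F :
  conv x y F = \sum_(p <- fcuts F) x p.1 * y p.2.
Proof.
rewrite -[RHS](sum_fmasks (fun a b => x a * y b)) /conv.
pose s : seq bitseq := map (@tval _ _)
  (filter (fun u : (fsize F).-tuple bool => ncompat F u) (enum {: (fsize F).-tuple bool})).
have hs : perm_eq (fmasks F) s.
  apply: uniq_perm; first exact: fmasks_uniq.
    rewrite map_inj_uniq; last by move=> a b /val_inj.
    by apply/filter_uniq/enum_uniq.
  move=> m; rewrite mem_fmasks; apply/andP/mapP => [[sm cm]|[u]].
    by exists (Tuple sm); rewrite // mem_filter cm mem_enum.
  by rewrite mem_filter => /andP[cu _] ->; rewrite size_tuple.
by rewrite (perm_big _ hs) big_map big_filter big_enum_cond.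
Qed.

Lemma fcuts0 : fcuts [::] = [:: ([::], [::])]. Proof. by []. Qed.

Lemma sum_tcuts (V : nmodType) (h : forest -> forest -> V) H c :
  \sum_(t <- tcuts H c) h t.1 t.2 =
  h [:: Bplus H] [::] + \sum_(p <- c) h p.1 [:: Bplus p.2].
Proof. by rewrite big_cons big_map. Qed.

Lemma sum_fcuts_cat (V : nmodType) (h : forest -> forest -> V) F G :
  \sum_(p <- fcuts (F ++ G)) h p.1 p.2 =
  \sum_(p <- fcuts F) \sum_(q <- fcuts G) h (p.1 ++ q.1) (p.2 ++ q.2).
Proof.
elim/forest_ind: F h => [|H F IH IF] h; first by rewrite big_seq1.
rewrite cat_cons !fcuts_cons !big_allpairs_dep; apply: eq_bigr => t _ /=.
rewrite (IF (fun a b => h (t.1 ++ a) (t.2 ++ b))); apply: eq_bigr => p _.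
by apply: eq_bigr => q _; rewrite !catA.
Qed.

Lemma sum_fcuts1 (V : nmodType) (h : forest -> forest -> V) H :
  \sum_(p <- fcuts [:: Bplus H]) h p.1 p.2 =
  h [:: Bplus H] [::] + \sum_(p <- fcuts H) h p.1 [:: Bplus p.2].
Proof.
rewrite fcuts_cons big_allpairs_dep /tcuts big_cons big_map /= big_seq1.
by congr (_ + _); apply: eq_bigr => p _; rewrite big_seq1 /= cats0.
Qed.

Lemma fcuts_size F : all (fun p => fsize p.1 + fsize p.2 == fsize F)%N (fcuts F).
Proof.
elim/forest_ind: F => [//|H F IH IF]; apply/allP => p.
rewrite fcuts_cons => /allpairsP[[t c]] /= [ht /(allP IF)/eqP hc ->] /=.
rewrite !fsize_cat fsize_cons -hc.
move: ht; rewrite inE => /orP[/eqP ->|/mapP[q /(allP IH)/eqP hq ->]] /=.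
  by rewrite !fsize_cons; apply/eqP; rewrite /fsize /=; lia.
by rewrite -hq fsize_cons; apply/eqP; rewrite /fsize /=; lia.
Qed.

Lemma fcutsA (V : nmodType) (h : forest -> forest -> forest -> V) F :
  \sum_(p <- fcuts F) \sum_(q <- fcuts p.1) h q.1 q.2 p.2 =
  \sum_(p <- fcuts F) \sum_(q <- fcuts p.2) h p.1 q.1 q.2.
Proof.
elim/forest_ind: F h => [|H F IH IF] h; first by rewrite !(fcuts0, big_seq1).
have tA (k : forest -> forest -> forest -> V) :
    \sum_(t <- tcuts H (fcuts H)) \sum_(q <- fcuts t.1) k q.1 q.2 t.2 =
    \sum_(t <- tcuts H (fcuts H)) \sum_(q <- fcuts t.2) k t.1 q.1 q.2.
  rewrite (sum_tcuts (fun a b => \sum_(q <- fcuts a) k q.1 q.2 b)).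
  rewrite (sum_tcuts (fun a b => \sum_(q <- fcuts b) k a q.1 q.2)).
  rewrite fcuts0 big_seq1 (sum_fcuts1 (fun a b => k a b [::])).
  rewrite -addrA; congr (_ + _).
  under [RHS]eq_bigr do rewrite (sum_fcuts1 (k _)).
  by rewrite big_split /= (IH (fun a b c => k a b [:: Bplus c])).
rewrite fcuts_cons !big_allpairs_dep /=.
transitivity (\sum_(t <- tcuts H (fcuts H)) \sum_(q <- fcuts t.1)
   \sum_(c <- fcuts F) \sum_(q2 <- fcuts c.2)
     h (q.1 ++ c.1) (q.2 ++ q2.1) (t.2 ++ q2.2)).
  apply: eq_bigr => t _.
  under eq_bigr do rewrite (sum_fcuts_cat (fun a b => h a b _)).
  rewrite exchange_big; apply: eq_bigr => q _ /=.
  by rewrite (IF (fun a b c => h (q.1 ++ a) (q.2 ++ b) (t.2 ++ c))).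
rewrite (tA (fun a b d => \sum_(c <- fcuts F) \sum_(q2 <- fcuts c.2)
     h (a ++ c.1) (b ++ q2.1) (d ++ q2.2))).
apply: eq_bigr => t _; rewrite exchange_big; apply: eq_bigr => c _.
by rewrite (sum_fcuts_cat (fun a b => h _ a b)).
Qed.

Lemma fcuts1l (V : nmodType) (h : forest -> V) F :
  \sum_(p <- fcuts F | fsize p.1 == 0%N) h p.2 = h F.
Proof.
rewrite big_mkcond; elim/forest_ind: F h => [|H F IH IF] h; first by rewrite big_seq1.
rewrite fcuts_cons big_allpairs_dep /tcuts big_cons big_map /= big1 ?add0r //
  -[RHS](IH (fun G => h (Bplus G :: F))).
apply: eq_bigr => p _ /=; rewrite -(IF (fun G => h (Bplus p.2 :: G))).
case: eqP => [p0|p0]; last by rewrite big1 // => q _; case: eqP => //; rewrite fsize_cat; lia.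
by apply: eq_bigr => q _; rewrite fsize_cat p0.
Qed.

Lemma fcuts1r (V : nmodType) (h : forest -> V) F :
  \sum_(p <- fcuts F | fsize p.2 == 0%N) h p.1 = h F.
Proof.
rewrite big_mkcond; elim/forest_ind: F h => [|H F IH IF] h; first by rewrite big_seq1.
rewrite fcuts_cons big_allpairs_dep /tcuts big_cons big_map /= [X in _ + X]big1; last first.
  by move=> p _; rewrite big1.
by rewrite addr0 -[RHS](IF (fun G => h (Bplus H :: G))).
Qed.

Definition forest_coalg : coalg :=
  @Coalg forest fsize fcuts fcuts_size fcutsA fcuts1l fcuts1r.

(** * Unshuffles of words *)

Section Unshuffle.
Context {A : eqType}.

(** The two complementary subwords (u, v) of w, for each set of positions. *)
Fixpoint unsh (w : seq A) : seq (seq A * seq A) :=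
  if w is x :: w' then
    [seq (x :: p.1, p.2) | p <- unsh w'] ++ [seq (p.1, x :: p.2) | p <- unsh w']
  else [:: ([::], [::])].

Lemma sum_unsh_cons (V : nmodType) (h : seq A -> seq A -> V) x w :
  \sum_(p <- unsh (x :: w)) h p.1 p.2 =
  \sum_(p <- unsh w) h (x :: p.1) p.2 + \sum_(p <- unsh w) h p.1 (x :: p.2).
Proof. by rewrite big_cat !big_map. Qed.

Lemma sum_unsh_rcons (V : nmodType) (h : seq A -> seq A -> V) x w :
  \sum_(p <- unsh (rcons w x)) h p.1 p.2 =
  \sum_(p <- unsh w) h (rcons p.1 x) p.2 + \sum_(p <- unsh w) h p.1 (rcons p.2 x).
Proof.
elim: w h => [|y w IH] h; first by rewrite !big_cons !big_nil !addr0.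
rewrite rcons_cons sum_unsh_cons (IH (fun a b => h (y :: a) b)) (IH (fun a b => h a (y :: b))).
rewrite (sum_unsh_cons (fun a b => h (rcons a x) b)).
rewrite (sum_unsh_cons (fun a b => h a (rcons b x))) /=.
by rewrite addrACA.
Qed.

Lemma unsh_size w : all (fun p => size p.1 + size p.2 == size w)%N (unsh w).
Proof.
elim: w => [//|x w IH]; rewrite /= all_cat !all_map; apply/andP.
by split; apply: sub_all IH => p /= /eqP <-; rewrite ?addSn ?addnS.
Qed.

Lemma unshA (V : nmodType) (h : seq A -> seq A -> seq A -> V) w :
  \sum_(p <- unsh w) \sum_(q <- unsh p.1) h q.1 q.2 p.2 =
  \sum_(p <- unsh w) \sum_(q <- unsh p.2) h p.1 q.1 q.2.
Proof.
elim: w h => [|x w IH] h; first by rewrite /= !big_seq1 /= ?big_seq1.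
rewrite (sum_unsh_cons (fun a b => \sum_(q <- unsh a) h q.1 q.2 b)).
rewrite (sum_unsh_cons (fun a b => \sum_(q <- unsh b) h a q.1 q.2)).
under eq_bigr do rewrite (sum_unsh_cons (fun a b => h a b _)).
under [X in _ = _ + X]eq_bigr do rewrite (sum_unsh_cons (h _)).
rewrite !big_split /= (IH (fun a b c => h (x :: a) b c)) (IH (fun a b c => h a (x :: b) c)).
by rewrite (IH (fun a b c => h a b (x :: c))) addrA.
Qed.

Lemma unshC (V : nmodType) (h : seq A -> seq A -> V) w :
  \sum_(p <- unsh w) h p.1 p.2 = \sum_(p <- unsh w) h p.2 p.1.
Proof.
elim: w h => [|x w IH] h; first by rewrite !big_seq1.
rewrite sum_unsh_cons (sum_unsh_cons (fun a b => h b a)) addrC.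
by rewrite (IH (fun a b => h a (x :: b))) (IH (fun a b => h (x :: a) b)).
Qed.

Lemma unsh1l (V : nmodType) (h : seq A -> V) w :
  \sum_(p <- unsh w | size p.1 == 0%N) h p.2 = h w.
Proof.
rewrite big_mkcond; elim: w h => [|x w IH] h; first by rewrite big_seq1.
rewrite (sum_unsh_cons (fun a b => if size a == 0%N then h b else 0)) /=.
by rewrite big1 // add0r (IH (fun b => h (x :: b))).
Qed.

Lemma unsh1r (V : nmodType) (h : seq A -> V) w :
  \sum_(p <- unsh w | size p.2 == 0%N) h p.1 = h w.
Proof.
rewrite -[RHS]unsh1l big_mkcond [RHS]big_mkcond.
by rewrite (unshC (fun a b => if size b == 0%N then h a else 0)).
Qed.

Definition word_coalg : coalg :=
  @Coalg (seq A) size unsh unsh_size unshA unsh1l unsh1r.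
End Unshuffle.
Arguments word_coalg : clear implicits.

(** * Compositions *)

Definition hincr (J : seq nat) := if J is i :: J' then i.+1 :: J' else [::].

Fixpoint comps (n : nat) : seq (seq nat) :=
  if n is n'.+1 then
    [seq 1%N :: J | J <- comps n'] ++ (if n' is 0 then [::] else map hincr (comps n'))
  else [:: [::]].

Lemma mem_comps n I : (I \in comps n) = (0%N \notin I) && (sumn I == n).
Proof.
elim: n I => [|n IH] I; first by case: I => [|[|i] I]; rewrite // inE /= ?inE ?eqxx ?andbF.
rewrite [comps _]/= mem_cat; apply/orP/andP.
  case=> [/mapP[J]|].
    by rewrite IH => /andP[h1 /eqP h2] ->; rewrite inE /= (negPf h1) h2.
  case: n IH => [//|n] IH /mapP[[|i J]]; rewrite IH ?andbF // => /andP[h1 /eqP h2] ->.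
  by move: h1 h2; rewrite !inE !negb_or /= => /andP[_ ->] <-.
case: I => [[_]|[|[|i]] I []]; rewrite ?inE //= => h1 /eqP[h2].
  by left; apply: map_f; rewrite IH h1; apply/eqP.
right; case: n IH h2 => [//|n] IH h2; apply/mapP; exists (i.+1 :: I) => //.
by rewrite IH inE negb_or h1; apply/eqP.
Qed.

Lemma comps_uniq n : uniq (comps n).
Proof.
elim: n => [//|n IH]; rewrite [comps _]/= cat_uniq map_inj_uniq ?IH /= => [|a b []//].
case: n IH => [//|n] IH; apply/andP; split.
  apply/hasPn => I /mapP[[|i J] hJ ->]; first by move: hJ; rewrite mem_comps.
  apply/mapP => -[J' _] [i0 _]; move: hJ.
  by rewrite i0 mem_comps inE.
rewrite map_inj_in_uniq // => [[|i a]] [|j b]; rewrite !mem_comps //= => _ _.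
by case=> -> ->.
Qed.

Lemma sum_comps_last (V : nmodType) (g : seq nat -> V) n :
  \sum_(I <- comps n) g I =
  (if n == 0%N then g [::] else 0)
  + \sum_(k <- iota 1 n) \sum_(J <- comps (n - k)) g (rcons J k).
Proof.
case: n => [|n]; first by rewrite big_seq1 big_nil addr0.
rewrite add0r.
pose s := [seq rcons J k | k <- iota 1 n.+1, J <- comps (n.+1 - k)].
rewrite (perm_big s).
  by rewrite /s big_allpairs_dep.
apply: uniq_perm; first exact: comps_uniq.
  apply: allpairs_uniq_dep; first exact: iota_uniq.
    by move=> k _; apply: comps_uniq.
  by move=> [k J] [k' J'] _ _ /= /rcons_inj[-> ->].
move=> I; rewrite mem_comps; apply/andP/allpairsPdep.
  case/lastP: I => [[]//|J k [h1 /eqP]].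
  rewrite sumn_rcons => h2.
  move: h1; rewrite mem_rcons inE negb_or => /andP[h3 h4]; exists k, J.
  rewrite mem_iota mem_comps h4; split=> //; last by apply/eqP; lia.
  by move: h3 h2; case: k => //= k _; lia.
move=> [k [J]] []; rewrite mem_iota mem_comps => hk /andP[h1 /eqP h2] ->.
rewrite mem_rcons inE negb_or h1 andbT sumn_rcons h2.
by split; [case: k hk {h2}|apply/eqP; lia].
Qed.

(** * The subalgebra generated by the complete functions *)

Section Complete.
Context {C : coalg} {L : comNzRingType} {B : lalgType L} (s : cfun C B).
Hypothesis s1 : forall x, cosz x = 0%N -> s x = 1.
Hypothesis scAr : forall (c : L) (x y : B), x * (c *: y) = c *: (x * y).

Definition Sn (k : nat) : cfun C B := fun x => if cosz x == k then s x else 0.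
Definition Sprod (I : seq nat) : cfun C B := \prod_(i <- I) Sn i.

Lemma Sn0 : Sn 0 = 1.
Proof.
apply/funext => x; rewrite /Sn cfun1; case: eqP => // h; exact: s1.
Qed.

Lemma Sprod_rcons I k : Sprod (rcons I k) = Sprod I * Sn k.
Proof. by rewrite /Sprod big_rcons. Qed.

(** The series of the c_I S^I.  The seed s is what the complete functions do in
    degree n: it is 1 on forests and sends a word to itself on words, so that
    one family of coefficients describes both realisations of Sym. *)
Definition Ssum (c : seq nat -> L) : cfun C B :=
  fun x => \sum_(I <- comps (cosz x)) c I *: Sprod I x.

Definition sigma (a : L) : cfun C B := fun x => a ^+ cosz x *: s x.

(** The last factor S_k of S^I is the contribution of degree k of sigma. *)
Lemma Ssum_sigma (a : L) (cm cp : seq nat -> L) : cp [::] = cm [::] ->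
  (forall J k, cp (rcons J k) = cm (rcons J k) + a ^+ k * cm J) ->
  Ssum cp = Ssum cm * sigma a.
Proof.
move=> c0 cr; apply/funext => x; rewrite cmulE.
transitivity (\sum_(k < (cosz x).+1) a ^+ k *: \sum_(J <- comps (cosz x - k))
     cm J *: (Sprod J * Sn k) x).
  rewrite big_ord_recl subn0 expr0 scale1r Sn0.
  under [X in _ = X + _]eq_bigr do rewrite mulr1.
  rewrite -(big_mkord xpredT (fun k => a ^+ k.+1 *:
    \sum_(J <- comps (cosz x - k.+1)) cm J *: (Sprod J * Sn k.+1) x)).
  rewrite -(big_add1 _ _ 0 (cosz x).+1 xpredT (fun k => a ^+ k *:
    \sum_(J <- comps (cosz x - k)) cm J *: (Sprod J * Sn k) x)).
  rewrite /index_iota subSS subn0.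
  rewrite /Ssum !(sum_comps_last (fun I => _ *: Sprod I x)).
  rewrite -addrA; congr (_ + _); first by rewrite c0.
  rewrite -big_split /=; apply: eq_bigr => k _.
  rewrite scaler_sumr -big_split /=; apply: eq_bigr => J _.
  by rewrite cr scalerDl -scalerA Sprod_rcons.
under eq_bigr do rewrite scaler_sumr.
rewrite (eq_bigr (fun k : 'I_(cosz x).+1 => \sum_(p <- cocut x)
   if cosz p.2 == k then Ssum cm p.1 * sigma a p.2 else 0)); last first.
  move=> k _; under eq_bigr do rewrite cmulE !scaler_sumr.
  rewrite exchange_big /= big_seq [RHS]big_seq; apply: eq_bigr => p.
  move=> /(allP (cosz_cut x))/eqP hp.
  rewrite /Sn; case: eqP => e; last by rewrite big1 // => *; rewrite mulr0 !scaler0.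
  rewrite /Ssum /sigma mulr_suml (_ : cosz p.1 = (cosz x - k)%N); last by lia.
  by apply: eq_bigr => J _; rewrite scAr -scalerAl e.
rewrite exchange_big big_seq [RHS]big_seq; apply: eq_bigr => p.
move=> /(allP (cosz_cut x))/eqP hp.
have hk : (cosz p.2 < (cosz x).+1)%N by lia.
rewrite (bigD1 (Ordinal hk)) //= eqxx big1 ?addr0 // => k.
by rewrite -val_eqE eq_sym /= => /negPf ->.
Qed.

End Complete.

(** * Up-sets of the Tamari order *)

(** The last i trees of a forest are grafted on a new root, for every i; in
    particular i = 0 adds a single vertex. *)
Definition utree (uH : seq forest) : seq forest :=
  [seq rcons (take i G) (Bplus (drop i G)) | G <- uH, i <- iota 0 (size G).+1].

(** The forests above F: above a single tree B_+(H) lie the forests obtained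
    from a forest above H by grafting some of its last trees on a new root. *)
Definition up : forest -> seq forest :=
  ffold [:: [::]] (fun _ uH uF => [seq G1 ++ G2 | G1 <- utree uH, G2 <- uF]).
Arguments up : simpl never.

Lemma up_cons H F :
  up (Bplus H :: F) = [seq G1 ++ G2 | G1 <- utree (up H), G2 <- up F].
Proof. by []. Qed.

Lemma up0 : up [::] = [:: [::]]. Proof. by []. Qed.

Lemma mem_utree uH G : reflect
  (exists L R, G = rcons L (Bplus R) /\ L ++ R \in uH) (G \in utree uH).
Proof.
apply: (iffP allpairsPdep) => [[G' [i [h1 _ ->]]]|[L [R [-> h]]]].
  by exists (take i G'), (drop i G'); rewrite cat_take_drop.
exists (L ++ R), (size L); rewrite take_size_cat // drop_size_cat // mem_iota.
by rewrite h size_cat ltnS leq_addr.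
Qed.

Definition fcov (F G : forest) := tamari_cover (Bplus F) (Bplus G).

Lemma fcovP F G : fcov F G ->
  (exists L s cs R, F = L ++ Bplus (s :: cs) :: R /\ G = L ++ s :: Bplus cs :: R) \/
  (exists L H H' R, [/\ F = L ++ Bplus H :: R, G = L ++ Bplus H' :: R & fcov H H']).
Proof.
rewrite /fcov; move e1 : (Bplus F) => t; move e2 : (Bplus G) => t' c.
case: c e1 e2 => [L s cs R [->] [->]|L [H] [H'] R c [->] [->]].
  by left; exists L, s, cs, R.
by right; exists L, H, H', R.
Qed.

Lemma fcov_catl A B B' : fcov B B' -> fcov (A ++ B) (A ++ B').
Proof.
case/fcovP => [[L [s [cs [R [-> ->]]]]]|[L [H [H' [R [-> -> c]]]]]]; rewrite !catA.
  exact: TamariHere.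
exact: TamariBelow.
Qed.

Lemma fcov_catr A A' B : fcov A A' -> fcov (A ++ B) (A' ++ B).
Proof.
case/fcovP => [[L [s [cs [R [-> ->]]]]]|[L [H [H' [R [-> -> c]]]]]]; rewrite -!catA /=.
  exact: TamariHere.
exact: TamariBelow.
Qed.

Lemma cat_cons_split (T : Type) (L R A B : seq T) t : L ++ t :: R = A ++ B ->
  (exists R1, A = L ++ t :: R1 /\ R = R1 ++ B) \/
  (exists L1, L = A ++ L1 /\ B = L1 ++ t :: R).
Proof.
elim: A L => [|a A IH] [|l L] /=.
- by move=> <-; right; exists [::].
- by move=> <-; right; exists (l :: L).
- by case=> -> ->; left; exists A.
case=> -> /IH[[R1 [-> ->]]|[L1 [-> ->]]]; first by left; exists R1.
by right; exists L1.
Qed.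

Lemma fcov_cat A B C : fcov (A ++ B) C ->
  (exists A', fcov A A' /\ C = A' ++ B) \/ (exists B', fcov B B' /\ C = A ++ B').
Proof.
case/fcovP => [[L [s [cs [R [e ->]]]]]|[L [H [H' [R [e -> c]]]]]].
  case: (cat_cons_split (esym e)) => [[R1 [-> ->]]|[L1 [-> ->]]].
    left; exists (L ++ s :: Bplus cs :: R1); rewrite -catA; split=> //.
    exact: TamariHere.
  right; exists (L1 ++ s :: Bplus cs :: R); rewrite -catA; split=> //.
  exact: TamariHere.
case: (cat_cons_split (esym e)) => [[R1 [-> ->]]|[L1 [-> ->]]].
  left; exists (L ++ Bplus H' :: R1); rewrite -catA; split=> //.
  exact: TamariBelow.
right; exists (L1 ++ Bplus H' :: R); rewrite -catA; split=> //.
exact: TamariBelow.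
Qed.

Lemma fcov0 C : ~ fcov [::] C.
Proof. by case/fcovP => [[[|? ?] [? [? [? []]]]]|[[|? ?] [? [? [? []]]]]]. Qed.

Lemma fcov_tree H C : fcov [:: Bplus H] C ->
  (exists s cs, H = s :: cs /\ C = [:: s; Bplus cs]) \/
  (exists H', fcov H H' /\ C = [:: Bplus H']).
Proof.
have nil2 (L R : forest) t : [:: Bplus H] = L ++ t :: R -> [/\ L = [::], R = [::] & t = Bplus H].
  by case: L => [|? [|? ?]] // [<- <-].
case/fcovP => [[L [s [cs [R [e ->]]]]]|[L [K [H' [R [e -> c]]]]]].
  by case: (nil2 _ _ _ e) => -> -> [<-]; left; exists s, cs.
by case: (nil2 _ _ _ e) => -> -> [eK]; right; exists H'; rewrite -eK.
Qed.

(** In a forest L B_+(R) with L R above H, a cover is a cover of L, or a cover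
    of R, or moves the first tree of R to the end of L; correspondingly, L R
    undergoes a cover or stays the same. *)
Lemma up_cover F G G' : G \in up F -> fcov G G' -> G' \in up F.
Proof.
elim/forest_ind: F G G' => [|H F IH IF] G G'.
  by rewrite up0 inE => /eqP -> /fcov0.
rewrite up_cons => /allpairsP[[G1 G2]] /= [/mem_utree[L [R [e1 hLR]]] h2 ->].
case/fcov_cat => [[A' [c ->]]|[B' [/(IF _ _ h2) h2' ->]]]; last first.
  apply/allpairsP; exists (G1, B'); split=> //=.
  by apply/mem_utree; exists L, R.
apply/allpairsP; exists (A', G2); split=> //=; apply/mem_utree.
move: c; rewrite e1 -cats1 => /fcov_cat[[L' [c ->]]|[B' [c ->]]].
  by exists L', R; rewrite cats1; split=> //; apply: IH hLR _; apply: fcov_catr.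
case/fcov_tree: c hLR => [[s [cs [-> ->]]]|[R' [c ->]]] hLR.
  by exists (rcons L s), cs; rewrite -!cats1 -!catA.
by exists L, R'; rewrite cats1; split=> //; apply: IH hLR _; apply: fcov_catl.
Qed.

Lemma up_refl F : F \in up F.
Proof.
elim/forest_ind: F => [//|H F IH IF]; rewrite up_cons.
apply/allpairsP; exists ([:: Bplus H], F); split=> //=.
by apply/mem_utree; exists [::], H.
Qed.

Definition fle := clos_refl_trans forest fcov.

Lemma forest_leE F G : forest_le F G <-> fle F G.
Proof.
pose unB t := let: Bplus F := t in F.
split.
  have h t t' : tamari_le t t' -> fle (unB t) (unB t').
    elim=> [[F'] [G'] c|[F']|? ? ? _ h1 _ h2]; first exact: rt_step.
      exact: rt_refl.
    exact: rt_trans h1 h2.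
  exact: h.
elim=> [F' G' c|F'|? ? ? _ h1 _ h2]; first exact: rt_step.
  exact: rt_refl.
exact: rt_trans h1 h2.
Qed.

Lemma fle_map (f : forest -> forest) F G :
  (forall F G, fcov F G -> fcov (f F) (f G)) -> fle F G -> fle (f F) (f G).
Proof.
move=> hf; elim=> [F' G' c|F'|? ? ? _ h1 _ h2]; first exact/rt_step/hf.
  exact: rt_refl.
exact: rt_trans h1 h2.
Qed.

(** The trees of L leave B_+(L R) one at a time, each by a cover. *)
Lemma fle_rot L R : fle [:: Bplus (L ++ R)] (rcons L (Bplus R)).
Proof.
elim: L => [|s L IH]; first exact: rt_refl.
apply: (@rt_trans _ _ _ (s :: [:: Bplus (L ++ R)])).
  by apply: rt_step; apply: (@TamariHere [::] s (L ++ R) [::]).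
by apply: (@fle_map (cons s)) IH => F G; apply: (@fcov_catl [:: s]).
Qed.

Lemma up_le F G : G \in up F -> fle F G.
Proof.
elim/forest_ind: F G => [|H F IH IF] G.
  by rewrite up0 inE => /eqP ->; apply: rt_refl.
rewrite up_cons => /allpairsP[[G1 G2]] /= [/mem_utree[L [R [e1 hLR]]] h2 ->].
apply: (@rt_trans _ _ _ (Bplus H :: G2)).
  by apply: (@fle_map (cons (Bplus H))) (IF _ h2) => A B; apply: (@fcov_catl [:: _]).
apply: (@fle_map (cat^~ G2) [:: Bplus H]) => [A B|]; first exact: fcov_catr.
apply: (@rt_trans _ _ _ [:: Bplus (L ++ R)]); last by rewrite e1; apply: fle_rot.
apply: (@fle_map (fun X => [:: Bplus X])) (IH _ hLR) => A B c.
exact: (@TamariBelow [::] _ _ [::]).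
Qed.

Lemma mem_up F G : forest_le F G <-> G \in up F.
Proof.
rewrite forest_leE; split=> [h|]; last exact: up_le.
suff step A B K : fle A B -> A \in up K -> B \in up K by apply: step h (up_refl F).
by elim=> [A' B' c|//|A' B' D _ h1 _ h2 /h1/h2//]; move=> /up_cover; apply.
Qed.

Lemma up_size F G : G \in up F -> fsize G = fsize F.
Proof.
elim/forest_ind: F G => [|H F IH IF] G; first by rewrite up0 inE => /eqP ->.
rewrite up_cons => /allpairsP[[G1 G2]] /= [/mem_utree[L [R [-> /IH hLR]]] /IF h2 ->].
move: hLR; rewrite fsize_cat fsize_cons -h2 -cats1 !fsize_cat fsize_cons /= => <-.
by rewrite addn0 addnS.
Qed.

Lemma tsize_gt0 t : (0 < Defs.tsize t)%N. Proof. by case: t. Qed.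

Lemma cat_fsize_inj A B A' B' : A ++ B = A' ++ B' -> fsize A = fsize A' ->
  A = A' /\ B = B'.
Proof.
elim: A A' => [|a A IH] [|a' A'] //=.
- by move=> _; rewrite /fsize /=; have := tsize_gt0 a'; lia.
- by move=> _; rewrite /fsize /=; have := tsize_gt0 a; lia.
case=> -> h; rewrite /fsize /= => /addnI e.
by case: (IH _ h e) => -> ->.
Qed.

Lemma up_uniq F : uniq (up F).
Proof.
elim/forest_ind: F => [//|H F IH IF]; rewrite up_cons.
apply: allpairs_uniq => //.
  apply: allpairs_uniq_dep => // [G _|]; first exact: iota_uniq.
  move=> [G i] [G' i'] /allpairsPdep[x [y [_ hi [-> ->]]]].
  case/allpairsPdep => [x' [y' [_ hi' [-> ->]]]] /= /rcons_inj[e1 [e2]].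
  have ex : x = x' by rewrite -(cat_take_drop y x) e1 e2 cat_take_drop.
  move: hi hi' e1; rewrite -ex !mem_iota !add0n !ltnS /= => hi hi' /(congr1 size).
  by rewrite !size_takel // => ->.
have s1 G : G \in utree (up H) -> fsize G = (fsize H).+1.
  move=> hG; have := @up_size [:: Bplus H] G; rewrite up_cons fsize_cons addn0; apply.
  by apply/allpairsP; exists (G, [::]); rewrite up0 cats0.
move=> a b /allpairsP[a' [ha _ ->]] /allpairsP[b' [hb _ ->]].
rewrite /uncurry => e.
by case: (cat_fsize_inj e) => [|-> ->//]; rewrite (s1 _ ha) (s1 _ hb).
Qed.

(** * Laurent series *)

Section Laurent.
Context {K : comNzRingType}.
Implicit Types (f g : laurent K) (m n : int).

Lemma lcoef0 m : lcoef (0 : laurent K) m = 0. Proof. exact: if_same. Qed.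
Lemma lcoef1 m : lcoef (1 : laurent K) m = (m == 0)%:R.
Proof. by rewrite /=; case: eqP. Qed.
Lemma lcoefD f g m : lcoef (f + g) m = lcoef f m + lcoef g m. Proof. by []. Qed.
Lemma lcoefN f m : lcoef (- f) m = - lcoef f m. Proof. by []. Qed.
Lemma lcoefB f g m : lcoef (f - g) m = lcoef f m - lcoef g m. Proof. by []. Qed.
Lemma lcoefM f g m :
  lcoef (f * g) m = \sum_(i \in [set: int]%classic) lcoef f i * lcoef g (m - i).
Proof. by []. Qed.
Lemma lcoef_sum (J : Type) (r : seq J) (P : pred J) (F : J -> laurent K) m :
  lcoef (\sum_(j <- r | P j) F j) m = \sum_(j <- r | P j) lcoef (F j) m.
Proof. by elim/big_rec2: _ => [|j u v _ <-]; rewrite ?lcoef0. Qed.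
Lemma lcoefMn f k m : lcoef (f *+ k) m = lcoef f m *+ k.
Proof. by elim: k => [|k IH]; rewrite ?mulr0n ?lcoef0 // !mulrS lcoefD IH. Qed.

(** No power of z above, respectively below, z^n. *)
Definition ltop n f := forall m, n < m -> lcoef f m = 0.
Definition lbot n f := forall m, m < n -> lcoef f m = 0.

Lemma in_AplusE f : in_Aplus f <-> ltop (-1) f.
Proof. by split=> h m hm; apply: h; lia. Qed.

Lemma ltopW n n' f : n <= n' -> ltop n f -> ltop n' f.
Proof. by move=> nn' h m hm; apply: h; lia. Qed.

Lemma ltop0 n : ltop n 0. Proof. by move=> m _; apply: lcoef0. Qed.
Lemma lbot0 n : lbot n 0. Proof. by move=> m _; apply: lcoef0. Qed.
Lemma ltop1 : ltop 0 1. Proof. by move=> m hm; rewrite lcoef1 gt_eqF. Qed.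
Lemma lbot1 : lbot 0 1. Proof. by move=> m hm; rewrite lcoef1 lt_eqF. Qed.
Lemma ltopD n f g : ltop n f -> ltop n g -> ltop n (f + g).
Proof. by move=> hf hg m hm; rewrite lcoefD hf ?hg ?addr0. Qed.
Lemma lbotD n f g : lbot n f -> lbot n g -> lbot n (f + g).
Proof. by move=> hf hg m hm; rewrite lcoefD hf ?hg ?addr0. Qed.
Lemma ltopN n f : ltop n f -> ltop n (- f).
Proof. by move=> hf m hm; rewrite lcoefN hf ?oppr0. Qed.
Lemma lbotN n f : lbot n f -> lbot n (- f).
Proof. by move=> hf m hm; rewrite lcoefN hf ?oppr0. Qed.

Lemma ltopM n n' f g : ltop n f -> ltop n' g -> ltop (n + n') (f * g).
Proof.
move=> hf hg m hm; rewrite lcoefM; apply: fsbig1 => i _.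
have [hi|hi] := ltP n i; first by rewrite hf ?mul0r.
by rewrite hg ?mulr0 //; lia.
Qed.

Lemma lbotM n n' f g : lbot n f -> lbot n' g -> lbot (n + n') (f * g).
Proof.
move=> hf hg m hm; rewrite lcoefM; apply: fsbig1 => i _.
have [hi|hi] := ltP i n; first by rewrite hf ?mul0r.
by rewrite hg ?mulr0 //; lia.
Qed.

Lemma ltop_lbot0 n n' f : n < n' -> ltop n f -> lbot n' f -> f = 0.
Proof.
move=> nn' ht hb; apply: laurentP => m; rewrite lcoef0.
by have [hm|hm] := ltP n m; [apply: ht|apply: hb; lia].
Qed.

Lemma lmon_bounded (c : K) n :
  exists N : int, forall m : int, m < N -> (if m == n then c else 0) = 0.
Proof. by exists n => m; case: eqP => // ->; rewrite ltxx. Qed.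
Definition lmon (c : K) n : laurent K := Laurent (lmon_bounded c n).

Lemma lcoef_lmon c n m : lcoef (lmon c n) m = if m == n then c else 0.
Proof. by []. Qed.

Lemma lcoef_lmonM c n f m : lcoef (lmon c n * f) m = c * lcoef f (m - n).
Proof.
rewrite lcoefM (fsbigE [:: n]) //=; first by rewrite big_cons big_nil in_setT eqxx addr0.
by move=> i _; rewrite inE => /negPf ->; rewrite mul0r.
Qed.

Lemma lmonM c n c' n' : lmon c n * lmon c' n' = lmon (c * c') (n + n').
Proof.
apply: laurentP => m; rewrite lcoef_lmonM !lcoef_lmon.
rewrite (_ : (m - n == n') = (m == n + n')); last by apply/eqP/eqP; lia.
by case: eqP; rewrite ?mulr0.
Qed.

Lemma lmon1 : lmon 1 0 = 1. Proof. by apply: laurentP. Qed.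

Definition lplus_coef f m := if m < 0 then lcoef f m else 0.
Lemma lplus_bounded f : exists N : int, forall m, m < N -> lplus_coef f m = 0.
Proof.
by have [N hN] := lcoef_bounded f; exists N => m hm; rewrite /lplus_coef hN ?if_same.
Qed.
Definition lplus f : laurent K := Laurent (lplus_bounded f).

Lemma lplus_top f : ltop (-1) (lplus f).
Proof. by move=> m hm; rewrite /= /lplus_coef ifF //; apply/negbTE; lia. Qed.

Lemma lplus_bot f : lbot 0 (f - lplus f).
Proof. by move=> m hm; rewrite lcoefB /= /lplus_coef hm subrr. Qed.

(** Birkhoff coefficients: [bminus a I] and [bplus a I] are the coefficients of
    S^I in the two factors of sigma_a; they are found by reading the last part
    of I, the two projections of the Rota-Baxter algebra acting on scalars. *)
Variable a : laurent K.

Fixpoint bminus_rev (I : seq nat) : laurent K :=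
  if I is k :: J then lplus (a ^+ k * bminus_rev J) - a ^+ k * bminus_rev J else 1.
Definition bminus I := bminus_rev (rev I).
Definition bplus I :=
  if rev I is k :: J then lplus (a ^+ k * bminus_rev J) else 1.

Lemma bplus_rcons J k :
  bplus (rcons J k) = bminus (rcons J k) + a ^+ k * bminus J.
Proof. by rewrite /bplus /bminus rev_rcons /= subrK. Qed.

Lemma bplus_top I : I <> [::] -> ltop (-1) (bplus I).
Proof.
case/lastP: I => [//|I k] _; rewrite /bplus rev_rcons; exact: lplus_top.
Qed.

Lemma bplus_top0 I : ltop 0 (bplus I).
Proof.
have [->|/eqP h] := eqVneq I [::]; first exact: ltop1.
exact: ltopW (bplus_top h).
Qed.

Lemma bminus_bot I : lbot 0 (bminus I).
Proof.
case/lastP: I => [|I k]; first exact: lbot1.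
by rewrite /bminus rev_rcons /= -opprB; apply/lbotN/lplus_bot.
Qed.

End Laurent.

(** * Birkhoff factorisation over plane forests *)

Section Birkhoff.
Context {K : comNzRingType} (a : laurent K).
Notation L := (laurent K).
Notation fcfun := (cfun forest_coalg L).

Definition birkhoff_pair (m p : fcfun) :=
  [/\ m [::] = 1, p [::] = 1,
      forall F, p F = \sum_(q <- fcuts F) m q.1 * a ^+ fsize q.2
    & forall F, F <> [::] -> ltop (-1) (p F) /\ lbot 0 (m F)].

(** The terms of the convolution with a nonempty trunk only involve the value of
    the first factor on smaller forests, so p F - m F is known by induction; a
    Laurent series is in only one way the difference of a series of negative
    powers and a series of nonnegative powers. *)
Lemma birkhoff_unique m p m' p' : birkhoff_pair m p -> birkhoff_pair m' p' ->
  forall F, m F = m' F /\ p F = p' F.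
Proof.
move=> [m0 p0 hp hh] [m0' p0' hp' hh'] F.
have [n] := ubnP (fsize F); elim: n F => // n IH F; rewrite ltnS => Fn.
have [->|/eqP F0] := eqVneq F [::]; first by rewrite m0 p0 m0' p0'.
have e (m1 : fcfun) : \sum_(q <- fcuts F) m1 q.1 * a ^+ fsize q.2 =
    m1 F + \sum_(q <- fcuts F | fsize q.2 != 0%N) m1 q.1 * a ^+ fsize q.2.
  rewrite (bigID (fun q => fsize q.2 == 0%N)) /=; congr (_ + _).
  rewrite -[RHS](fcuts1r m1); apply: eq_bigr => q /eqP ->.
  by rewrite expr0 mulr1.
have {}e : p F - m F = p' F - m' F.
  rewrite hp hp' !e ![m F + _]addrC ![m' F + _]addrC !addrK.
  rewrite big_seq_cond [RHS]big_seq_cond; apply: eq_bigr => q /andP[hq q0].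
  have /eqP sq := allP (fcuts_size F) _ hq.
  have lq : (fsize q.1 < n)%N.
    by apply: leq_trans Fn; rewrite -sq -addn1 leq_add2l lt0n.
  by rewrite (IH _ lq).1.
have [h1 h2] := hh _ F0; have [h1' h2'] := hh' _ F0.
have d : p F - p' F = m F - m' F.
  by apply/eqP; rewrite subr_eq addrAC -addrA -e addrCA subrr addr0.
have pz : p F - p' F = 0.
  apply: (@ltop_lbot0 _ (-1) 0) => //; first exact/ltopD/ltopN.
  by rewrite d; apply/lbotD/lbotN.
by split; apply/eqP; rewrite -subr_eq0 -?d pz.
Qed.

Lemma is_birkhoff_pair m p :
  is_birkhoff (fun F => a ^+ fsize F) m p -> birkhoff_pair m p.
Proof.
case=> [[m0 _] [p0 _] hp hh]; split; [exact: m0|exact: p0| |move=> F /hh[h1 h2]].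
  by move=> F; rewrite hp convE.
by split; [apply/in_AplusE|].
Qed.

Definition one_seed : cfun forest_coalg (L^o : lalgType L) := fun=> 1.

(** The S^I take natural numbers as values, so the conditions on poles pass from
    the coefficients to the series. *)
Lemma birkhoff_Ssum :
  birkhoff_pair (Ssum one_seed (bminus a)) (Ssum one_seed (bplus a)).
Proof.
have s1 (x : forest_coalg) : cosz x = 0%N -> one_seed x = 1 by [].
have h0 c : c [::] = 1 -> Ssum one_seed c [::] = 1.
  by move=> c0; rewrite /Ssum big_seq1 c0 scale1r /Sprod big_nil cfun1.
split; [exact: h0|exact: h0| |].
  move=> F; rewrite (@Ssum_sigma _ _ _ _ s1 _ a (bminus a)) //.
  - by rewrite cmulE; apply: eq_bigr => q _; rewrite /sigma /one_seed /GRing.scale /= mulr1.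
  - by move=> c x y; rewrite /GRing.scale /= mulrCA.
  exact: bplus_rcons.
move=> F F0.
have Sz I : exists k : nat, (Sprod one_seed I : fcfun) F = k%:R.
  rewrite /Sprod; elim: I F {F0} => [|i I IH] F.
    by rewrite big_nil cfun1; eexists.
  rewrite big_cons cmulE.
  apply: (big_ind (fun x : L => exists k : nat, x = k%:R)) => [|x y [k ->] [l ->]|q _].
  - by exists 0%N.
  - by exists (k + l)%N; rewrite natrD.
  have [k ->] := IH q.2; rewrite /Sn /one_seed; case: eqP => _.
    by exists k; rewrite mul1r.
  by exists 0%N; rewrite mul0r.
split; rewrite /Ssum big_seq.
  apply: (big_ind (ltop (-1))) => [|x y|I hI]; [exact: ltop0|exact: ltopD|].
  have [k ->] := Sz I; rewrite /GRing.scale /= mulr_natr => m hm.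
  rewrite lcoefMn bplus_top ?mul0rn // => I0.
  by move: hI; rewrite I0 mem_comps /= eq_sym => /eqP h; case: F0; apply/eqP; rewrite -fsize0 h.
apply: (big_ind (lbot 0)) => [|x y|I hI]; [exact: lbot0|exact: lbotD|].
have [k ->] := Sz I; rewrite /GRing.scale /= mulr_natr => m hm.
by rewrite lcoefMn bminus_bot ?mul0rn.
Qed.

End Birkhoff.

(** The factor phi^+ is a sum over Tamari up-sets, each forest G contributing
    a_G z^(-k) for its k trees. *)
Section TamariBirkhoff.
Context {k : comNzRingType}.
Notation K := (apoly k).
Notation a := (aseries k).

Lemma aforest_cat F G : aforest k (F ++ G) = aforest k F * aforest k G.
Proof. by rewrite /aforest map_cat flatten_cat big_cat. Qed.

Lemma aforest_tree H : aforest k [:: Bplus H] = avar k (size H) * aforest k H.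
Proof. by rewrite /aforest /= cats0 big_cons. Qed.

Definition aplus (F : forest) : laurent K :=
  \sum_(G <- up F) lmon (aforest k G) (- (size G)%:Z).

Lemma aplus0 : aplus [::] = 1.
Proof. by rewrite /aplus up0 big_seq1 /aforest big_nil; apply: lmon1. Qed.

Lemma up1 H : up [:: Bplus H] = utree (up H).
Proof.
rewrite up_cons up0 /allpairs.
by elim: (utree _) => //= G s ->; rewrite cats0.
Qed.

Lemma aplus_cons H F : aplus (Bplus H :: F) = aplus [:: Bplus H] * aplus F.
Proof.
rewrite /aplus up1 up_cons big_allpairs_dep mulr_suml; apply: eq_bigr => G1 _.
rewrite mulr_sumr; apply: eq_bigr => G2 _.
by rewrite lmonM aforest_cat size_cat PoszD opprD.
Qed.

Lemma aplus_tree H : aplus [:: Bplus H] =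
  \sum_(G <- up H) \sum_(i < (size G).+1)
     lmon (avar k (size G - i) * aforest k G) (- i.+1%:Z).
Proof.
rewrite /aplus up1 big_allpairs_dep; apply: eq_bigr => G _.
rewrite -[iota _ _]/(index_iota 0 (size G).+1) big_mkord; apply: eq_bigr => i _.
rewrite size_rcons size_takel ?(leq_ord i) // -cats1 aforest_cat aforest_tree size_drop.
by rewrite mulrCA -aforest_cat cat_take_drop.
Qed.

Lemma lcoef_a m : lcoef a m = aseries_coef k m. Proof. by []. Qed.

Lemma aplus_tree_top H : ltop (-1) (aplus [:: Bplus H]).
Proof.
move=> m hm; rewrite aplus_tree lcoef_sum big1 // => G _; rewrite lcoef_sum big1 // => i _.
by rewrite lcoef_lmon ifF //; apply/eqP; lia.
Qed.

(** The pole part of a(z) phi^+(H) is phi^+(B_+(H)): a forest G above H with g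
    trees contributes to z^(-j-1), for j <= g, the coefficient a_(g-j) a_G of
    the forest obtained by grafting all but its first j trees, and nothing for
    j > g. *)
Lemma aplus_tree_bot H : lbot 0 (aplus [:: Bplus H] - a * aplus H).
Proof.
move=> m hm; rewrite lcoefB aplus_tree [a * _]mulrC /aplus mulr_suml !lcoef_sum -sumrB.
apply: big1 => G _; rewrite lcoef_lmonM opprK lcoef_sum lcoef_a /aseries_coef.
have [j ej] : exists j : nat, m = - j.+1%:Z by exists (`|m|.-1)%N; lia.
have [hj|hj] := leqP j (size G).
  rewrite (bigD1 (inord j)) //= inordK // ej eqxx big1 ?addr0.
    rewrite (_ : - j.+1%:Z + _ + 1 = (size G - j)%N) ?[_ * avar _ _]mulrC ?subrr //.
    by lia.
  move=> i; rewrite -val_eqE /= inordK // => hi; rewrite ifF //.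
  by apply/eqP => -[e]; rewrite e eqxx in hi.
rewrite big1 ?sub0r; last first.
  by move=> i _; rewrite lcoef_lmon ifF //; apply/eqP; have := ltn_ord i; lia.
have : m + size G + 1 < 0 by lia.
by case: (m + _ + 1) => // n _; rewrite mulr0 oppr0.
Qed.

(** Each tree B_+(H) contributes the opposite of the part of a(z) phi^+(H)
    without pole. *)
Definition aminus : forest -> laurent K :=
  ffold 1 (fun H _ mF => (aplus [:: Bplus H] - a * aplus H) * mF).

Lemma aminus_cons H F :
  aminus (Bplus H :: F) = (aplus [:: Bplus H] - a * aplus H) * aminus F.
Proof. by []. Qed.

Lemma aminus_cat F G : aminus (F ++ G) = aminus F * aminus G.
Proof.
elim/forest_ind: F => [|H F _ IF]; first by rewrite mul1r.
by rewrite cat_cons !aminus_cons IF mulrA.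
Qed.

Lemma aplus_conv F : aplus F = \sum_(q <- fcuts F) aminus q.1 * a ^+ fsize q.2.
Proof.
elim/forest_ind: F => [|H F IH IF].
  by rewrite fcuts0 big_seq1 aplus0 mulr1.
rewrite aplus_cons fcuts_cons big_allpairs_dep.
transitivity (\sum_(t <- tcuts H (fcuts H)) aminus t.1 * a ^+ fsize t.2 * aplus F).
  rewrite -mulr_suml; congr (_ * _).
  rewrite (sum_tcuts (fun x y => aminus x * a ^+ fsize y)) expr0 mulr1 aminus_cons mulr1.
  rewrite -[LHS](subrK (a * aplus H)); congr (_ + _).
  rewrite IH mulr_sumr; apply: eq_bigr => q _.
  by rewrite fsize_cons addn0 exprS mulrCA.
apply: eq_bigr => t _; rewrite IF mulr_sumr; apply: eq_bigr => q _.
by rewrite aminus_cat fsize_cat exprD mulrACA.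
Qed.

Lemma birkhoff_aplus : birkhoff_pair a aminus aplus.
Proof.
split; [by []|exact: aplus0|exact: aplus_conv|].
elim/forest_ind => [//|H F IH IF] _; rewrite aplus_cons aminus_cons.
have h1 := aplus_tree_top H; have h2 := aplus_tree_bot H.
have [->|/eqP /IF[h3 h4]] := eqVneq F [::]; first by rewrite aplus0 !mulr1.
split; last exact: (lbotM h2 h4).
by apply: ltopW (ltopM h1 h3).
Qed.

Lemma aplus_Ssum F : aplus F = Ssum one_seed (bplus a) F.
Proof. exact: (birkhoff_unique birkhoff_aplus (birkhoff_Ssum a) F).2. Qed.

Lemma is_birkhoff_aplus phim phip :
  is_birkhoff (aphi k) phim phip -> forall F, phip F = aplus F.
Proof.
move=> /is_birkhoff_pair h F.
exact: (birkhoff_unique h birkhoff_aplus F).2.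
Qed.

End TamariBirkhoff.

(** * Expansion on the complete functions *)

Lemma sum_compositions (V : nmodType) (g : seq nat -> V) n :
  \sum_(I \in compositions n) g I = \sum_(I <- comps n) g I.
Proof.
rewrite [RHS]fsbig_seq ?comps_uniq //; suff -> : compositions n = [set` comps n]%classic by [].
apply/seteqP; split=> I; rewrite /compositions /= mem_comps; first by case=> -> ->; rewrite eqxx.
by case/andP=> h /eqP h2; split.
Qed.

(** The values of S^I are natural numbers that do not depend on the scalars;
    this is how the coefficients over Laurent series are compared with those
    over their residues. *)
Fixpoint Snat (I : seq nat) (F : forest) : nat :=
  if I is i :: I' then \sum_(p <- fcuts F) (fsize p.1 == i) * Snat I' p.2 else nilp F.

Lemma SI_nat (A : nzRingType) I F : SI A I F = (Snat I F)%:R.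
Proof.
elim: I F => [//|i I IH] F; rewrite /SI /= -/(SI A I) convE natr_sum.
by apply: eq_bigr => p _; rewrite natrM IH.
Qed.

Lemma Sprod_nat (K : comNzRingType) I F :
  (Sprod (@one_seed K) I : cfun forest_coalg (laurent K)) F = (Snat I F)%:R.
Proof.
rewrite /Sprod; elim: I F => [|i I IH] F.
  by rewrite big_nil cfun1 /= fsize0; case: F.
rewrite big_cons cmulE natr_sum; apply: eq_bigr => p _.
by rewrite IH natrM /Sn; case: eqP.
Qed.

Lemma Snat_supp I F : fsize F <> sumn I -> Snat I F = 0%N.
Proof.
elim: I F => [|i I IH] F /=; first by case: F.
move=> hF; rewrite big_seq big1 // => p /(allP (fcuts_size F))/eqP hp.
by case: eqP => //= e; rewrite IH // => e2; apply: hF; rewrite -hp e e2.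
Qed.

Lemma sum_Snat_supp (A : nzRingType) (c : seq nat -> A) n F : fsize F != n ->
  \sum_(I <- comps n) c I * SI A I F = 0.
Proof.
move=> Fn; rewrite big_seq big1 // => I; rewrite mem_comps => /andP[_ /eqP hI].
by rewrite SI_nat Snat_supp ?mulr0 // hI; apply/eqP.
Qed.

Section Eval.
Context {K : comNzRingType}.
Implicit Types (f g : laurent K).

(** The sum defining the value at z = 1 is finite, with a common range for
    several series. *)
Lemma eval1_top f : ltop 0 f -> exists N0, forall N, (N0 <= N)%N ->
  eval1 f = \sum_(i < N) lcoef f (- i%:Z).
Proof.
move=> ht; have [b hb] := Defs.lbound f; exists b.+1 => N hN.
rewrite /eval1 (fsbigE [seq - i%:Z | i <- iota 0 N]).
- rewrite big_map (_ : iota 0 N = index_iota 0 N) ?big_mkord; last by rewrite /index_iota subn0.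
  by apply: eq_bigl => i; rewrite in_setT.
- by rewrite map_inj_uniq ?iota_uniq // => i j; lia.
- by [].
move=> i _ hi; have [h1|h1] := ltP 0 i; first exact: ht.
apply: hb; rewrite ltNge; apply/negP => h2; case/negP: hi.
apply/mapP; exists `|i|%N; last by lia.
by rewrite mem_iota; lia.
Qed.

Lemma eval1D f g : ltop 0 f -> ltop 0 g -> eval1 (f + g) = eval1 f + eval1 g.
Proof.
move=> hf hg; have [N1 h1] := eval1_top hf; have [N2 h2] := eval1_top hg.
have [N3 h3] := eval1_top (ltopD hf hg); pose N := maxn N1 (maxn N2 N3).
rewrite (h1 N) ?(h2 N) ?(h3 N) ?leq_max ?leqnn ?orbT //.
by rewrite -big_split.
Qed.

Lemma eval1_lmon (c : K) m : eval1 (lmon c m) = c.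
Proof.
rewrite /eval1 (fsbigE [:: m]) //=.
  by rewrite big_cons big_nil in_setT eqxx addr0.
by move=> i _; rewrite inE => /negPf ->.
Qed.

Lemma eval10 : eval1 (0 : laurent K) = 0.
Proof. by rewrite /eval1; apply: fsbig1 => i _; apply: lcoef0. Qed.

Lemma eval1_sum (J : eqType) (r : seq J) (F : J -> laurent K) :
  (forall j, j \in r -> ltop 0 (F j)) ->
  eval1 (\sum_(j <- r) F j) = \sum_(j <- r) eval1 (F j).
Proof.
elim: r => [|j r IH] h; first by rewrite !big_nil eval10.
rewrite !big_cons eval1D.
- by rewrite IH // => i hi; apply: h; rewrite inE hi orbT.
- by apply: h; rewrite inE eqxx.
rewrite big_seq; apply: (big_ind (ltop 0)) => [|x y|i hi]; first exact: ltop0.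
  exact: ltopD.
by apply: h; rewrite inE hi orbT.
Qed.

Lemma eval1Mn f n : ltop 0 f -> eval1 (f *+ n) = eval1 f *+ n.
Proof.
move=> hf; suff [] : ltop 0 (f *+ n) /\ eval1 (f *+ n) = eval1 f *+ n by [].
elim: n => [|n [IH1 IH2]]; first by rewrite !mulr0n eval10; split=> //; apply: ltop0.
by rewrite !mulrS eval1D // IH2; split=> //; apply: ltopD.
Qed.
End Eval.

Section PartOne.
Context {k : comNzRingType}.
Notation K := (apoly k).
Notation a := (aseries k).

Lemma aplus_expand F :
  aplus F = \sum_(I <- comps (fsize F)) bplus a I *+ Snat I F :> laurent K.
Proof.
rewrite aplus_Ssum /Ssum; apply: eq_bigr => I _.
by rewrite /GRing.scale /= Sprod_nat mulr_natr.
Qed.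

Lemma eval1_aplus F : eval1 (@aplus k F) = \sum_(G <- up F) aforest k G.
Proof.
rewrite /aplus eval1_sum; first by apply: eq_bigr => G _; rewrite eval1_lmon.
by move=> G _ m hm; rewrite lcoef_lmon ifF //; apply/eqP; lia.
Qed.

Lemma CX_up (A : nzRingType) G F : CX A G F = (G \in up F)%:R.
Proof.
rewrite /CX; suff -> : `[< forest_le F G >] = (G \in up F) by [].
by apply/idP/idP => [/asboolP h|h]; [|apply/asboolP]; apply/mem_up.
Qed.

Lemma eval1_aplus_CX F : eval1 (@aplus k F) =
  \sum_(G \in [set: forest]%classic) aforest k G * CX K G F.
Proof.
rewrite eval1_aplus (fsbigE (up F)) ?up_uniq //.
  rewrite [RHS](eq_bigl xpredT) => [|G]; last by rewrite in_setT.
  by rewrite big_seq [RHS]big_seq; apply: eq_bigr => G hG; rewrite CX_up hG mulr1.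
by move=> G _ /negPf hG; rewrite CX_up hG mulr0.
Qed.

Definition up_trees (F : forest) : seq ptree :=
  [seq head (Bplus [::]) G | G <- up F & size G == 1%N].

Lemma size1_head (G : forest) : size G == 1%N -> [:: head (Bplus [::]) G] = G.
Proof. by case: G => // T [|]. Qed.

Lemma mem_up_trees F T : (T \in up_trees F) = ([:: T] \in up F).
Proof.
apply/mapP/idP => [[G]|hT].
  by rewrite mem_filter => /andP[hG1 hG] ->; rewrite size1_head.
by exists [:: T] => //; rewrite mem_filter.
Qed.

Lemma up_trees_uniq F : uniq (up_trees F).
Proof.
rewrite map_inj_in_uniq ?filter_uniq ?up_uniq // => G G'.
rewrite !mem_filter => /andP[h1 _] /andP[h2 _] e.
by rewrite -(size1_head h1) -(size1_head h2) e.
Qed.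

Lemma sum_up_trees (V : nmodType) (g : forest -> V) F :
  \sum_(G <- up F | size G == 1%N) g G = \sum_(T <- up_trees F) g [:: T].
Proof.
rewrite big_map big_filter; apply: eq_bigr => G h; by rewrite size1_head.
Qed.

Lemma residue_aplus F : residue (@aplus k F) = \sum_(T <- up_trees F) aforest k [:: T].
Proof.
rewrite -(sum_up_trees (aforest k)) /residue /aplus lcoef_sum [RHS]big_mkcond.
apply: eq_bigr => G _; rewrite lcoef_lmon.
by congr (if _ then _ else _); apply/eqP/eqP; lia.
Qed.

Lemma residue_aplus_CX F : residue (@aplus k F) =
  \sum_(T \in [set: ptree]%classic) aforest k [:: T] * CX K [:: T] F.
Proof.
rewrite residue_aplus (fsbigE (up_trees F)) ?up_trees_uniq //.
  rewrite [RHS](eq_bigl xpredT) => [|T]; last by rewrite in_setT.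
  rewrite big_seq [RHS]big_seq; apply: eq_bigr => T hT.
  by rewrite CX_up -mem_up_trees hT mulr1.
by move=> T _ /negPf hT; rewrite CX_up -mem_up_trees hT mulr0.
Qed.

Lemma eval1_in_Sym n : in_Sym n (hcomp n (fun F => eval1 (@aplus k F))).
Proof.
exists (fun I => eval1 (bplus a I)) => F; rewrite sum_compositions /hcomp.
case: eqP => [e|/eqP e]; last by rewrite sum_Snat_supp.
rewrite aplus_expand e eval1_sum.
  apply: eq_bigr => I _; rewrite eval1Mn ?SI_nat ?mulr_natr //.
  exact: bplus_top0.
by move=> I _ m hm; rewrite lcoefMn bplus_top0 // mul0rn.
Qed.

Lemma residue_expand F : residue (@aplus k F) =
  \sum_(I <- comps (fsize F)) residue (bplus a I) *+ Snat I F.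
Proof.
rewrite aplus_expand /residue lcoef_sum.
by apply: eq_bigr => I _; rewrite lcoefMn.
Qed.

Lemma residue_in_Sym n : in_Sym n (hcomp n (fun F => residue (@aplus k F))).
Proof.
exists (fun I => residue (bplus a I)) => F; rewrite sum_compositions /hcomp.
case: eqP => [e|/eqP e]; last by rewrite sum_Snat_supp.
rewrite residue_expand e.
by apply: eq_bigr => I _; rewrite SI_nat mulr_natr.
Qed.

(** * The coefficients of a given type *)

Definition pmon (s : seq nat) : {cmonom nat} := foldr (fun c m => mmul (ucm c) m) mone s.

Lemma pmon_cons c s : pmon (c :: s) = mmul (ucm c) (pmon s).
Proof. by []. Qed.

Lemma avar_mul c m : avar k c * << m >> = << mmul (ucm c) m >>.
Proof. by rewrite /avar malgM_def fgmulUU mulr1. Qed.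

Lemma prod_avar (s : seq nat) : \prod_(c <- s) avar k c = << pmon s >>.
Proof.
elim: s => [|c s IH]; first by rewrite big_nil -mpolyC1E.
by rewrite big_cons {}IH avar_mul -pmon_cons.
Qed.

(** Monomials determine the type of a tree without reference to the scalars. *)
Definition tmon (T : ptree) := pmon (child_counts T).
Definition lmono (n : nat) (l : seq nat) := pmon (nseq (n - size l) 0%N ++ l).

Lemma aforest_mon T : aforest k [:: T] = << tmon T >>.
Proof. by rewrite /aforest /= cats0 prod_avar. Qed.

Lemma apartition_mon n l : apartition k n l = << lmono n l >>.
Proof.
rewrite /lmono -prod_avar big_cat /=; congr (_ * _).
elim: (_ - _)%N => [|m IH]; first by rewrite big_nil expr0.
by rewrite big_cons exprS {}IH.
Qed.

Lemma mcoeff_mon (m m' : {cmonom nat}) : (<< m >> : K)@_m' = (m == m')%:R.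
Proof. exact: mcoeffU. Qed.

Lemma mkmalg1_inj (m m' : {cmonom nat}) : << m >> = << m' >> :> K -> m = m'.
Proof.
move=> h; have {h} := congr1 (mcoeff m) h.
move=> h; have {h} := etrans (esym (mcoeff_mon m m)) (etrans h (mcoeff_mon m' m)).
by rewrite eqxx eq_sym; case: eqVneq => // _ /eqP; rewrite oner_eq0.
Qed.

Lemma trees_of_typeP n l T :
  trees_of_type k n l T <-> Defs.tsize T = n /\ tmon T = lmono n l.
Proof.
rewrite /trees_of_type /= aforest_mon apartition_mon; split=> -[h e].
  by split; [exact: h|exact: mkmalg1_inj e].
by rewrite e.
Qed.

Definition dcoef n l I : k := (residue (bplus a I))@_(lmono n l).

(** The coefficient of a_lambda in the residue of phi^+ selects the trees of type
    lambda on one side, and a family of scalars independent of the forest on the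
    other side. *)
Lemma Dpart_expand n l F :
  Dpart k n l F = \sum_(I <- comps n) dcoef n l I * SI k I F.
Proof.
pose s := [seq T <- up_trees F | (Defs.tsize T == n) && (tmon T == lmono n l)].
have hs T : T \in s -> trees_of_type k n l T.
  by rewrite mem_filter => /andP[/andP[/eqP h1 /eqP h2] _]; apply/trees_of_typeP.
rewrite /Dpart (fsbigE s) ?filter_uniq ?up_trees_uniq //; last first.
  move=> T /trees_of_typeP[h1 h2]; rewrite mem_filter h1 h2 !eqxx mem_up_trees /=.
  by rewrite CX_up => /negPf ->.
rewrite big_seq_cond (eq_bigl (fun T => T \in s)) => [|T]; last first.
  by apply/andP/idP => [[]//|hT]; split=> //; apply/mem_set/hs.
rewrite -big_seq.
have [Fn|Fn] := eqVneq (fsize F) n; last first.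
  rewrite sum_Snat_supp // big_seq big1 // => T.
  rewrite mem_filter => /andP[/andP[/eqP sT _] hT]; case/eqP: Fn.
  by move: hT; rewrite mem_up_trees => /up_size <-; rewrite -sT /fsize /= addn0.
transitivity ((residue (@aplus k F))@_(lmono n l)); last first.
  rewrite residue_expand Fn raddf_sum; apply: eq_bigr => I _.
  by rewrite raddfMn SI_nat mulr_natr.
rewrite residue_aplus raddf_sum big_filter big_mkcond big_seq [RHS]big_seq.
apply: eq_bigr => T hT; rewrite aforest_mon CX_up -mem_up_trees hT [RHS]mcoeff_mon.
move: hT; rewrite mem_up_trees => /up_size; rewrite Fn /fsize /= addn0 => ->.
by rewrite eqxx /=; case: eqP.
Qed.

Lemma Dpart_in_Sym n l : in_Sym n (Dpart k n l).
Proof.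
by exists (dcoef n l) => F; rewrite sum_compositions Dpart_expand.
Qed.

End PartOne.

(** * Noncommutative polynomials *)

Section NcPoly.
Context {R : comNzRingType} {A : choiceType}.
Implicit Types (p q : ncpoly R A) (u v w : seq A).

Lemma ncword0 : ncword R [::] = 1 :> ncpoly R A.
Proof. by rewrite /ncword -fmE. Qed.

Lemma ncword_cat u v : ncword R (u ++ v) = ncword R u * ncword R v.
Proof.
rewrite /ncword malgM_def fgmulUU mulr1; congr mkmalgU.
by apply/eqP; rewrite fmP fmM.
Qed.

Lemma ncword_coef u v : (ncword R u)@_(FMonom v) = (u == v)%:R.
Proof. by rewrite /ncword mcoeffU; congr (_ *+ (_ : bool)); rewrite fmP. Qed.

Lemma malgC_comm p (c : R) : p * c%:MP = c%:MP * p.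
Proof.
rewrite [p]monalgE mulr_suml mulr_sumr; apply: eq_bigr => w _.
by rewrite !malgM_def !fgmulUU mulrC mulm1 mul1m.
Qed.

Lemma ncpoly_scaleAr (c : R) p q : p * (c *: q) = c *: (p * q).
Proof. by rewrite -!mul_malgC mulrA malgC_comm mulrA. Qed.

Lemma ncpolyP p q : (forall w, p@_(FMonom w) = q@_(FMonom w)) -> p = q.
Proof. by move=> h; apply/malgP => w; rewrite -(fmK w). Qed.
End NcPoly.

(** * Filtrations by the order in z *)

Section Filtration.
Context {K : comNzRingType} {A : choiceType}.
Notation L := (laurent K).
Notation B := (ncpoly L A).
Notation W := (word_coalg A).

Record filtration := Filtration {
  fil :> int -> L -> Prop;
  fil0 : forall n, fil n 0;
  filD : forall n f g, fil n f -> fil n g -> fil n (f + g);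
  filN : forall n f, fil n f -> fil n (- f);
  filM : forall n n' f g, fil n f -> fil n' g -> fil (n + n') (f * g);
  fil1 : fil 0 1 }.

Definition topfil := Filtration (@ltop0 K) (@ltopD K) (@ltopN K) (@ltopM K) (@ltop1 K).
Definition botfil := Filtration (@lbot0 K) (@lbotD K) (@lbotN K) (@lbotM K) (@lbot1 K).

Variable P : filtration.

Definition bfil n (b : B) := forall w, P n b@_w.
Definition ffil n (f : cfun W B) := forall w, bfil n (f w).

Lemma filMn n f k : P n f -> P n (f *+ k).
Proof.
by move=> h; elim: k => [|k IH]; rewrite ?mulr0n ?mulrS; [apply: fil0|apply: filD].
Qed.

Lemma bfil0 n : bfil n 0. Proof. by move=> w; rewrite mcoeff0; apply: fil0. Qed.
Lemma bfilD n b c : bfil n b -> bfil n c -> bfil n (b + c).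
Proof. by move=> hb hc w; rewrite mcoeffD; apply: filD. Qed.
Lemma bfilN n b : bfil n b -> bfil n (- b).
Proof. by move=> hb w; rewrite mcoeffN; apply: filN. Qed.
Lemma bfil_sum n (J : eqType) (r : seq J) (F : J -> B) :
  (forall j, j \in r -> bfil n (F j)) -> bfil n (\sum_(j <- r) F j).
Proof.
move=> h; rewrite big_seq; apply: (big_ind (bfil n)) => //; first exact: bfil0.
by move=> *; apply: bfilD.
Qed.
Lemma bfilM n n' b c : bfil n b -> bfil n' c -> bfil (n + n') (b * c).
Proof.
move=> hb hc; rewrite malgME; apply: bfil_sum => u _; apply: bfil_sum => v _ w.
by rewrite mcoeffU; apply/filMn/filM.
Qed.
Lemma bfilZ n n' c b : P n c -> bfil n' b -> bfil (n + n') (c *: b).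
Proof. by move=> hc hb w; rewrite mcoeffZ; apply: filM. Qed.
Lemma bfil_ncword w : bfil 0 (ncword L w).
Proof. by move=> v; rewrite mcoeffU; apply/filMn/fil1. Qed.

Lemma ffilD n f g : ffil n f -> ffil n g -> ffil n (f + g).
Proof. by move=> hf hg w; apply: bfilD. Qed.
Lemma ffilN n f : ffil n f -> ffil n (- f).
Proof. by move=> hf w; apply: bfilN. Qed.
Lemma ffilM n n' f g : ffil n f -> ffil n' g -> ffil (n + n') (f * g).
Proof. by move=> hf hg w; rewrite cmulE; apply: bfil_sum => p _; apply: bfilM. Qed.
Lemma ffil1 : ffil 0 1.
Proof.
move=> w; rewrite cfun1; case: (_ == _); last exact: bfil0.
by rewrite -ncword0; apply: bfil_ncword.
Qed.
Lemma ffilX f k : ffil 0 f -> ffil 0 (f ^+ k).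
Proof.
move=> hf; elim: k => [|k IH]; first by rewrite expr0; apply: ffil1.
by rewrite exprS -[0]addr0; apply: ffilM.
Qed.
End Filtration.

(** * Derivations of the convolution ring on words *)

Section Derivations.
Context {A : choiceType} {B : pzRingType}.
Notation W := (word_coalg A).
Implicit Types (f g : cfun W B).

(** Since the first (or last) letter of a word goes to one of the two
    subwords, both operators below satisfy the Leibniz rule. *)
Definition dl (y : A) f : cfun W B := fun w => f (y :: w).
Definition dr (x : A) f : cfun W B := fun w => f (rcons w x).
Definition cst (b : B) : cfun W B := fun w => if nilp w then b else 0.

Lemma wmulE f g (w : seq A) : (f * g) w = \sum_(p <- unsh w) f p.1 * g p.2.
Proof. exact: cmulE. Qed.

Lemma wcommE f g w :
  (f * g - g * f) w = \sum_(p <- unsh w) (f p.1 * g p.2 - g p.2 * f p.1).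
Proof. by rewrite cfunB !wmulE (unshC (fun u v => g u * f v)) sumrB. Qed.

Lemma dlM y f g : dl y (f * g) = dl y f * g + f * dl y g.
Proof.
apply/funext => w; rewrite cfunD /dl !wmulE.
by rewrite (sum_unsh_cons (fun u v => f u * g v)).
Qed.
Lemma drM x f g : dr x (f * g) = dr x f * g + f * dr x g.
Proof.
apply/funext => w; rewrite cfunD /dr !wmulE.
by rewrite (sum_unsh_rcons (fun u v => f u * g v)).
Qed.
Lemma dlE y f w : dl y f w = f (y :: w). Proof. by []. Qed.
Lemma drE x f w : dr x f w = f (rcons w x). Proof. by []. Qed.
Lemma dl1 y : dl y 1 = 0. Proof. by []. Qed.
Lemma dl_cst y b : dl y (cst b) = 0. Proof. by []. Qed.

Lemma cst_mulE b f w : (cst b * f) w = b * f w.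
Proof.
rewrite wmulE -[RHS](unsh1l (fun v => b * f v)) [RHS]big_mkcond.
by apply: eq_bigr => p _; rewrite /cst /nilp; case: ifP; rewrite ?mul0r.
Qed.
Lemma mul_cstE b f w : (f * cst b) w = f w * b.
Proof.
rewrite wmulE -[RHS](unsh1r (fun v => f v * b)) [RHS]big_mkcond.
by apply: eq_bigr => p _; rewrite /cst /nilp; case: ifP; rewrite ?mulr0.
Qed.
Lemma cmul_nil f g : (f * g) [::] = f [::] * g [::].
Proof. by rewrite wmulE /= big_seq1. Qed.
End Derivations.

(** * Algebra of logarithmic derivatives *)

(** For p = m s and a derivation d with d s = c s, the element (d p) p^-1 is
    expressed by m alone; when d s = s c, the conjugate of c by p enters as well.
    The names dp, dm, dip, de stand for the images under d
    of p, m, the inverse ip of p, and the conjugate p c p^-1; im is the inverse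
    of m. *)
Section LogarithmicDerivative.
Context {R : pzRingType} (p m s im ip : R).
Hypotheses (pE : p = m * s) (sip : s * ip = im) (pK : p * ip = 1) (ipK : ip * p = 1).

Lemma logder_left dp dm c : dp = dm * s + m * (c * s) ->
  dp * ip = dm * im + m * c * im.
Proof. by move=> ->; rewrite mulrDl -!mulrA sip. Qed.

Lemma logder_inverse dp dip : dip * p + ip * dp = 0 -> dip = - (ip * (dp * ip)).
Proof.
move=> /(congr1 (fun f => f * ip)); rewrite mul0r mulrDl -!mulrA pK mulr1 => /eqP.
by rewrite addr_eq0 => /eqP.
Qed.

Lemma logder_conj dp dip de c : dip = - (ip * (dp * ip)) ->
  de = (dp * c + p * 0) * ip + p * c * dip ->
  de = (dp * ip) * (p * c * ip) - (p * c * ip) * (dp * ip).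
Proof.
move=> -> ->; rewrite mulr0 addr0 mulrN; congr (_ - _); last by rewrite !mulrA.
by rewrite -!mulrA (mulrA ip) ipK mul1r.
Qed.

Lemma logder_right dp dm c : dp = dm * s + m * (s * c) ->
  dp = dm * im + p * c * ip - dp * (ip - 1).
Proof.
move=> h; have -> : dm * im + p * c * ip = dp * ip.
  by rewrite h pE mulrDl -!mulrA sip.
by rewrite mulrBr mulr1 opprB addrCA subrr addr0.
Qed.

Lemma logder_split dp : dp * ip = dp + dp * (ip - 1).
Proof. by rewrite mulrBr mulr1 addrCA subrr addr0. Qed.

Lemma inverse_sub1 : ip - 1 = - ((p - 1) * ip).
Proof. by rewrite mulrBl pK mul1r opprB. Qed.
End LogarithmicDerivative.

(** * The Lax equations on words *)

Section WordLax.
Context {K : comNzRingType} {A : choiceType} (a : laurent K).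
Notation L := (laurent K).
Notation B := (ncpoly L A).
Notation W := (word_coalg A).
Notation word w := (ncword L w).
Hypothesis abot : lbot (-1) a.

(** The geometric series of f preserves the filtration. *)
Lemma word_inverse (P : filtration) (f : cfun W B) : f [::] = 1 -> ffil P 0 f ->
  exists g, [/\ f * g = 1, g * f = 1 & ffil P 0 g].
Proof.
move=> f1 hf; have [w /size0nil -> //|g [h1 h2 h3]] := @cfun_inverse _ _ f.
exists g; split=> // w; have [N ->] := h3 w; rewrite cfun_sum; apply: bfil_sum => i _.
by apply: ffilX; apply: ffilD; [apply: ffil1|apply: ffilN].
Qed.

Variables (p m s : cfun W B).
Hypotheses (pE : p = m * s) (p_nil : p [::] = 1) (m_nil : m [::] = 1).
Hypotheses (p1_top : ffil topfil (-1) (p - 1)) (p_top : ffil topfil 0 p).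
Hypotheses (m_bot : ffil botfil 0 m).
Hypotheses (dls : forall y, dl y s = cst (a *: word [:: y]) * s).
Hypotheses (drs : forall x, dr x s = s * cst (a *: word [:: x])).

(** Here Q y = (d_y p) p^-1 and E x = p x p^-1.  The first is
    (d_y m) m^-1 + m (a y) m^-1, which has at most a simple pole, whereas
    (d_y p) p^-1 consists of negative powers.  Multiplying by p^-1 - 1 adds a
    power of z^-1, so Q y and d_y p have the same term in z^-1, and so have, for
    the derivative by the last letter x, d_x p and a E x. *)
Lemma word_lax_of : exists (Q E : A -> cfun W B),
  [/\ forall x, E x [::] = word [:: x],
      forall x y w, E x (y :: w) =
        \sum_(q <- unsh w) (Q y q.1 * E x q.2 - E x q.2 * Q y q.1),
      forall y w, bfil topfil (-1) (Q y w) /\ bfil botfil (-1) (Q y w)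
    & forall x y u w, y :: w = rcons u x -> forall v,
        lcoef (Q y w)@_v (-1) = lcoef (a *: E x u)@_v (-1) /\
        lcoef (Q y w)@_v (-1) = lcoef (p (y :: w))@_v (-1)].
Proof.
have [im [mK imK imb]] := word_inverse m_nil m_bot.
have [ip [pK ipK ipt]] := word_inverse p_nil p_top.
have ip1t : ffil topfil (-1) (ip - 1).
  rewrite (inverse_sub1 pK).
  by apply: ffilN; rewrite -[-1]addr0; apply: ffilM => //; apply: p1_top.
have sip : s * ip = im.
  have es : s = im * p by rewrite pE mulrA imK mul1r.
  by rewrite es -mulrA pK mulr1.
have ip_nil : ip [::] = 1.
  by have := congr1 (fun f => f [::]) pK; rewrite /= cmul_nil p_nil mul1r => ->.
have dlp_top y : ffil topfil (-1) (dl y p).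
  move=> w; have := p1_top (y :: w); rewrite cfunB cfun1 /= subr0.
  exact.
have drp_top x : ffil topfil (-1) (dr x p).
  move=> w; have := p1_top (rcons w x); rewrite cfunB cfun1 /= size_rcons subr0.
  exact.
pose Q y := dl y p * ip.
pose E x := p * cst (word [:: x]) * ip.
have QE y : Q y = dl y m * im + m * cst (a *: word [:: y]) * im.
  by apply: (logder_left sip); rewrite pE dlM dls.
have dlip y : dl y ip = - (ip * Q y).
  by apply: (logder_inverse pK); rewrite -dlM ipK dl1.
have Qtop y : ffil topfil (-1) (Q y).
  by have := ffilM (dlp_top y) ipt; rewrite addr0.
have cstb (y : A) : ffil botfil (-1) (cst (a *: word [:: y])).
  move=> w; rewrite /cst; case: nilp; last exact: bfil0.
  by rewrite -[-1]addr0; apply: bfilZ => //; apply: bfil_ncword.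
have Qbot y : ffil botfil (-1) (Q y).
  have hm : ffil botfil 0 (dl y m * im).
    by rewrite -[0]addr0; apply: ffilM => // w; apply: m_bot.
  rewrite QE; apply: ffilD.
    by move=> w v n hn; apply: hm; lia.
  have := ffilM (ffilM m_bot (cstb y)) imb.
  by rewrite add0r addr0.
exists Q, E; split.
- by move=> x; rewrite /E !cmul_nil p_nil ip_nil mul1r mulr1.
- move=> x y w.
  have h := dlM y (p * cst (word [:: x])) ip.
  rewrite (dlM y p (cst _)) dl_cst in h.
  have {}h : dl y (E x) = Q y * E x - E x * Q y := logder_conj ipK (dlip y) h.
  by rewrite -(dlE y (E x) w) h wcommE.
- by move=> y w; split; [apply: Qtop|apply: Qbot].
move=> x y u w e v.
have small (f g : cfun W B) w' : ffil topfil (-1) f -> ffil topfil (-1) g ->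
    lcoef ((f * g) w')@_v (-1) = 0.
  by move=> hf hg; apply: (ffilM hf hg w' v); lia.
have hQ : lcoef (Q y w)@_v (-1) = lcoef (p (y :: w))@_v (-1).
  have hs : Q y = dl y p + dl y p * (ip - 1) := logder_split ip (dl y p).
  by rewrite hs cfunD mcoeffD lcoefD small ?addr0.
split=> //; rewrite hQ e -(drE x p u).
have hd : dr x p = dr x m * im + p * cst (a *: word [:: x]) * ip - dr x p * (ip - 1).
  by apply: (logder_right pE sip); rewrite {1}pE drM drs.
have hE : (p * cst (a *: word [:: x]) * ip) u = a *: E x u.
  rewrite /E (wmulE (p * cst _) ip) (wmulE (p * cst _) ip) scaler_sumr.
  apply: eq_bigr => q _; rewrite (mul_cstE _ p) (mul_cstE _ p).
  by rewrite ncpoly_scaleAr -scalerAl.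
rewrite hd cfunB cfunD hE mcoeffB lcoefB small ?subr0 // mcoeffD lcoefD.
have hm : ffil botfil 0 (dr x m * im).
  by rewrite -[0]addr0; apply: ffilM => // w'; apply: m_bot.
by rewrite hm ?add0r.
Qed.

End WordLax.

Section WordBirkhoff.
Context {K : comNzRingType} {A : choiceType} (a : laurent K).
Notation L := (laurent K).
Notation B := (ncpoly L A).
Notation W := (word_coalg A).
Notation word w := (ncword L w).
Hypothesis abot : lbot (-1) a.

Definition wseed : cfun W B := fun w => word w.

Lemma wseed1 (w : W) : cosz w = 0%N -> wseed w = 1.
Proof. by move/size0nil ->; apply: ncword0. Qed.

(** The words occurring in S^I applied to w: the letters of w are dealt into
    consecutive blocks of lengths I, each block keeping their order. *)
Fixpoint shuf (T : eqType) (I : seq nat) (w : seq T) : seq (seq T) :=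
  if I is i :: I' then
    flatten [seq [seq p.1 ++ v | v <- shuf I' p.2] | p <- unsh w & size p.1 == i]
  else if nilp w then [:: [::]] else [::].

Lemma Sprod_shuf I (w : seq A) : Sprod wseed I w = \sum_(v <- shuf I w) word v.
Proof.
rewrite /Sprod; elim: I w => [|i I IH] w.
  rewrite big_nil cfun1 /= /nilp; case: eqP => _; last by rewrite big_nil.
  by rewrite big_seq1 ncword0.
rewrite big_cons wmulE /= big_flatten /= big_map big_filter [RHS]big_mkcond.
apply: eq_bigr => p _; rewrite IH /Sn /wseed; case: eqP => _; last by rewrite mul0r.
by rewrite mulr_sumr big_map; apply: eq_bigr => v _; rewrite ncword_cat.
Qed.

Definition wminus : cfun W B := Ssum wseed (bminus a).
Definition wplus : cfun W B := Ssum wseed (bplus a).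
Definition wsigma : cfun W B := sigma wseed a.

Lemma wplusE : wplus = wminus * wsigma.
Proof.
apply: Ssum_sigma; [exact: wseed1| |by []|exact: bplus_rcons].
by move=> c x y; apply: ncpoly_scaleAr.
Qed.

Lemma wplus_nil : wplus [::] = 1.
Proof. by rewrite /wplus /Ssum big_seq1 scale1r /Sprod big_nil. Qed.
Lemma wminus_nil : wminus [::] = 1.
Proof. by rewrite /wminus /Ssum big_seq1 scale1r /Sprod big_nil. Qed.

Lemma bfil_Sprod (P : filtration) I w : bfil P 0 (Sprod wseed I w).
Proof. by rewrite Sprod_shuf; apply: bfil_sum => v _; apply: bfil_ncword. Qed.

Lemma wplus_top : ffil topfil (-1) (wplus - 1).
Proof.
move=> [|x w]; rewrite cfunB cfun1 /=.
  by rewrite wplus_nil subrr; apply: bfil0.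
rewrite subr0 /wplus /Ssum; apply: bfil_sum => I hI.
apply: (@bfilZ _ _ topfil (-1) 0) (bfil_Sprod topfil I _); apply: bplus_top => I0.
by move: hI; rewrite I0 mem_comps.
Qed.

Lemma wplus_top0 : ffil topfil 0 wplus.
Proof.
move=> w; rewrite /wplus /Ssum; apply: bfil_sum => I hI.
apply: (@bfilZ _ _ topfil 0 0) (bfil_Sprod topfil I _); exact: bplus_top0.
Qed.

Lemma wminus_bot : ffil botfil 0 wminus.
Proof.
move=> w; rewrite /wminus /Ssum; apply: bfil_sum => I hI.
apply: (@bfilZ _ _ botfil 0 0) (bfil_Sprod botfil I _); exact: bminus_bot.
Qed.

(** The previous lemma for the factorisation of sigma_a, which maps a word w to
    a^|w| w: removing the first or the last letter of w removes a letter and one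
    factor a on that side. *)
Lemma word_lax : exists (Q E : A -> cfun W B),
  [/\ forall x, E x [::] = word [:: x],
      forall x y w, E x (y :: w) =
        \sum_(p <- unsh w) (Q y p.1 * E x p.2 - E x p.2 * Q y p.1),
      forall y w, bfil topfil (-1) (Q y w) /\ bfil botfil (-1) (Q y w)
    & forall x y u w, y :: w = rcons u x -> forall v,
        lcoef (Q y w)@_v (-1) = lcoef (a *: E x u)@_v (-1) /\
        lcoef (Q y w)@_v (-1) = lcoef (wplus (y :: w))@_v (-1)].
Proof.
have dls y : dl y wsigma = cst (a *: word [:: y]) * wsigma.
  apply/funext => w; rewrite cst_mulE /dl /wsigma /sigma /wseed.
  rewrite exprS -cat1s ncword_cat -scalerA -scalerAl ncpoly_scaleAr.
  by rewrite scalerA mulrC -scalerA.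
have drs x : dr x wsigma = wsigma * cst (a *: word [:: x]).
  apply/funext => w; rewrite mul_cstE /dr /wsigma /sigma /wseed /= size_rcons.
  by rewrite exprS -cats1 ncword_cat -scalerAl ncpoly_scaleAr scalerA mulrC.
exact: (word_lax_of abot wplusE wplus_nil wminus_nil wplus_top wplus_top0 wminus_bot dls drs).
Qed.

End WordBirkhoff.

(** * Bracketings and admissible labellings *)

Section Bracketing.
Context {A : eqType}.
Implicit Types (t : btree) (u v w : seq A) (x y : A).

(** Bracketings have integer coefficients: the signed words are kept apart from
    the scalars, and can be transported along relabellings. *)
Fixpoint blist t w : seq (bool * seq A) :=
  if t is BNode l r then
    let bl := blist l (take (leaves l) w) in
    let br := blist r (drop (leaves l) w) in
    [seq (p.1 (+) q.1, p.2 ++ q.2) | p <- bl, q <- br] ++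
    [seq (~~ (p.1 (+) q.1), q.2 ++ p.2) | p <- bl, q <- br]
  else [:: (false, w)].

Definition bcoef t w v : int := \sum_(p <- blist t w) (-1) ^+ p.1 * (p.2 == v)%:R.

(** The admissible words for t on the letters of [rcons w x], in increasing
    order: below an internal node, the first letter goes to the left subtree and
    the last one to the right subtree. *)
Fixpoint adm t w x : seq (seq A) :=
  if t is BNode l r then
    if w is y :: w' then
      flatten [seq [seq u ++ v | u <- adm l (belast y p.1) (last y p.1), v <- adm r p.2 x]
              | p <- unsh w']
    else [::]
  else if nilp w then [:: [:: x]] else [::].

Lemma adm_size t w x v : v \in adm t w x ->
  size v = leaves t /\ leaves t = (size w).+1.
Proof.
elim: t w x v => [|l IHl r IHr] w x v /=.
  by case: nilP => // -> ; rewrite inE => /eqP ->.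
case: w => [//|y w] /flattenP[s /mapP[p hp ->]] /allpairsP[[u1 u2]] /=.
case=> /IHl[s1 s2] /IHr[s3 s4] ->; rewrite size_cat s1 s3.
split=> //; rewrite s2 s4 size_belast addnS addSn.
by rewrite (eqP (allP (unsh_size w) _ hp)).
Qed.

Definition pbcoef t w x v : int := \sum_(u <- adm t w x) bcoef t u v.
End Bracketing.

Section BracketingCoef.
Context {R : comNzRingType} {A : choiceType}.
Implicit Types (t : btree) (u v w : seq A) (x y : A).

Lemma lie_bracket_sum (I J : Type) (r : seq I) (s : seq J) (c : I -> R) (d : J -> R)
    (P : I -> ncpoly R A) (Q : J -> ncpoly R A) :
  lie_bracket (\sum_(i <- r) c i *: P i) (\sum_(j <- s) d j *: Q j) =
  \sum_(i <- r) \sum_(j <- s) (c i * d j) *: lie_bracket (P i) (Q j).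
Proof.
rewrite /lie_bracket mulr_suml [X in _ - X]mulr_sumr -sumrB; apply: eq_bigr => i _.
rewrite mulr_sumr mulr_suml -sumrB; apply: eq_bigr => j _.
by rewrite -!scalerAl !ncpoly_scaleAr !scalerA [d j * _]mulrC -scalerBr.
Qed.

Lemma bracketingE t w :
  bracketing R t w = \sum_(p <- blist t w) (-1) ^+ p.1 *: ncword R p.2.
Proof.
elim: t w => [|l IHl r IHr] w; first by rewrite /= big_seq1 expr0 scale1r.
rewrite /= /lie_bracket IHl IHr big_cat !big_allpairs_dep /=; congr (_ + _).
  rewrite mulr_suml; apply: eq_bigr => p _; rewrite mulr_sumr; apply: eq_bigr => q _.
  by rewrite ncword_cat -scalerAl ncpoly_scaleAr scalerA signr_addb.
rewrite mulr_sumr -sumrN; apply: eq_bigr => p _.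
rewrite mulr_suml -sumrN; apply: eq_bigr => q _.
rewrite ncword_cat -scalerAl ncpoly_scaleAr scalerA signrN signr_addb scaleNr.
by rewrite [_ ^+ _ * _]mulrC.
Qed.

Lemma bracketing_coef t w v :
  (bracketing R t w)@_(FMonom v) = (bcoef t w v)%:~R.
Proof.
rewrite bracketingE raddf_sum /bcoef rmorph_sum; apply: eq_bigr => p _ /=.
rewrite mcoeffZ ncword_coef rmorphM rmorph_sign; congr (_ * _).
by case: eqP.
Qed.

Definition pbsum t w x : ncpoly R A := \sum_(v <- adm t w x) bracketing R t v.

Lemma pbsum_coef t w x v : (pbsum t w x)@_(FMonom v) = (pbcoef t w x v)%:~R.
Proof.
rewrite /pbsum raddf_sum /pbcoef rmorph_sum; apply: eq_bigr => u _.
exact: bracketing_coef.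
Qed.

Lemma pbsum_supp t w x : leaves t <> (size w).+1 -> pbsum t w x = 0.
Proof.
by move=> h; rewrite /pbsum big_seq big1 // => v /adm_size[_ /h].
Qed.

Lemma pbsum_node l r y w x : pbsum (BNode l r) (y :: w) x =
  \sum_(p <- unsh w)
    lie_bracket (pbsum l (belast y p.1) (last y p.1)) (pbsum r p.2 x).
Proof.
rewrite /pbsum [adm _ _ _]/= big_flatten /= big_map; apply: eq_bigr => p _.
rewrite big_allpairs_dep /lie_bracket mulr_suml mulr_sumr -sumrB.
rewrite big_seq [RHS]big_seq; apply: eq_bigr => u /adm_size[su _].
rewrite mulr_suml mulr_sumr -sumrB; apply: eq_bigr => v _.
by rewrite -su take_size_cat; [rewrite drop_size_cat|].
Qed.
End BracketingCoef.

(** The binary tree t_T for T = B_+(F), as a function of F. *)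
Definition fbt : forest -> btree := forest_binary tree_binary.

Lemma fbt_cons H F : fbt (Bplus H :: F) = BNode (fbt H) (fbt F).
Proof. by []. Qed.

Lemma leaves_fbt F : leaves (fbt F) = (fsize F).+1.
Proof.
elim/forest_ind: F => [//|H F IH IF].
by rewrite fbt_cons fsize_cons /= IH IF addSn addnS.
Qed.

(** * Enumeration of plane forests *)

(** Forests with n vertices; k bounds the depth of the recursion, and every k at
    least n gives the same forests. *)
Fixpoint fenum (k n : nat) : seq forest :=
  match k, n with
  | _, 0 => [:: [::]]
  | 0, _ => [::]
  | k'.+1, n'.+1 =>
    flatten [seq [seq Bplus H :: F | H <- fenum k' i, F <- fenum k' (n' - i)]
            | i <- iota 0 n'.+1]
  end.
Definition forests n := fenum n n.

Lemma fenumS k n : fenum k.+1 n.+1 =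
  flatten [seq [seq Bplus H :: F | H <- fenum k i, F <- fenum k (n - i)]
          | i <- iota 0 n.+1].
Proof. by []. Qed.

Lemma mem_fenum k n F : (n <= k)%N -> (F \in fenum k n) = (fsize F == n).
Proof.
elim: k n F => [|k IH] [|n] F nk //; [by rewrite inE fsize0|by rewrite inE fsize0|].
rewrite fenumS; apply/flattenP/idP => [[s /mapP[i hi ->]]|].
  move: hi; rewrite mem_iota => hi /allpairsP[[H G]] /= [].
  rewrite !IH; [|lia|lia] => /eqP h1 /eqP h2 ->.
  by rewrite fsize_cons; apply/eqP; lia.
case: F => [//|[H] G]; rewrite fsize_cons => /eqP[h].
exists [seq Bplus H0 :: F | H0 <- fenum k (fsize H), F <- fenum k (n - fsize H)].
  by apply/mapP; exists (fsize H); rewrite // mem_iota; lia.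
apply/allpairsP; exists (H, G) => /=.
by rewrite !IH; [split=> //; apply/eqP; lia|lia|lia].
Qed.

Lemma fenum_uniq k n : (n <= k)%N -> uniq (fenum k n).
Proof.
elim: k n => [|k IH] [|n] nk //.
rewrite fenumS; move: (leqnn n); rewrite -ltnS.
have : all (fun i => i < n.+1)%N (iota 0 n.+1).
  by apply/allP => i; rewrite mem_iota.
have := iota_uniq 0 n.+1; elim: (iota 0 n.+1) => [//|i s IHs] /= /andP[si us] /andP[hi hs] nn.
rewrite cat_uniq IHs // andbT; apply/andP; split.
  apply: allpairs_uniq; [by apply: IH; lia|by apply: IH; lia|].
  by move=> [? ?] [? ?] _ _ /= [-> ->].
apply/hasPn => F /flattenP[s' /mapP[j hj ->]] /allpairsP[[H G]] /= [h1 _ ->].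
apply/negP => /allpairsP[[H' G']] /= [h2 _ [e _]].
have jn : (j < n.+1)%N by apply: (allP hs).
move: h1 h2; rewrite -e !mem_fenum; [|lia|lia] => /eqP e1 /eqP e2.
by move: si; rewrite -e2 e1 hj.
Qed.

Lemma mem_forests n F : (F \in forests n) = (fsize F == n).
Proof. exact: mem_fenum. Qed.
Lemma forests_uniq n : uniq (forests n).
Proof. exact: fenum_uniq. Qed.

Lemma sum_forestsS (V : nmodType) (h : forest -> V) n :
  \sum_(F <- forests n.+1) h F =
  \sum_(i < n.+1) \sum_(H <- forests i) \sum_(G <- forests (n - i)) h (Bplus H :: G).
Proof.
rewrite /forests fenumS big_flatten big_map.
rewrite -[iota 0 n.+1]/(index_iota 0 n.+1) big_mkord; apply: eq_bigr => i _.
have pe j : (j <= n)%N -> perm_eq (fenum n j) (fenum j j).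
  move=> hj; apply: uniq_perm; rewrite ?fenum_uniq // => F.
  by rewrite !mem_fenum.
rewrite big_allpairs_dep (perm_big _ (pe i _)); last by rewrite -ltnS.
by apply: eq_bigr => H _; rewrite (perm_big _ (pe (n - i)%N _)) // leq_subr.
Qed.

(** * Expansion on the bracketings *)

Lemma mcoeff_sum (M : choiceType) (G : zmodType) (J : Type) (r : seq J)
    (P : pred J) (F : J -> {malg G[M]}) v :
  (\sum_(j <- r | P j) F j)@_v = \sum_(j <- r | P j) (F j)@_v.
Proof. exact: raddf_sum. Qed.

Section WordExpansion.
Context {k : comNzRingType} {A : choiceType}.
Notation K := (apoly k).
Notation L := (laurent K).
Notation a := (aseries k).

Lemma lcoefMz (f : L) (z : int) m : lcoef (f *~ z) m = lcoef f m *~ z.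
Proof. by case: z => n; rewrite ?NegzE ?mulrNz ?lcoefN lcoefMn. Qed.

Lemma lcoef_lmonMz c n (z : int) m :
  lcoef (lmon c n * z%:~R : L) m = if m == n then c *~ z else 0.
Proof. by rewrite mulrzr lcoefMz lcoef_lmon; case: eqP; rewrite ?mul0rz. Qed.

Lemma lcoef_lmonMMz c n (z : int) m :
  lcoef (a * (lmon c n * z%:~R) : L) m = (c * aseries_coef k (m - n)) *~ z.
Proof. by rewrite mulrA mulrzr lcoefMz mulrC lcoef_lmonM. Qed.

Lemma aseries_bot : lbot (-1) a.
Proof.
move=> m hm; rewrite lcoef_a /aseries_coef.
by case E: (m + 1) => [n|//]; lia.
Qed.

(** The two recursions of the Lax equations are those of the admissible
    bracketings.  In E_x the forest F occurs with z^(-k) for its k trees, and its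
    first tree comes from the factor Q_y of the commutator; the z^-1 part of
    a E_x turns F into B_+(F), with a new root having k children. *)
Lemma wplus_pbsum (y : A) w v :
  lcoef ((wplus a (y :: w))@_(FMonom v)) (-1) =
  \sum_(H <- forests (size w))
    (avar k (size H) * aforest k H) *~ pbcoef (fbt H) (belast y w) (last y w) v.
Proof.
have [Q [E [E0 ES Qc QE]]] := @word_lax _ A a aseries_bot.
pose Esum x w := \sum_(F <- forests (size w))
  lmon (aforest k F) (- (size F)%:Z) *: pbsum (fbt F) w x : ncpoly L A.
pose Qsum y w := \sum_(H <- forests (size w))
  lmon (avar k (size H) * aforest k H) (-1) *: pbsum (fbt H) (belast y w) (last y w)
  : ncpoly L A.
have Qlast y' w' v' m : lcoef ((Qsum y' w')@_(FMonom v')) m = if m == -1 then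
    \sum_(H <- forests (size w')) (avar k (size H) * aforest k H)
      *~ pbcoef (fbt H) (belast y' w') (last y' w') v' else 0.
  rewrite mcoeff_sum lcoef_sum; case: eqP => [->|/eqP hm].
    by apply: eq_bigr => H _; rewrite mcoeffZ pbsum_coef lcoef_lmonMz.
  apply: big1 => H _; rewrite mcoeffZ pbsum_coef lcoef_lmonMz.
  by rewrite (negPf hm).
have QofE y' w' : E (last y' w') (belast y' w') = Esum (last y' w') (belast y' w') ->
    Q y' w' = Qsum y' w'.
  move=> hE; apply: ncpolyP => v'; apply: laurentP => m; rewrite Qlast.
  case: eqP => [->|/eqP hm]; last first.
    have [h1 h2] := Qc y' w'; have [hm1|hm1] := ltP (-1) m; first exact: h1.
    by apply: h2; lia.
  have [-> _] := QE (last y' w') y' (belast y' w') w' (lastI y' w') (FMonom v').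
  rewrite hE mcoeffZ mcoeff_sum mulr_sumr lcoef_sum size_belast.
  apply: eq_bigr => F _; rewrite mcoeffZ pbsum_coef lcoef_lmonMMz /aseries_coef.
  have -> : -1 - - (size F)%:Z + 1 = (size F)%:Z by lia.
  by rewrite [aforest k F * _]mulrC.
have EE x w' : E x w' = Esum x w'.
  have [n] := ubnP (size w'); elim: n x w' => // n IH x [|y' w'] hw.
    by rewrite E0 /Esum big_seq1 /aforest big_nil lmon1 scale1r /pbsum /= big_seq1.
  rewrite ES /Esum sum_forestsS.
  transitivity (\sum_(p <- unsh w') lie_bracket (Qsum y' p.1) (Esum x p.2)).
    apply: eq_big_seq => p hp.
    have /eqP sp := allP (unsh_size w') _ hp; rewrite /= in sp.
    have hw' : (size w' < n)%N := hw.
    have -> : Q y' p.1 = Qsum y' p.1.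
      apply: QofE; apply: IH; rewrite size_belast.
      by apply: leq_ltn_trans hw'; rewrite -sp leq_addr.
    have -> // : E x p.2 = Esum x p.2.
    by apply: IH; apply: leq_ltn_trans hw'; rewrite -sp leq_addl.
  transitivity (\sum_(p <- unsh w') \sum_(i < (size w').+1) \sum_(H <- forests i)
     \sum_(G <- forests (size w' - i)) lmon (aforest k (Bplus H :: G))
       (- (size (Bplus H :: G))%:Z) *:
     lie_bracket (pbsum (fbt H) (belast y' p.1) (last y' p.1)) (pbsum (fbt G) p.2 x)
     : ncpoly L A); last first.
    rewrite exchange_big; apply: eq_bigr => i _; rewrite exchange_big; apply: eq_bigr => H _.
    rewrite exchange_big; apply: eq_bigr => G _.
    by rewrite fbt_cons pbsum_node scaler_sumr.
  apply: eq_big_seq => p hp.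
  have /eqP sp := allP (unsh_size w') _ hp; rewrite /= in sp.
  have hi : (size p.1 < (size w').+1)%N by rewrite ltnS -sp leq_addr.
  rewrite (bigD1 (Ordinal hi)) //= [X in _ + X]big1 ?addr0 => [|i ip]; last first.
    rewrite big_seq big1 // => H; rewrite mem_forests => /eqP hH.
    rewrite big1 // => G _; rewrite [pbsum (fbt H) _ _]pbsum_supp ?leaves_fbt ?size_belast.
      by rewrite /lie_bracket mul0r mulr0 subrr scaler0.
    by move: ip; rewrite -val_eqE /= => /eqP ip [e]; apply: ip; rewrite -hH e.
  rewrite (_ : (size w' - size p.1)%N = size p.2); last by rewrite -sp addKn.
  rewrite /Qsum /Esum lie_bracket_sum; apply: eq_bigr => H _; apply: eq_bigr => G _.
  rewrite lmonM -[Bplus H :: G]cat1s aforest_cat aforest_tree; congr (lmon _ _ *: _).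
  by rewrite /=; lia.
have [_ <-] := QE (last y w) y (belast y w) w (lastI y w) (FMonom v).
by rewrite QofE // Qlast.
Qed.

Lemma wplus_shuf (w : seq A) v :
  lcoef ((wplus a w)@_(FMonom v)) (-1) =
  \sum_(I <- comps (size w)) residue (bplus a I) *+ count_mem v (shuf I w).
Proof.
rewrite /wplus /Ssum mcoeff_sum lcoef_sum; apply: eq_bigr => I _.
rewrite mcoeffZ Sprod_shuf mcoeff_sum.
rewrite (eq_bigr (fun u => (u == v)%:R)) => [|u _]; last exact: ncword_coef.
by rewrite -natr_sum -sum1_count -big_mkcond mulr_natr lcoefMn.
Qed.

(** Both sides are the coefficient of a_lambda in the z^-1 part of sigma^+ on
    the word y w, expanded on the S^I and on the bracketings. *)
Lemma dcoef_shuf n l (y : A) w v : n = (size w).+1 ->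
  \sum_(I <- comps n) @dcoef k n l I *+ count_mem v (shuf I (y :: w)) =
  \sum_(H <- forests (size w) | tmon (Bplus H) == lmono n l)
     (pbcoef (fbt H) (belast y w) (last y w) v)%:~R :> k.
Proof.
move=> ->; have := etrans (esym (wplus_shuf (y :: w) v)) (wplus_pbsum y w v).
move=> /(congr1 (mcoeff (lmono (size w).+1 l))); rewrite !mcoeff_sum => h.
transitivity (\sum_(I <- comps (size w).+1)
   (residue (bplus a I) *+ count_mem v (shuf I (y :: w)))@_(lmono (size w).+1 l)).
  by apply: eq_bigr => I _; rewrite raddfMn.
rewrite h [RHS]big_mkcond; apply: eq_bigr => H _.
rewrite -aforest_tree aforest_mon raddfMz [X in X *~ _]mcoeff_mon.
by case: eqP => _; rewrite ?mul0rz.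
Qed.
End WordExpansion.

(** * Ribbons and complete functions *)

Definition hmap (i : nat) (J : seq nat) : seq (seq nat) :=
  if J is j :: J' then [:: (i + j)%N :: J'] else [::].

(** The compositions coarser than I: the first part is kept, or merged with the
    first part of a composition coarser than the rest. *)
Fixpoint coars (I : seq nat) : seq (seq nat) :=
  if I is i :: I' then
    [seq i :: J | J <- coars I'] ++ flatten [seq hmap i J | J <- coars I']
  else [:: [::]].

Lemma coars_size I J : J \in coars I -> (size J <= size I)%N.
Proof.
elim: I J => [|i I IH] J; first by rewrite inE => /eqP ->.
rewrite mem_cat => /orP[/mapP[K /IH hK ->] //|/flattenP[s /mapP[[|j K] /IH hK ->]]] //.
by rewrite inE => /eqP -> /=; apply: leqW.
Qed.

Lemma coars0 I J : 0%N \notin I -> J \in coars I -> 0%N \notin J /\ sumn J = sumn I.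
Proof.
elim: I J => [|i I IH] J; first by move=> _; rewrite inE => /eqP ->.
rewrite inE negb_or => /andP[i0 I0].
rewrite mem_cat => /orP[/mapP[K /(IH _ I0)[hK sK] ->]|].
  by rewrite inE negb_or i0 /= sK.
case/flattenP => s /mapP[[|j K] /(IH _ I0)[hK sK] ->] //.
rewrite inE => /eqP ->; move: hK sK; rewrite !inE !negb_or /= => /andP[j0 ->] <-.
by rewrite andbT addnA; split=> //; apply/eqP; move/eqP: i0; lia.
Qed.

Lemma coars_coarser I J : J \in coars I -> coarser J I.
Proof.
elim: I J => [|i I IH] J; first by rewrite inE => /eqP ->; exists [::].
rewrite mem_cat => /orP[/mapP[K /IH[Is [-> ->]] ->]|].
  by exists ([:: i] :: Is); rewrite /= addn0.
case/flattenP => s /mapP[[|j K] /IH[[|I1 Is] [-> eK]] ->] //.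
rewrite inE => /eqP ->; exists ((i :: I1) :: Is).
by case: eK => -> ->.
Qed.

Lemma coarser_coars I J : 0%N \notin I -> 0%N \notin J -> coarser J I -> J \in coars I.
Proof.
move=> I0 J0 [Is [eI eJ]]; rewrite {}eJ in J0 *.
elim: I I0 Is eI J0 => [|i I IH] I0 [|[|i' K] Is] eI J0 //.
case: eI J0 => <- {i'} eI; rewrite /= inE negb_or => /andP[_ J0].
move: I0; rewrite inE negb_or => /andP[i0 I0].
rewrite mem_cat; apply/orP; case: K eI => [|k K] eI.
  by left; rewrite addn0; apply: map_f; apply: IH.
right; apply/flattenP; exists (hmap i (sumn (k :: K) :: map sumn Is)); last by rewrite inE.
apply: map_f; apply: (IH _ ((k :: K) :: Is)) => //=.
rewrite inE negb_or J0 andbT; move: I0; rewrite eI inE negb_or => /andP[k0 _].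
by apply/eqP; move/eqP: k0; lia.
Qed.

Lemma uniq_flatten_map (T S : eqType) (f : T -> seq S) (r : seq T) :
  uniq r -> {in r, forall x, uniq (f x)} ->
  {in r &, forall x y z, z \in f x -> z \in f y -> x = y} ->
  uniq (flatten [seq f x | x <- r]).
Proof.
elim: r => [//|x r IH] /= /andP[xr ur] hu hd; rewrite cat_uniq hu ?inE ?eqxx //=.
rewrite IH ?andbT // => [|y hy|y z hy hz]; last first.
- by apply: hd; rewrite inE ?hy ?hz orbT.
- by apply: hu; rewrite inE hy orbT.
apply/hasPn => z /flattenP[s /mapP[y hy ->]] hz; apply/negP => hzx.
move: xr; rewrite (hd x y _ _ z) ?hy // ?inE ?eqxx //.
by rewrite hy orbT.
Qed.

Lemma coars_uniq I : 0%N \notin I -> uniq (coars I).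
Proof.
elim: I => [//|i I IH]; rewrite inE negb_or => /andP[i0 I0] /=.
rewrite cat_uniq map_inj_uniq ?IH //= => [|? ? [->] //].
apply/andP; split.
  apply/hasPn => K /flattenP[s /mapP[[|j J] hJ ->]] //; rewrite inE => /eqP ->.
  apply/mapP => -[J' _ [e _]].
  by have [] := coars0 I0 hJ; rewrite inE negb_or; case: j e {hJ} => // j; lia.
apply: uniq_flatten_map; first exact: IH.
  by move=> [|j J] _.
move=> [|j J] [|j' J'] _ _ K //=; rewrite !inE => /eqP -> /eqP [] /addnI -> ->.
by [].
Qed.

Section Ribbon.
Variable A : nzRingType.
Implicit Types (s : seq nat -> A).

Definition ribbon s I := \sum_(J <- coars I) (-1) ^+ (size I - size J) * s J.
(** Prepending i to the first part; the value 0 at the empty composition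
    corresponds to there being no part to merge with. *)
Definition smerge s i J := if J is j :: J' then s ((i + j)%N :: J') else 0.

Lemma sum_hmap s i (r : seq (seq nat)) :
  \sum_(K <- flatten [seq hmap i J | J <- r]) s K = \sum_(J <- r) smerge s i J.
Proof.
rewrite big_flatten /= big_map; apply: eq_bigr => -[|j J] _; first by rewrite big_nil.
by rewrite big_seq1.
Qed.

Lemma ribbon_cons s i I :
  ribbon s (i :: I) = ribbon (s \o cons i) I - ribbon (smerge s i) I.
Proof.
rewrite /ribbon big_cat big_map; congr (_ + _).
rewrite (sum_hmap (fun K => (-1) ^+ (size (i :: I) - size K) * s K)) -sumrN.
rewrite big_seq [RHS]big_seq; apply: eq_bigr => -[|j J] /coars_size hJ.
  by rewrite /= mulr0 oppr0.
rewrite /= subSS -mulNr; rewrite /= in hJ.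
by rewrite -(subnSK hJ) exprS mulN1r.
Qed.

Lemma ribbon_smerge s i j J : ribbon (smerge s i) (j :: J) = ribbon s ((i + j)%N :: J).
Proof.
rewrite !ribbon_cons; congr (_ - _); apply: eq_bigr => -[|l K] _ //=.
by rewrite addnA.
Qed.

(** Moebius inversion for the refinement order. *)
Lemma sum_ribbon s I : \sum_(J <- coars I) ribbon s J = s I.
Proof.
elim: I s => [|i I IH] s; first by rewrite /= big_seq1 /ribbon big_seq1 mul1r.
rewrite big_cat big_map (sum_hmap (ribbon s)) -[RHS](IH (s \o cons i)).
transitivity (\sum_(J <- coars I) (ribbon s (i :: J) + smerge (ribbon s) i J)).
  by rewrite big_split.
apply: eq_bigr => J _; rewrite ribbon_cons.
case: J => [|j J]; last by rewrite ribbon_smerge /= subrK.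
by rewrite {2}/ribbon big_seq1 mulr0 subr0 addr0.
Qed.

Lemma RI_ribbon I F : 0%N \notin I -> RI A I F = ribbon (fun J => SI A J F) I.
Proof.
move=> I0; rewrite /RI /ribbon [RHS]fsbig_seq ?coars_uniq //.
suff -> : [set J | compositions (sumn I) J /\ coarser J I]%classic = [set` coars I]%classic by [].
apply/seteqP; split=> J /=.
  by case=> -[J0 _] h; apply: coarser_coars.
by move=> h; have [h1 h2] := coars0 I0 h; split; [split|apply: coars_coarser].
Qed.
End Ribbon.

(** * Descents of words *)

Lemma descents_cons x y w : descents (x :: y :: w) =
  (if (y < x)%N then [:: 1%N] else [::]) ++ map S (descents (y :: w)).
Proof.
rewrite /descents; set P := fun i => (nth 0 [:: x, y & w] i < _)%N.
have -> : iota 1 (size [:: x, y & w]).-1 = 1%N :: map S (iota 1 (size w)).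
  by rewrite /= -(iotaDl 1 1).
rewrite -cat1s filter_cat filter_map; congr (_ ++ map S _).
by apply: eq_in_filter => -[|i]; rewrite mem_iota.
Qed.

Lemma comp_descents_cons i I : comp_descents (i :: I) =
  if I is [::] then [::] else i :: map (addn i) (comp_descents I).
Proof.
case: I => [//|j I]; rewrite /comp_descents /=.
rewrite addn0; congr cons.
by rewrite (iotaDl 1 1) -!map_comp; apply: eq_map => l /=.
Qed.

Lemma comp_descents_hincr J : comp_descents (hincr J) = map S (comp_descents J).
Proof.
case: J => [|j [|l J]] //; rewrite [hincr _]/= (comp_descents_cons j.+1) (comp_descents_cons j).
rewrite map_cons; congr cons; rewrite -[RHS]map_comp.
by apply: eq_map => m; rewrite /= addSn.
Qed.

Lemma coars_hincr i I : coars (i.+1 :: I) = map hincr (coars (i :: I)).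
Proof.
rewrite /= map_cat -map_comp; congr (_ ++ _).
by rewrite map_flatten -map_comp; congr flatten; apply: eq_map => -[|j J].
Qed.

Fixpoint blockinc (I : seq nat) (w : seq nat) : bool :=
  if I is i :: I' then sorted leq (take i w) && blockinc I' (drop i w) else nilp w.

Lemma descents0 w : 0%N \notin descents w.
Proof. by rewrite mem_filter mem_iota /= andbF. Qed.

Lemma comp_descents0 J : 0%N \notin J -> 0%N \notin comp_descents J.
Proof.
case: J => [//|i J]; rewrite inE negb_or comp_descents_cons => /andP[i0 _].
case: J => [//|j J]; rewrite inE negb_or i0 /=; apply/mapP => -[l _].
by move/eqP: i0; lia.
Qed.

(** A word with descent set that of some J coarser than I increases on the
    blocks of I, and J is determined by the word. *)
Lemma sum_coars_descents I w : 0%N \notin I -> sumn I = size w ->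
  (\sum_(J <- coars I) (descents w == comp_descents J) = blockinc I w)%N.
Proof.
elim: w I => [|x w IH] [|i I] //.
- by move=> _ _; rewrite big_seq1.
- by rewrite inE negb_or; case: i.
rewrite inE negb_or => /andP[]; case: i => // i _ I0 [hs].
have Sinj : injective S by move=> ? ? [].
case: w IH hs => [|y w] IH hs.
  have [-> ->] : i = 0%N /\ I = [::].
    case: I I0 hs => [|[|j] I] //= _; last by rewrite addnS.
    by rewrite addn0 => ->.
  by rewrite big_seq1.
have noS (s t : seq nat) : (map S s == 1%N :: map S t) = (0%N \in s) && (map S s == 1%N :: map S t).
  apply/idP/andP => [/eqP h|[]//]; rewrite -h eqxx; split=> //.
  by rewrite -(mem_map Sinj) h inE.
case: i hs => [|i] hs; last first.
  rewrite coars_hincr big_map.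
  transitivity ((x <= y) * blockinc (i.+1 :: I) (y :: w))%N; last first.
    by rewrite /=; case: (x <= y)%N; rewrite ?mul1n.
  rewrite -(IH (i.+1 :: I) _ hs); last by rewrite inE negb_or I0.
  rewrite big_distrr big_seq [RHS]big_seq; apply: eq_bigr => J hJ.
  have [|J0 _] := coars0 _ hJ; first by rewrite inE negb_or I0.
  rewrite comp_descents_hincr descents_cons [(y < x)%N]ltnNge /=.
  case: (x <= y)%N; rewrite /= ?mul1n ?mul0n.
    by rewrite (inj_eq (inj_map Sinj)).
  by rewrite eq_sym noS (negPf (comp_descents0 J0)).
transitivity (blockinc I (y :: w) : nat); last by [].
rewrite -IH // big_cat big_map big_flatten /= big_map -big_split /=.
rewrite big_seq [RHS]big_seq; apply: eq_bigr => -[|j J] hJ.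
  by have [_ e] := coars0 I0 hJ; rewrite -e in hs.
have [J0 _] := coars0 I0 hJ.
rewrite big_seq1 descents_cons comp_descents_cons -[(0 + j)%N.+1 :: J]/(hincr (j :: J)).
rewrite comp_descents_hincr; case: ltnP => _ /=.
  rewrite eqseq_cons eqxx (inj_eq (inj_map Sinj)) /=.
  rewrite [X in (_ + X)%N](_ : _ = 0%N) ?addn0 //.
  by rewrite eq_sym noS (negPf (comp_descents0 J0)).
by rewrite noS (negPf (descents0 _)) (inj_eq (inj_map Sinj)).
Qed.

(** * Unshuffles, shuffles and admissible words of words without repetition *)

Section Unsh.
Context {T : eqType}.
Implicit Types (u v w : seq T).

Lemma unsh_filter (a : pred T) w : (filter a w, filter (predC a) w) \in unsh w.
Proof.
elim: w => [|x w IH] //=; rewrite mem_cat; apply/orP.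
by case: (a x); [left|right]; apply/mapP; exists (filter a w, filter (predC a) w).
Qed.

Lemma unsh_subseq w p : p \in unsh w -> subseq p.1 w /\ subseq p.2 w.
Proof.
elim: w p => [|x w IH] p; first by rewrite inE => /eqP ->.
rewrite mem_cat => /orP[] /mapP[q /IH[h1 h2] ->] /=; rewrite ?eqxx; split=> //.
  exact: subseq_trans h2 (subseq_cons w x).
exact: subseq_trans h1 (subseq_cons w x).
Qed.

Lemma unsh_perm w p : p \in unsh w -> perm_eq (p.1 ++ p.2) w.
Proof.
elim: w p => [|x w IH] p; first by rewrite inE => /eqP ->.
rewrite mem_cat => /orP[] /mapP[q /IH h ->] /=; first by rewrite perm_cons.
by rewrite -cat1s perm_catCA cat1s perm_cons.
Qed.

(** The second subword consists of the letters missing from the first. *)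
Lemma unsh_inj w p q : uniq w -> p \in unsh w -> q \in unsh w -> p.1 = q.1 -> p = q.
Proof.
move=> uw.
have h r : r \in unsh w -> r.2 = [seq x <- w | x \notin r.1].
  move=> hr; have [_ /subseq_uniqP-/(_ uw) e2] := unsh_subseq hr.
  have hp := unsh_perm hr; rewrite {1}e2; apply: eq_in_filter => x xw.
  have := perm_uniq hp; rewrite uw cat_uniq => /and3P[_ /hasPn hd _].
  have := perm_mem hp x; rewrite xw mem_cat /=.
  by case h2 : (x \in r.2); [have /negPf -> := hd _ h2|rewrite orbF => ->].
by case: p q => [p1 p2] [q1 q2] /h /= -> /h /= -> ->.
Qed.

Lemma unsh_uniq w : uniq w -> uniq (unsh w).
Proof.
elim: w => [//|x w IH] /= /andP[xw uw]; rewrite cat_uniq.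
rewrite !map_inj_uniq ?IH // => [|[a b] [c d] [-> ->] //|[a b] [c d] [-> ->] //].
rewrite andbT; apply/hasPn => p /mapP[q hq ->]; apply/mapP => -[r _ [e _]].
have [/mem_subseq h _] := unsh_subseq hq; case/negP: xw; apply: h.
by rewrite e inE eqxx.
Qed.

Lemma shuf_uniq I w : uniq w -> uniq (shuf I w).
Proof.
elim: I w => [|i I IH] w uw; first by rewrite /=; case: nilp.
have hu p : p \in unsh w -> uniq p.2.
  by move=> /unsh_subseq[_ h]; apply: subseq_uniq h uw.
apply: allpairs_uniq_dep.
- by apply: filter_uniq; apply: unsh_uniq.
- by move=> p; rewrite mem_filter => /andP[_ /hu]; apply: IH.
move=> [p s] [q t] /allpairsPdep[p' [s' [hp _ [-> ->]]]].
case/allpairsPdep => [q' [t' [hq _ [-> ->]]]] /= e.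
move: hp hq; rewrite !mem_filter => /andP[/eqP sp hp] /andP[/eqP sq hq].
move/eqP: e; rewrite eqseq_cat ?sp ?sq // => /andP[/eqP e1 /eqP ->].
by rewrite (unsh_inj uw hp hq e1).
Qed.

Lemma adm_uniq t w x : uniq (rcons w x) -> uniq (adm t w x).
Proof.
elim: t w x => [|l IHl r IHr] w x uw; first by rewrite /=; case: nilp.
case: w uw => [//|y w]; rewrite rcons_cons => /= /andP[yw uw].
have uw' : uniq w by move: uw; rewrite rcons_uniq => /andP[].
have hx : x \notin w by move: uw; rewrite rcons_uniq => /andP[].
apply: uniq_flatten_map; first exact: unsh_uniq.
  move=> p /unsh_subseq[h1 h2]; apply: allpairs_uniq.
  - apply: IHl; rewrite -lastI /= (subseq_uniq h1) // andbT.
    apply/negP => /(mem_subseq h1) yw1; case/negP: yw.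
    by rewrite mem_rcons inE yw1 orbT.
  - apply: IHr; rewrite rcons_uniq (subseq_uniq h2) // andbT.
    by apply/negP => /(mem_subseq h2); rewrite (negPf hx).
  move=> a b /allpairsP[a' [ha _ ->]] /allpairsP[b' [hb _ ->]].
  rewrite /uncurry => /eqP; rewrite eqseq_cat; first by case/andP => /eqP -> /eqP ->.
  by rewrite (adm_size ha).1 (adm_size hb).1.
have hperm t' w' x' : {in adm t' w' x', forall v, perm_eq v (rcons w' x')}.
  elim: t' w' x' => [|l' IHl' r' IHr'] w' x' v /=.
    by case: nilP => // ->; rewrite inE => /eqP ->.
  case: w' => [//|y' w'] /flattenP[s /mapP[p hp ->]] /allpairsP[[u1 u2]] /=.
  case=> /IHl' h1 /IHr' h2 ->; rewrite (perm_trans (perm_cat h1 h2)) //.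
  by rewrite -lastI /= perm_cons -rcons_cat -!cats1 perm_cat2r unsh_perm.
move=> p q hp hq v /allpairsP[a [h1 _ e1]] /allpairsP[b [h2 _ e2]].
have ea : a.1 = b.1.
  move/eqP: e2; rewrite e1 eqseq_cat ?(adm_size h1).1 ?(adm_size h2).1 //.
  by case/andP => /eqP.
apply: (unsh_inj uw' hp hq).
have [/subseq_uniqP-/(_ uw') -> _] := unsh_subseq hp.
have [/subseq_uniqP-/(_ uw') -> _] := unsh_subseq hq.
apply: eq_in_filter => z zw.
have hz : z != y.
  apply/eqP => e; case/negP: yw; by rewrite -e mem_rcons inE zw orbT.
have := perm_mem (hperm _ _ _ _ h1) z; rewrite ea (perm_mem (hperm _ _ _ _ h2) z).
by rewrite -!lastI !inE (negPf hz).
Qed.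
End Unsh.

Section Naturality.
Context {T S : eqType} (f : T -> S).

Lemma unsh_map w : unsh (map f w) = [seq (map f p.1, map f p.2) | p <- unsh w].
Proof.
elim: w => [//|x w IH] /=; rewrite IH map_cat -!map_comp.
by congr (_ ++ _); apply: eq_map.
Qed.

Lemma shuf_map I w : shuf I (map f w) = [seq map f v | v <- shuf I w].
Proof.
elim: I w => [|i I IH] w; first by case: w.
rewrite /= unsh_map filter_map map_flatten -!map_comp; congr flatten.
rewrite (eq_filter (a2 := fun p => size p.1 == i)) => [|p]; last by rewrite /= size_map.
apply: eq_map => p /=; rewrite IH -!map_comp; apply: eq_map => v /=.
by rewrite map_cat.
Qed.

Lemma adm_map t w x : adm t (map f w) (f x) = [seq map f v | v <- adm t w x].
Proof.
elim: t w x => [|l IHl r IHr] w x; first by case: w.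
case: w => [//|y w]; rewrite [LHS]/= unsh_map map_flatten -!map_comp; congr flatten.
apply: eq_map => p /=; rewrite last_map belast_map IHl IHr.
rewrite map_allpairs allpairs_mapl allpairs_mapr; apply: eq_allpairs => u v.
by rewrite map_cat.
Qed.

Lemma blist_map t w :
  blist t (map f w) = [seq (p.1, map f p.2) | p <- blist t w].
Proof.
elim: t w => [//|l IHl r IHr] w /=.
rewrite -map_take -map_drop IHl IHr map_cat !map_allpairs.
by congr (_ ++ _); rewrite allpairs_mapl allpairs_mapr; apply: eq_allpairs => p q;
  rewrite /= map_cat.
Qed.

End Naturality.

Lemma sorted_ltn_uniq (w : seq nat) : sorted ltn w -> uniq w.
Proof. exact: sorted_uniq ltn_trans ltnn w. Qed.

Lemma subseq_ltn (s w : seq nat) : subseq s w -> sorted ltn w -> sorted ltn s.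
Proof. exact: (@subseq_sorted _ ltn ltn_trans). Qed.

Lemma sorted_ltn_leq (w : seq nat) : sorted ltn w -> sorted leq w.
Proof. by apply: sub_sorted => x y; apply: ltnW. Qed.

(** On the word 12...n, the shuffles of S^I are the words increasing along the
    blocks of I: the first block, being increasing, is a subword of w. *)
Lemma mem_shuf I w v : sorted ltn w -> sumn I = size w ->
  (v \in shuf I w) = perm_eq v w && blockinc I v.
Proof.
elim: I w v => [|i I IH] w v sw sI.
  by case: w sw sI => // _ _; rewrite inE; case: v => //= x v; rewrite andbF.
apply/allpairsPdep/andP.
  case=> p [s [hp hs ->]]; move: hp; rewrite mem_filter => /andP[/eqP sp hp].
  have [h1 h2] := unsh_subseq hp.
  have s2 : sumn I = size p.2.
    by have /eqP := allP (unsh_size w) _ hp; rewrite sp -sI => /addnI.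
  move: hs; rewrite (IH _ _ (subseq_ltn h2 sw) s2) => /andP[ps bs].
  split; last first.
    by rewrite /= -sp take_size_cat // drop_size_cat // bs andbT;
       apply/sorted_ltn_leq/(subseq_ltn h1 sw).
  apply: perm_trans (unsh_perm hp); by rewrite perm_cat2l.
move=> [pv /= /andP[su bs]]; set u := take i v in su *.
pose p := ([seq z <- w | z \in u], [seq z <- w | predC (mem u) z]).
have sv : size v = size w by apply: perm_size.
have sizeu : size u = i by rewrite size_takel // sv -sI leq_addr.
have uw := sorted_ltn_uniq sw.
have uv : uniq v by rewrite (perm_uniq pv).
have hp : p \in unsh w by apply: unsh_filter.
have uu : uniq u by apply: take_uniq.
have eu : u = p.1.
  apply: (sorted_eq leq_trans anti_leq su).
    by apply/sorted_ltn_leq/(sorted_filter ltn_trans).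
  apply: uniq_perm => //; first exact: filter_uniq.
  move=> z; rewrite mem_filter; case zu : (z \in u) => //=.
  by rewrite -(perm_mem pv); apply/esym/(mem_take zu).
exists p, (drop i v); rewrite mem_filter -eu sizeu eqxx hp cat_take_drop; split=> //.
rewrite IH; first 1 last.
- exact: (sorted_filter ltn_trans).
- have /eqP := allP (unsh_size w) _ hp; rewrite -eu sizeu -sI => /addnI -> //.
rewrite bs andbT; have := unsh_perm hp; rewrite -eu => h.
have : perm_eq (u ++ drop i v) (u ++ p.2).
  by rewrite cat_take_drop (perm_trans pv) // perm_sym.
by rewrite perm_cat2l.
Qed.

(** The first letter of an increasing word is the smallest label and the last
    letter the greatest one.  The labels of the left subtree other than the first
    letter, and those of the right subtree other than the last letter, form an
    unshuffle of the letters in between. *)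
Lemma mem_adm t w x v : sorted ltn (rcons w x) -> leaves t = (size w).+1 ->
  (v \in adm t w x) = perm_eq v (rcons w x) && admissible_labels t v.
Proof.
elim: t w x v => [|l IHl r IHr] w x v sw st.
  case: st => /esym/size0nil ->; rewrite /= inE andbT.
  by apply/eqP/idP => [-> //|/perm_small_eq ->].
have lgt0 t' : (0 < leaves t')%N by elim: t' => //= ? + ? _; lia.
case: w sw st => [|y w] sw st; first by move: (lgt0 l) (lgt0 r) st => /=; lia.
have uw := sorted_ltn_uniq sw.
have yw : y \notin rcons w x by move: uw => /= /andP[].
have sw' : sorted ltn w.
  apply: subseq_ltn _ sw; rewrite rcons_cons -cats1.
  exact: subseq_trans (prefix_subseq _ _) (subseq_cons _ _).
have xw : x \notin y :: w by move: uw; rewrite rcons_uniq => /andP[].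
have subs s : subseq s w -> sorted ltn (y :: s) /\ sorted ltn (rcons s x).
  move=> h; split; apply: (subseq_ltn _ sw).
    by rewrite rcons_cons /= eqxx -cats1; apply: subseq_trans h (prefix_subseq _ _).
  rewrite rcons_cons; apply: (subseq_trans _ (subseq_cons _ _)).
  by rewrite -!cats1 subseq_cat2r.
have miny z : z \in rcons (y :: w) x -> (y <= z)%N.
  rewrite rcons_cons inE => /orP[/eqP -> //|hz].
  by move: sw; rewrite /= path_sortedE; [case/andP => /allP/(_ _ hz)/ltnW|exact: ltn_trans].
have maxx z : z \in rcons (y :: w) x -> (z <= x)%N.
  rewrite mem_rcons inE => /orP[/eqP -> //|hz].
  move: sw; rewrite -cats1 (sorted_pairwise ltn_trans).
  by rewrite pairwise_cat => /and3P[/allrelP/(_ z x hz)]; rewrite inE eqxx => /(_ isT)/ltnW.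
apply/flattenP/andP.
  case=> s /mapP[p hp ->] /allpairsP[[u1 u2]] /= [h1 h2 ->].
  have [hs1 hs2] := unsh_subseq hp.
  have [l1 l2] := adm_size h1; have [r1 r2] := adm_size h2.
  move: h1 h2; rewrite IHl // -?lastI; last exact: (subs _ hs1).1.
  rewrite IHr //; last exact: (subs _ hs2).2.
  move=> /andP[p1 a1] /andP[p2 a2].
  have pv : perm_eq (u1 ++ u2) (rcons (y :: w) x).
    rewrite (perm_trans (perm_cat p1 p2)) // rcons_cons cat_cons perm_cons.
    by rewrite -rcons_cat -!cats1 perm_cat2r unsh_perm.
  split=> //; rewrite take_size_cat // drop_size_cat // a1 a2 !andbT.
  apply/andP; split.
    apply/hasP; exists y; first by rewrite (perm_mem p1) inE eqxx.
    by apply/allP => z; rewrite (perm_mem pv) => /miny.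
  apply/hasP; exists x; first by rewrite (perm_mem p2) mem_rcons inE eqxx.
  by apply/allP => z; rewrite (perm_mem pv) => /maxx.
move=> [pv /= /and4P[/hasP[y' hy' /allP hy] /hasP[x' hx' /allP hx] al ar]].
set u1 := take _ v in hy' al *; set u2 := drop _ v in hx' ar *.
have uv : uniq v by rewrite (perm_uniq pv).
have hu z : z \in u1 -> z \notin u2.
  move=> hz; move: uv; rewrite -(cat_take_drop (leaves l) v) cat_uniq.
  by case/and3P => _ /hasPn h _; apply/negP => /h; rewrite /= hz.
have yu1 : y \in u1.
  have yv : y \in v by rewrite (perm_mem pv) inE eqxx.
  suff -> : y = y' by [].
  by apply/eqP; rewrite eqn_leq hy // miny // -(perm_mem pv) (mem_take hy').
have xu2 : x \in u2.
  have xv : x \in v by rewrite (perm_mem pv) mem_rcons inE eqxx.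
  suff -> : x = x' by [].
  by apply/eqP; rewrite eqn_leq hx //= maxx // -(perm_mem pv) (mem_drop hx').
have su1 : size u1 = leaves l.
  by rewrite size_takel // (perm_size pv) size_rcons /= -[(size w).+2]st /= leq_addr.
have su2 : size u2 = leaves r.
  by rewrite size_drop (perm_size pv) size_rcons /= -[(size w).+2]st /= addKn.
have hmem z : (z \in u1) || (z \in u2) = (z \in rcons (y :: w) x).
  by rewrite -(perm_mem pv) -(cat_take_drop (leaves l) v) mem_cat.
pose p := ([seq z <- w | z \in u1], [seq z <- w | predC (mem u1) z]).
have hp : p \in unsh w by apply: unsh_filter.
have [hs1 hs2] := unsh_subseq hp.
have yw2 : y \notin w by apply: contra yw; rewrite mem_rcons inE orbC => ->.
have xw2 : x \notin w by apply: contra xw; rewrite inE orbC => ->.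
have p1 : perm_eq u1 (y :: p.1).
  apply: uniq_perm; [exact: take_uniq|exact/sorted_ltn_uniq/(subs _ hs1).1|].
  move=> z; rewrite inE mem_filter; case zu1: (z \in u1); last first.
    by rewrite orbF; apply/esym/negP => /eqP e; move: zu1; rewrite e yu1.
  move: (hmem z); rewrite zu1 rcons_cons inE mem_rcons inE => /esym.
  case: eqP => //= _ /orP[/eqP e|-> //].
  by move: (hu _ zu1); rewrite e xu2.
have p2 : perm_eq u2 (rcons p.2 x).
  apply: uniq_perm; [exact: drop_uniq|exact/sorted_ltn_uniq/(subs _ hs2).2|].
  move=> z; rewrite mem_rcons inE mem_filter /=; case zu2: (z \in u2); last first.
    apply/esym/negP => /orP[/eqP e|/andP[zu1 zw]]; first by move: zu2; rewrite e xu2.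
    by move: (hmem z); rewrite (negPf zu1) zu2 rcons_cons inE mem_rcons inE zw !orbT.
  have zu1 : z \notin u1 by apply/negP => /hu; rewrite zu2.
  move: (hmem z); rewrite zu2 orbT rcons_cons inE mem_rcons inE zu1 => /esym.
  by case/orP => [/eqP e|//]; move: zu1; rewrite e yu1.
exists [seq u ++ v | u <- adm l (belast y p.1) (last y p.1), v <- adm r p.2 x].
  by apply: map_f.
apply/allpairsP; exists (u1, u2); split=> /=; last by rewrite cat_take_drop.
  rewrite IHl -?lastI ?p1 //; first exact: (subs _ hs1).1.
  by rewrite size_belast -su1 (perm_size p1).
rewrite IHr ?p2 //; first exact: (subs _ hs2).2.
by rewrite -su2 (perm_size p2) size_rcons.
Qed.

(** * Words of permutations *)

Section PermWords.
Variable n : nat.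

Lemma perm_wordE (s : 'S_n) : perm_word s = [seq s i | i <- fintype.enum 'I_n].
Proof. by rewrite /perm_word enumT. Qed.

Lemma nth_perm_word (s : 'S_n) (i : 'I_n) : nth i (perm_word s) i = s i.
Proof.
rewrite perm_wordE (nth_map i); first by rewrite nth_ord_enum.
by rewrite size_enum_ord.
Qed.

Lemma perm_word_inj : injective (@perm_word n).
Proof.
move=> s t e; apply/permP => i.
by rewrite -nth_perm_word e nth_perm_word.
Qed.

Lemma perm_word_perm (s : 'S_n) : perm_eq (perm_word s) (fintype.enum 'I_n).
Proof.
apply: uniq_perm; rewrite ?enum_uniq //.
  by rewrite perm_wordE map_inj_uniq ?enum_uniq //; apply: perm_inj.
move=> i; rewrite mem_enum perm_wordE; apply/mapP; exists (s^-1 i)%g; first by rewrite mem_enum.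
by rewrite permKV.
Qed.

Lemma size_perm_word (s : 'S_n) : size (perm_word s) = n.
Proof. by rewrite (perm_size (perm_word_perm s)) size_enum_ord. Qed.

Lemma perm_word_surj (v : seq 'I_n) : perm_eq v (fintype.enum 'I_n) ->
  exists s : 'S_n, v = perm_word s.
Proof.
move=> pv; have sv : size v = n by rewrite (perm_size pv) size_enum_ord.
have uv : uniq v by rewrite (perm_uniq pv) enum_uniq.
have finj : injective (fun i : 'I_n => nth i v i).
  move=> i j; rewrite (set_nth_default j) ?sv // => /eqP.
  by rewrite nth_uniq ?sv // => /eqP/val_inj.
exists (perm finj); rewrite perm_wordE.
case: n v pv sv uv finj => [|m] v pv sv uv finj.
  transitivity ([::] : seq 'I_0); first exact: size0nil.
  by apply/esym/size0nil; rewrite size_map size_enum_ord.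
apply: (@eq_from_nth _ ord0) => [|i]; first by rewrite size_map size_enum_ord.
rewrite sv => hi; rewrite (nth_map ord0) ?size_enum_ord // permE.
by rewrite nth_enum_ord //; apply: set_nth_default; rewrite sv.
Qed.

Lemma sum_perm_words (V : nmodType) (P : pred (seq 'I_n)) (r : seq (seq 'I_n))
    (g : seq 'I_n -> V) :
  uniq r -> (forall v, (v \in r) = perm_eq v (fintype.enum 'I_n) && P v) ->
  \sum_(s : 'S_n | P (perm_word s)) g (perm_word s) = \sum_(v <- r) g v.
Proof.
move=> ur hr.
have pe : perm_eq r (map (@perm_word n) (filter (fun s => P (perm_word s)) (fintype.enum 'S_n))).
  apply: uniq_perm => //.
    by rewrite (map_inj_uniq perm_word_inj) filter_uniq ?enum_uniq.
  move=> v; rewrite hr; apply/andP/mapP => [[/perm_word_surj[s ->] h]|[s]].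
    by exists s; rewrite // mem_filter h mem_enum.
  by rewrite mem_filter => /andP[h _] ->; rewrite perm_word_perm.
by rewrite (perm_big _ pe) big_map big_filter big_enum_cond.
Qed.

Lemma sorted_enum : sorted ltn (map val (fintype.enum 'I_n)).
Proof. by rewrite val_enum_ord iota_ltn_sorted. Qed.

Lemma mem_shuf_enum I v : sumn I = n ->
  (v \in shuf I (fintype.enum 'I_n)) = perm_eq v (fintype.enum 'I_n) && blockinc I (map val v).
Proof.
move=> sI; rewrite -(mem_map (inj_map val_inj)) -shuf_map mem_shuf ?sorted_enum //.
  congr (_ && _); apply/idP/idP; last exact: perm_map.
  exact: perm_map_inj val_inj _ _.
by rewrite size_map size_enum_ord.
Qed.

Lemma count_shuf_enum I (s : 'S_n) : sumn I = n ->
  count_mem (perm_word s) (shuf I (fintype.enum 'I_n)) = blockinc I (map val (perm_word s)).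
Proof.
move=> sI; rewrite count_uniq_mem ?shuf_uniq ?enum_uniq // mem_shuf_enum //.
by rewrite perm_word_perm.
Qed.

Lemma mem_adm_enum t w x v : rcons w x = fintype.enum 'I_n -> leaves t = n ->
  (v \in adm t w x) = perm_eq v (fintype.enum 'I_n) && admissible_labels t (map val v).
Proof.
move=> ew st; rewrite -(mem_map (inj_map val_inj)) -adm_map mem_adm -?map_rcons ?ew.
- congr (_ && _); apply/idP/idP; last exact: perm_map.
  exact: perm_map_inj val_inj _ _.
- exact: sorted_enum.
by rewrite size_map st -(size_rcons w x) ew size_enum_ord.
Qed.
End PermWords.

(** * The element D_lambda of the descent algebra *)

Section DescentElement.
Context {k : comNzRingType}.

Lemma sum_trees_of_type (V : nmodType) (g : ptree -> V) n l : (0 < n)%N ->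
  \sum_(T \in trees_of_type k n l) g T =
  \sum_(H <- forests n.-1 | tmon (Bplus H) == lmono n l) g (Bplus H).
Proof.
move=> n0; pose P H := tmon (Bplus H) == lmono n l.
pose s := map Bplus (filter P (forests n.-1)).
have hs T : T \in s <-> trees_of_type k n l T.
  rewrite trees_of_typeP; split=> [/mapP[H]|[]].
    rewrite mem_filter mem_forests => /andP[/eqP hP /eqP hH] ->; split=> //.
    by rewrite [LHS]/= -/(fsize H) hH prednK.
  case: T => H hT e; apply/mapP; exists H => //.
  by rewrite mem_filter /P e eqxx mem_forests /=; apply/eqP; rewrite -hT.
have us : uniq s.
  by rewrite map_inj_uniq ?filter_uniq ?forests_uniq // => ? ? [].
rewrite (fsbigE s) //.
- rewrite big_seq_cond (eq_bigl (fun T => T \in s)) => [|T]; last first.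
    by apply/andP/idP => [[]//|hT]; split=> //; apply/mem_set/hs.
  by rewrite -big_seq big_map big_filter.
- by move=> T /= /hs.
by move=> T /hs ->.
Qed.

(** D_lambda in the descent algebra: S^I is sent to the sum of the words that
    increase along the blocks of I. *)
Definition dperm n l : galg k n :=
  [ffun s => \sum_(I <- comps n) dcoef n l I *+ blockinc I (map val (perm_word s))].

Lemma sum_bracket_perm n t w x (r : 'S_n) : rcons w x = fintype.enum 'I_n -> leaves t = n ->
  \sum_(s : 'S_n | admissible t s) bracket_perm k t s r =
  (pbcoef t w x (perm_word r))%:~R.
Proof.
move=> ew st; rewrite /pbcoef rmorph_sum.
rewrite -(@sum_perm_words n _ (fun v => admissible_labels t (map val v)) _
  (fun v => (bcoef t v (perm_word r))%:~R)).
- by apply: eq_bigr => s _; rewrite ffunE bracketing_coef.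
- by apply: adm_uniq; rewrite ew enum_uniq.
by move=> v; apply: mem_adm_enum.
Qed.

Lemma dperm_pbw n l : (0 < n)%N -> dperm n l = pbw_sum k n l.
Proof.
move=> n0; apply/ffunP => r; rewrite !ffunE sum_trees_of_type //.
have : size (fintype.enum 'I_n) = n by rewrite size_enum_ord.
case E: (fintype.enum 'I_n) => [|y w] /= sn; first by rewrite -sn in n0.
transitivity (\sum_(I <- comps n) dcoef n l I *+
    count_mem (perm_word r) (shuf I (y :: w)) : k).
  rewrite big_seq [RHS]big_seq; apply: eq_bigr => I.
  by rewrite mem_comps => /andP[_ /eqP sI]; rewrite -E count_shuf_enum.
rewrite dcoef_shuf //.
have -> : n.-1 = size w := esym (congr1 predn sn).
rewrite big_seq_cond [RHS]big_seq_cond; apply: eq_bigr => H /andP[hH _].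
rewrite -(@sum_bracket_perm n (fbt H) (belast y w) (last y w)) //.
  by rewrite -lastI -E.
by move: hH; rewrite mem_forests leaves_fbt => /eqP ->.
Qed.

Lemma sum_refine n (c X : seq nat -> k) :
  \sum_(J <- comps n) (\sum_(I <- comps n | J \in coars I) c I) * X J =
  \sum_(I <- comps n) c I * \sum_(J <- coars I) X J.
Proof.
under eq_bigr do rewrite mulr_suml big_mkcond.
rewrite exchange_big big_seq [RHS]big_seq; apply: eq_bigr => I.
rewrite mem_comps => /andP[I0 /eqP sI].
rewrite mulr_sumr -big_mkcond -big_filter; apply: perm_big; apply: uniq_perm.
- by rewrite filter_uniq // comps_uniq.
- exact: coars_uniq.
move=> J; rewrite mem_filter mem_comps; case hJ: (J \in coars I) => //=.
by have [-> ->] := coars0 I0 hJ; rewrite sI eqxx.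
Qed.

(** In S^I, both the elements R_J of Sym and the descent classes are summed over
    the compositions J coarser than I. *)
Lemma dperm_image n l : descent_image (Dpart k n l) (dperm n l).
Proof.
exists (fun J => \sum_(I <- comps n | J \in coars I) dcoef n l I); split=> [F|s].
  rewrite sum_compositions sum_refine Dpart_expand.
  rewrite big_seq [RHS]big_seq; apply: eq_bigr => I.
  rewrite mem_comps => /andP[I0 _]; congr (_ * _).
  rewrite -[LHS](sum_ribbon (fun J => SI k J F)) big_seq [RHS]big_seq.
  apply: eq_bigr => J hJ; rewrite RI_ribbon //.
  by have [] := coars0 I0 hJ.
rewrite sum_compositions sum_refine ffunE.
rewrite big_seq [RHS]big_seq; apply: eq_bigr => I.
rewrite mem_comps => /andP[I0 /eqP sI]; rewrite -mulr_natr; congr (_ * _).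
rewrite -sum_coars_descents //; last by rewrite size_map size_perm_word.
by rewrite natr_sum; apply: eq_bigr => J _; rewrite ffunE.
Qed.

(** * The coefficient of the identity *)

(** The tree without branching. *)
Fixpoint ladder (n : nat) : forest := if n is m.+1 then [:: Bplus (ladder m)] else [::].

Lemma fsize_ladder n : fsize (ladder n) = n.
Proof. by elim: n => // n IH; rewrite /= fsize_cons IH addn0. Qed.

Lemma sum_fcuts_ladder (V : nmodType) (h : forest -> forest -> V) n :
  \sum_(p <- fcuts (ladder n)) h p.1 p.2 = \sum_(i < n.+1) h (ladder i) (ladder (n - i)).
Proof.
elim: n h => [|n IH] h; first by rewrite big_ord1 fcuts0 big_seq1.
rewrite [ladder _]/= sum_fcuts1 (IH (fun a b => h a [:: Bplus b])).
rewrite [RHS]big_ord_recr /= subnn addrC; congr (_ + _).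
by apply: eq_bigr => i _; rewrite subSn // -ltnS.
Qed.

Lemma Snat_ladder I n : sumn I = n -> Snat I (ladder n) = 1%N.
Proof.
elim: I n => [|i I IH] n /=; first by move=> <-.
move=> sI; have hi : (i < n.+1)%N by rewrite ltnS -sI leq_addr.
rewrite (sum_fcuts_ladder (fun a b => (fsize a == i) * Snat I b : nat)%N).
rewrite (bigD1 (Ordinal hi)) //= fsize_ladder eqxx mul1n IH; last by rewrite -sI addKn.
rewrite big1 ?addn0 // => j ij; rewrite fsize_ladder.
by move: ij; rewrite -val_eqE /= => /negPf ->.
Qed.

(** For F = L B_+(R), the ladder with one vertex less lies below L R by induction,
    and F is obtained from L R by grafting R on a new root. *)
Lemma ladder_min F : F \in up (ladder (fsize F)).
Proof.
have [m] := ubnP (fsize F); elim: m F => // m IH F.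
case/lastP: F => [//|L [R]]; rewrite -cats1 fsize_cat fsize_cons addn0 addnS ltnS => h.
have hLR := IH (L ++ R); rewrite fsize_cat in hLR.
by rewrite [ladder _]/= up1; apply/mem_utree; exists L, R; split; rewrite ?cats1 ?hLR.
Qed.

(** The identity increases along all blocks, and each S^I has value 1 on the
    ladder, so the coefficient of the identity is the value of D_lambda at the
    ladder.  The ladder lies below all trees, which are thus counted once each. *)
Lemma dperm1 n l : (0 < n)%N -> dperm n l 1%g =
  (count (fun H => tmon (Bplus H) == lmono n l) (forests n.-1))%:R.
Proof.
move=> n0; transitivity (Dpart k n l (ladder n)).
  rewrite Dpart_expand ffunE big_seq [RHS]big_seq; apply: eq_bigr => I.
  rewrite mem_comps => /andP[_ /eqP sI]; rewrite SI_nat Snat_ladder // mulr1.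
  have -> : map val (perm_word (1%g : 'S_n)) = iota 0 n.
    by rewrite -val_enum_ord perm_wordE -map_comp; apply: eq_map => i; rewrite /= perm1.
  suff -> : blockinc I (iota 0 n) by [].
  elim: I n 0%N sI {n0} => [|i I IH] n a /=; first by move=> <-.
  move=> <-; rewrite iotaD take_size_cat ?size_iota // drop_size_cat ?size_iota //.
  by rewrite iota_sorted IH.
rewrite /Dpart sum_trees_of_type // -sum1_count natr_sum.
rewrite big_seq_cond [RHS]big_seq_cond; apply: eq_bigr => H /andP[hH _].
rewrite CX_up; have := ladder_min [:: Bplus H]; rewrite fsize_cons addn0.
by move: hH; rewrite mem_forests => /eqP ->; rewrite prednK // => ->.
Qed.

Lemma pmon_perm s s' : perm_eq s s' -> pmon s = pmon s'.
Proof.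
by move=> h; apply: (@mkmalg1_inj k); rewrite -!prod_avar (perm_big _ h).
Qed.

Lemma ccounts_cons H F : flatten (map child_counts (Bplus H :: F)) =
  size H :: flatten (map child_counts H) ++ flatten (map child_counts F).
Proof. by []. Qed.

Lemma size_le_sumn (l : seq nat) : 0%N \notin l -> (size l <= sumn l)%N.
Proof.
elim: l => [//|c l IH]; rewrite inE negb_or => /andP[c0 /IH h].
by rewrite /=; move/eqP: c0; lia.
Qed.

(** A caterpillar whose vertices on the spine have the parts of lambda as
    numbers of children. *)
Lemma tree_of_type_exists n l : (0 < n)%N -> is_partition n.-1 l ->
  exists2 H, fsize H = n.-1 & tmon (Bplus H) = lmono n l.
Proof.
move=> n0 /and3P[_ l0 /eqP sl].
suff [H hH pH] : exists2 H, fsize H = sumn l &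
    perm_eq (child_counts (Bplus H)) (nseq ((sumn l).+1 - size l) 0%N ++ l).
  exists H; first by rewrite hH.
  by rewrite /tmon /lmono (pmon_perm pH) sl prednK.
elim: l l0 {sl} => [_|c l IH]; first by exists [::].
rewrite inE negb_or => /andP[c0 l0]; have {IH} [H hH pH] := IH l0.
have {c0} c0 : (0 < c)%N by rewrite lt0n eq_sym.
have hl := size_le_sumn l0.
have hz m : fsize (nseq m (Bplus [::])) = m by elim: m => // m IHm; rewrite [nseq _ _]/= fsize_cons IHm.
have hc m : flatten (map child_counts (nseq m (Bplus [::]))) = nseq m 0%N.
  by elim: m => // m IHm; rewrite [nseq _ _]/= ccounts_cons IHm.
exists (Bplus H :: nseq c.-1 (Bplus [::])).
  by rewrite fsize_cons hz hH /=; lia.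
have -> : child_counts (Bplus (Bplus H :: nseq c.-1 (Bplus [::]))) =
    c :: child_counts (Bplus H) ++ nseq c.-1 0%N.
  by rewrite -[LHS]/(_ :: flatten _) ccounts_cons hc /= size_nseq prednK.
have -> : ((sumn (c :: l)).+1 - size (c :: l) = ((sumn l).+1 - size l) + c.-1)%N.
  by rewrite /=; lia.
rewrite nseqD; apply/seq.permP => q; move/seq.permP: pH => /(_ q).
by rewrite -[c :: (_ ++ _)]cat1s -[c :: l]cat1s !count_cat => ->; lia.
Qed.

Lemma dperm1_count_gt0 n l : (0 < n)%N -> is_partition n.-1 l ->
  (0 < count (fun H => tmon (Bplus H) == lmono n l) (forests n.-1))%N.
Proof.
move=> n0 hl; have [H hH e] := tree_of_type_exists n0 hl.
rewrite -has_count; apply/hasP; exists H; last by rewrite e eqxx.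
by rewrite mem_forests hH.
Qed.
End DescentElement.

(** * Linear maps on noncommutative polynomials *)

Section PolyLinear.
Context {k : comNzRingType} {A : choiceType} {M : lmodType k}.
Implicit Types (g : seq A -> M) (p q : ncpoly k A).

(** Linear extension of a map defined on words. *)
Definition plin g p : M := \sum_(w <- msupp p) p@_w *: g w.

Lemma plin_sup g (d : {fset {fmonom A}}) p : (msupp p `<=` d)%fset ->
  plin g p = \sum_(w <- d) p@_w *: g w.
Proof.
move=> h; apply: big_fset_incl => // w _ hw.
by rewrite mcoeff_outdom // scale0r.
Qed.

Lemma plin0 g : plin g 0 = 0.
Proof. by rewrite /plin msupp0 big_seq_fset0. Qed.

Lemma plinD g p q : plin g (p + q) = plin g p + plin g q.
Proof.
rewrite (plin_sup g (msuppD_le p q)) (plin_sup g (fsubsetUl (msupp p) (msupp q))).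
rewrite (plin_sup g (fsubsetUr (msupp p) (msupp q))) -big_split /=.
by apply: eq_bigr => w _; rewrite mcoeffD scalerDl.
Qed.

Lemma plinZ g c p : plin g (c *: p) = c *: plin g p.
Proof.
rewrite (plin_sup g (msuppZ_le c p)) scaler_sumr.
by apply: eq_bigr => w _; rewrite mcoeffZ scalerA.
Qed.

Lemma plinN g p : plin g (- p) = - plin g p.
Proof. by rewrite -(scaleN1r p) plinZ scaleN1r. Qed.

Lemma plin_sum g (J : Type) (r : seq J) (P : pred J) (F : J -> ncpoly k A) :
  plin g (\sum_(j <- r | P j) F j) = \sum_(j <- r | P j) plin g (F j).
Proof. by elim/big_rec2: _ => [|j u v _ <-]; rewrite ?plin0 ?plinD. Qed.

Lemma plin_word g (w : seq A) : plin g (ncword k w) = g w.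
Proof.
by rewrite /plin /ncword msuppU1 big_seq_fset1 mcoeffUU scale1r.
Qed.

Lemma eq_plin g g' p : (forall w : {fmonom A}, w \in msupp p -> g w = g' w) ->
  plin g p = plin g' p.
Proof. by move=> h; apply: eq_big_seq => w /h ->. Qed.

Lemma plin_gD g g' p : plin (fun w => g w + g' w) p = plin g p + plin g' p.
Proof. by rewrite -big_split; apply: eq_bigr => w _; rewrite scalerDr. Qed.

Lemma plin_gsum (J : Type) (r : seq J) (P : pred J) (G : J -> seq A -> M) p :
  plin (fun w => \sum_(j <- r | P j) G j w) p = \sum_(j <- r | P j) plin (G j) p.
Proof. by rewrite exchange_big; apply: eq_bigr => w _; rewrite scaler_sumr. Qed.

Lemma plin_gZ c g p : plin (fun w => c *: g w) p = c *: plin g p.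
Proof.
by rewrite scaler_sumr; apply: eq_bigr => w _; rewrite !scalerA mulrC.
Qed.

Lemma plin_swap (G : seq A -> seq A -> M) p q :
  plin (fun w => plin (G w) q) p = plin (fun w' => plin (G^~ w') p) q.
Proof.
transitivity (\sum_(w <- msupp p) \sum_(w' <- msupp q) (p@_w * q@_w') *: G w w').
  by apply: eq_bigr => w _; rewrite scaler_sumr; apply: eq_bigr => w' _; rewrite scalerA.
rewrite exchange_big; apply: eq_bigr => w' _; rewrite scaler_sumr.
by apply: eq_bigr => w _; rewrite scalerA mulrC.
Qed.
End PolyLinear.

Lemma plin_id (k : comNzRingType) (A : choiceType) (p : ncpoly k A) :
  plin (ncword k (A := A)) p = p.
Proof.
rewrite [RHS]monalgE; apply: eq_bigr => w _; apply/malgP => v.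
by rewrite mcoeffZ /ncword fmK !mcoeffU mulr_natr.
Qed.

Lemma plinM (k : comNzRingType) (A : choiceType) (M : lmodType k)
    (g : seq A -> M) (p q : ncpoly k A) :
  plin g (p * q) = plin (fun w => plin (fun w' => g (w ++ w')) q) p.
Proof.
rewrite -{1}(plin_id p) -{1}(plin_id q) mulr_suml plin_sum; apply: eq_bigr => w _.
rewrite mulr_sumr plin_sum scaler_sumr; apply: eq_bigr => w' _.
by rewrite -scalerAl ncpoly_scaleAr -ncword_cat !plinZ plin_word.
Qed.

(** * Lie polynomials are primitive *)

Lemma sum_unsh_cat (A : eqType) (V : nmodType) (F : seq A -> seq A -> V) u v :
  \sum_(p <- unsh (u ++ v)) F p.1 p.2 =
  \sum_(a <- unsh u) \sum_(b <- unsh v) F (a.1 ++ b.1) (a.2 ++ b.2).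
Proof.
elim: u F => [|x u IH] F; first by rewrite big_seq1.
rewrite cat_cons sum_unsh_cons (IH (fun a b => F (x :: a) b)) (IH (fun a b => F a (x :: b))).
by rewrite (sum_unsh_cons (fun a c => \sum_(b <- unsh v) F (a ++ b.1) (c ++ b.2))).
Qed.

Section Primitive.
Context {k : comNzRingType} {A : choiceType} {M : lmodType k}.

(** F stands for a bilinear map, so that this is F evaluated on the coproduct for
    which letters are primitive. *)
Definition coprod (F : seq A -> seq A -> M) (w : seq A) : M :=
  \sum_(p <- unsh w) F p.1 p.2.

(** For primitive p and q, the coproduct of pq has the additional terms
    p (x) q + q (x) p, which are symmetric and cancel in the bracket. *)
Lemma coprod_prod (F : seq A -> seq A -> M) (p q : ncpoly k A) :
  (forall F', plin (coprod F') p = plin (F'^~ [::]) p + plin (F' [::]) p) ->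
  (forall F', plin (coprod F') q = plin (F'^~ [::]) q + plin (F' [::]) q) ->
  plin (coprod F) (p * q) =
    plin (F^~ [::]) (p * q) + plin (F [::]) (p * q)
    + (plin (fun w => plin (F w) q) p + plin (fun w => plin (F^~ w) q) p).
Proof.
move=> hp hq; rewrite !plinM.
pose X w w' := \sum_(a <- unsh w) F (a.1 ++ w') a.2.
pose Y w w' := \sum_(a <- unsh w) F a.1 (a.2 ++ w').
have hX : plin (fun w => plin (X w) q) p =
    plin (fun w => plin (fun w' => F (w ++ w') [::]) q) p + plin (fun w => plin (F^~ w) q) p.
  rewrite plin_swap (plin_swap (fun w w' => F (w ++ w') [::])).
  rewrite (plin_swap (fun w w' => F w' w)) -plin_gD; apply: eq_plin => w' _.
  exact: (hp (fun x y => F (x ++ w') y)).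
have hY : plin (fun w => plin (Y w) q) p =
    plin (fun w => plin (F w) q) p + plin (fun w => plin (fun w' => F [::] (w ++ w')) q) p.
  rewrite plin_swap (plin_swap (fun w w' => F [::] (w ++ w'))).
  rewrite (plin_swap (fun w w' => F w w')) -plin_gD; apply: eq_plin => w' _.
  exact: (hp (fun x y => F x (y ++ w'))).
transitivity (plin (fun w => plin (X w) q + plin (Y w) q) p); last first.
  rewrite plin_gD hX hY [plin (fun w => plin (F w) q) p + _]addrC addrACA.
  by rewrite [plin (fun w => plin (F^~ w) q) p + _]addrC.
apply: eq_plin => w _.
transitivity (plin (coprod (fun x y => \sum_(a <- unsh w) F (a.1 ++ x) (a.2 ++ y))) q).
  by apply: eq_plin => w' _; rewrite /coprod sum_unsh_cat exchange_big.
rewrite hq; congr (_ + _); apply: eq_plin => w' _; apply: eq_bigr => a _;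
  by rewrite cats0.
Qed.

Lemma lie_primitive (p : ncpoly k A) : free_lie p -> forall F : seq A -> seq A -> M,
  plin (coprod F) p = plin (F^~ [::]) p + plin (F [::]) p.
Proof.
elim=> [a|| c p' q _ IHp _ IHq|p' q _ IHp _ IHq] F.
- by rewrite !plin_word /coprod big_cons big_seq1.
- by rewrite !plin0 addr0.
- by rewrite !plinD !plinZ IHp IHq scalerDr addrACA.
have sub (a b c d e f : M) : (a + b + (c + d)) - (e + f + (d + c)) = a - e + (b - f).
  by rewrite [d + c]addrC opprD addrACA subrr addr0 opprD addrACA.
have h1 := coprod_prod F IHp IHq.
have h2 : plin (coprod F) (q * p') = plin (F^~ [::]) (q * p') + plin (F [::]) (q * p')
    + (plin (fun w => plin (F^~ w) q) p' + plin (fun w => plin (F w) q) p').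
  rewrite (coprod_prod F IHq IHp); congr (_ + _); congr (_ + _); exact: plin_swap.
have e (f : seq A -> M) : plin f (lie_bracket p' q) = plin f (p' * q) - plin f (q * p').
  by rewrite plinD plinN.
rewrite (e (coprod F)) (e (F^~ [::])) (e (F [::])) h1 h2; exact: sub.
Qed.
End Primitive.

(** * Action of the descent algebra on Lie polynomials *)

Section Action.
Context {k : comNzRingType} {A : choiceType}.
Implicit Types (p : ncpoly k A).

Definition Sword (I : seq nat) (w : seq A) : ncpoly k A :=
  \sum_(v <- shuf I w) ncword k v.

Lemma Sword_cons i I : Sword (i :: I) =
  coprod (fun u v => if size u == i then ncword k u * Sword I v else 0).
Proof.
apply/funext => w; rewrite /Sword /coprod /= big_flatten /= big_map big_filter big_mkcond.
apply: eq_bigr => p _; case: eqP => // _; rewrite mulr_sumr big_map.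
by apply: eq_bigr => v _; rewrite ncword_cat.
Qed.

Lemma Sword_nil I : 0%N \notin I -> Sword I [::] = (I == [::])%:R.
Proof.
case: I => [|i I]; first by rewrite /Sword /= big_seq1 ncword0.
rewrite inE negb_or => /andP[i0 _]; rewrite Sword_cons /coprod big_seq1 /=.
by rewrite (negPf i0).
Qed.

(** The action of S_i S^I is a product applied to the coproduct.  A primitive
    element has only the terms with an empty word on one side; as the parts of a
    composition are positive, these vanish when there are several parts. *)
Lemma Sword_lie n I p : (0 < n)%N -> I \in comps n -> free_lie p -> homogeneous n p ->
  plin (Sword I) p = if I == [:: n] then p else 0.
Proof.
move=> n0; rewrite mem_comps => /andP[I0 /eqP sI] lp hp.
case: I I0 sI => [|i I] I0 sI; first by rewrite -sI in n0.
move: I0; rewrite inE negb_or eq_sym => /andP[i0 I0].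
rewrite Sword_cons lie_primitive //= [X in _ + X](_ : _ = 0) ?addr0; last first.
  rewrite (eq_plin (g' := fun=> 0)) => [|w _]; last by rewrite eq_sym (negPf i0).
  by apply: big1 => w _; rewrite scaler0.
rewrite Sword_nil //; case: I sI {I0} => [|j I] sI.
  have <- : i = n by rewrite -sI /= addn0.
  rewrite (eqxx [:: i]) -[RHS]plin_id; apply: eq_plin => w hw.
  by rewrite (hp _ hw) -sI /= addn0 eqxx mulr1.
rewrite ifF; last by apply/eqP => -[].
by apply: big1 => w _; case: ifP; rewrite ?mulr0 scaler0.
Qed.

Lemma word_actE n (w : seq A) (s : 'S_n) (a0 : A) : size w = n ->
  word_act w s = [seq nth a0 w (i : 'I_n) | i <- perm_word s].
Proof.
move=> sw; rewrite /word_act; elim: (perm_word s) => //= i v ->.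
by rewrite onthE (nth_map a0) ?sw.
Qed.

Lemma ncact_plin n p (x : galg k n) :
  ncact p x = plin (fun w => \sum_(s : 'S_n) x s *: ncword k (word_act w s)) p.
Proof.
apply: eq_bigr => w _; rewrite scaler_sumr; apply: eq_bigr => s _.
by rewrite scalerA.
Qed.

Lemma word_nth_enum n (w : seq A) (a0 : A) : size w = n ->
  w = [seq nth a0 w (i : 'I_n) | i <- fintype.enum 'I_n].
Proof.
move=> sw; rewrite -[LHS](mkseq_nth a0) /mkseq sw -val_enum_ord -map_comp.
exact: eq_map.
Qed.

Lemma dperm_word n l (w : seq A) : (0 < n)%N -> size w = n ->
  \sum_(s : 'S_n) dperm n l s *: ncword k (word_act w s) =
  \sum_(I <- comps n) dcoef n l I *: Sword I w.
Proof.
move=> n0 sw; case: w sw => [sw|a0 w0]; first by rewrite -sw in n0.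
set w := a0 :: w0 => sw.
under eq_bigr do rewrite ffunE scaler_suml.
rewrite exchange_big big_seq [RHS]big_seq; apply: eq_bigr => I.
rewrite mem_comps => /andP[_ /eqP sI].
rewrite /Sword {2}(word_nth_enum a0 sw) shuf_map big_map scaler_sumr.
rewrite -(@sum_perm_words n _ (fun v => blockinc I (map val v)) _
  (fun v => dcoef n l I *: ncword k [seq nth a0 w (i : 'I_n) | i <- v])).
- rewrite [RHS]big_mkcond; apply: eq_bigr => s _; rewrite (word_actE s a0 sw).
  by case: ifP => _; rewrite ?scale0r.
- by apply: shuf_uniq; apply: enum_uniq.
by move=> v; apply: mem_shuf_enum.
Qed.

Lemma ncact_dperm_lie n l p : (0 < n)%N -> free_lie p -> homogeneous n p ->
  ncact p (dperm n l) = dcoef n l [:: n] *: p.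
Proof.
move=> n0 lp hp; rewrite ncact_plin.
rewrite (eq_plin (g' := fun w => \sum_(I <- comps n) dcoef n l I *: Sword I w)); last first.
  by move=> w /hp sw; rewrite dperm_word.
rewrite plin_gsum (bigD1_seq [:: n]) ?comps_uniq //=; last first.
  by rewrite mem_comps inE eq_sym -lt0n n0 /= addn0.
rewrite plin_gZ (Sword_lie n0 _ lp hp) ?eqxx; last first.
  by rewrite mem_comps inE eq_sym -lt0n n0 /= addn0.
rewrite big_seq_cond big1 ?addr0 // => I /andP[hI In].
by rewrite plin_gZ (Sword_lie n0 hI lp hp) (negPf In) scaler0.
Qed.

Lemma free_lieZ c p : free_lie p -> free_lie (c *: p).
Proof. by move=> h; rewrite -[_ *: _]addr0; apply: FreeLieLin h (FreeLie0 _ _). Qed.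

Lemma free_lie_sum (J : Type) (r : seq J) (P : pred J) (F : J -> ncpoly k A) :
  (forall j, P j -> free_lie (F j)) -> free_lie (\sum_(j <- r | P j) F j).
Proof.
move=> h; apply: (big_ind (@free_lie k A)) => [|x y hx hy|//]; first exact: FreeLie0.
by rewrite -[x]scale1r; apply: FreeLieLin.
Qed.

Lemma free_lie_sum_seq (J : eqType) (r : seq J) (F : J -> ncpoly k A) :
  (forall j, j \in r -> free_lie (F j)) -> free_lie (\sum_(j <- r) F j).
Proof. by move=> h; rewrite big_seq; apply: free_lie_sum. Qed.

Lemma free_lie_bracketing t (w : seq A) : size w = leaves t -> free_lie (bracketing k t w).
Proof.
elim: t w => [|l IHl r IHr] w /= sw.
  by case: w sw => [|a [|]] // _; apply: FreeLieLetter.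
apply: FreeLieBracket; [apply: IHl|apply: IHr].
  by rewrite size_takel // sw leq_addr.
by rewrite size_drop sw addKn.
Qed.

Lemma blist_perm (T : eqType) t (w : seq T) q : q \in blist t w -> perm_eq q.2 w.
Proof.
elim: t w q => [|l IHl r IHr] w q; first by rewrite inE => /eqP ->.
rewrite mem_cat => /orP[] /allpairsP[[a b]] /= [/IHl h1 /IHr h2 ->] /=.
  by rewrite (perm_trans (perm_cat h1 h2)) // cat_take_drop.
by rewrite perm_catC (perm_trans (perm_cat h1 h2)) // cat_take_drop.
Qed.

Lemma bracket_permE n t (s r : 'S_n) :
  bracket_perm k t s r = (bcoef t (perm_word s) (perm_word r))%:~R.
Proof. by rewrite ffunE bracketing_coef. Qed.

Lemma bracket_perm_word n t (s : 'S_n) (w : seq A) (a0 : A) : size w = n ->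
  \sum_(r : 'S_n) bracket_perm k t s r *: ncword k (word_act w r) =
  bracketing k t [seq nth a0 w (i : 'I_n) | i <- perm_word s].
Proof.
move=> sw; rewrite bracketingE blist_map big_map.
transitivity (\sum_(r : 'S_n) \sum_(q <- blist t (perm_word s))
    ((-1) ^+ q.1 * (q.2 == perm_word r)%:R : int)%:~R *: ncword k (word_act w r)).
  by apply: eq_bigr => r _; rewrite bracket_permE /bcoef rmorph_sum scaler_suml.
rewrite exchange_big big_seq [RHS]big_seq; apply: eq_bigr => q /blist_perm hq.
have [r0 er0] : exists r0 : 'S_n, q.2 = perm_word r0.
  by apply: perm_word_surj; apply: perm_trans hq (perm_word_perm s).
rewrite (bigD1 r0) //= [X in _ + X]big1 ?addr0 => [|r rr0].
  by rewrite er0 eqxx mulr1 rmorph_sign (word_actE r0 a0 sw).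
rewrite er0 (inj_eq (@perm_word_inj n)) eq_sym (negPf rr0).
by rewrite mulr0 rmorph0 scale0r.
Qed.

Lemma dperm_word_lie n l (w : seq A) : (0 < n)%N -> size w = n ->
  free_lie (\sum_(s : 'S_n) dperm n l s *: ncword k (word_act w s)).
Proof.
move=> n0 sw; case: w sw => [sw|a0 w0]; first by rewrite -sw in n0.
set w := a0 :: w0 => sw.
rewrite (eq_bigr (fun s => \sum_(H <- forests n.-1 | tmon (Bplus H) == lmono n l)
   \sum_(s' : 'S_n | admissible (fbt H) s')
      bracket_perm k (fbt H) s' s *: ncword k (word_act w s))); last first.
  move=> s _; rewrite dperm_pbw // ffunE sum_trees_of_type // scaler_suml.
  by apply: eq_bigr => H _; rewrite scaler_suml.
rewrite exchange_big big_seq_cond; apply: free_lie_sum => H /andP[hH _].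
rewrite exchange_big; apply: free_lie_sum => s' _.
rewrite (bracket_perm_word _ _ a0 sw); apply: free_lie_bracketing.
move: hH; rewrite size_map size_perm_word mem_forests leaves_fbt => /eqP ->.
by rewrite prednK.
Qed.

Lemma size_word_act n (w : seq A) (s : 'S_n) : size w = n -> size (word_act w s) = n.
Proof.
case: w => [|a0 w] sw; last by rewrite (word_actE s a0 sw) size_map size_perm_word.
apply/eqP; rewrite eqn_leq size_pmap (leq_trans (count_size _ _)).
  by apply: leq_trans (leq0n _); rewrite -[X in (X <= 0)%N]sw.
by rewrite size_map size_perm_word.
Qed.

Lemma ncact_homogeneous n p (x : galg k n) : homogeneous n p ->
  homogeneous n (ncact p x).
Proof.
move=> hp w; apply: contraTeq => hw.
rewrite -mcoeff_eq0 ncact_plin /plin mcoeff_sum big_seq big1 // => u hu.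
have su := hp _ hu; rewrite mcoeffZ mcoeff_sum big1 ?mulr0 // => s _.
rewrite mcoeffZ /ncword mcoeffU; case: eqP => [e|_]; last by rewrite mulr0.
by case/eqP: hw; rewrite -e; apply: size_word_act.
Qed.

Lemma ncact_dperm_free_lie n l p : (0 < n)%N -> homogeneous n p ->
  free_lie (ncact p (dperm n l)).
Proof.
move=> n0 hp; rewrite ncact_plin; apply: free_lie_sum_seq => w /hp sw.
by apply/free_lieZ/dperm_word_lie.
Qed.
End Action.

(** * Quasi-idempotence *)

Section GroupAlgebra.
Context {k : comNzRingType} {n : nat}.
Implicit Types (x y : galg k n) (s t : 'S_n).

Lemma gmulE x y s : gmul x y s = \sum_t x (t^-1 * s)%g * y t.
Proof.
rewrite ffunE (reindex_onto (fun t => ((t^-1 * s)%g, t)) snd) /=; last first.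
  by move=> [u t] /= /eqP <-; rewrite mulKg.
by apply: eq_bigl => t; rewrite mulKVg !eqxx.
Qed.

Lemma word_act_perm s t : (0 < n)%N -> word_act (perm_word s) t = perm_word (t * s)%g.
Proof.
move=> n0; rewrite (word_actE t (Ordinal n0) (size_perm_word s)) !perm_wordE -map_comp.
apply: eq_map => i /=; rewrite permM -perm_wordE.
by rewrite (set_nth_default (t i)) ?size_perm_word // nth_perm_word.
Qed.

Lemma word_act_id s : (0 < n)%N -> word_act (perm_word (1%g : 'S_n)) s = perm_word s.
Proof. by move=> n0; rewrite word_act_perm // mulg1. Qed.

Notation idword := (ncword k (perm_word (1%g : 'S_n))).

Lemma ncact_idword x : (0 < n)%N ->
  ncact idword x = \sum_s x s *: ncword k (perm_word s).
Proof.
move=> n0; rewrite ncact_plin plin_word; apply: eq_bigr => s _.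
by rewrite word_act_id.
Qed.

Lemma ncact_idword_coef x s : (0 < n)%N ->
  (ncact idword x)@_(FMonom (perm_word s)) = x s.
Proof.
move=> n0; rewrite (ncact_idword x n0) mcoeff_sum.
rewrite (eq_bigr (fun t => x t * (t == s)%:R)) => [|t _]; last first.
  by rewrite mcoeffZ ncword_coef (inj_eq (@perm_word_inj n)).
rewrite (bigD1 s) //= eqxx mulr1 big1 ?addr0 // => t /negPf ->.
exact: mulr0.
Qed.

Lemma ncact_gmul x y : (0 < n)%N -> ncact (ncact idword x) y = ncact idword (gmul x y).
Proof.
move=> n0; rewrite ncact_plin (ncact_idword x n0) (ncact_idword _ n0) plin_sum.
transitivity (\sum_t \sum_s (x s * y t) *: ncword k (perm_word (t * s)%g)).
  rewrite exchange_big; apply: eq_bigr => s _; rewrite plinZ plin_word scaler_sumr.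
  by apply: eq_bigr => t _; rewrite (word_act_perm s t n0) scalerA.
transitivity (\sum_t \sum_s (x (t^-1 * s)%g * y t) *: ncword k (perm_word s)).
  apply: eq_bigr => t _; rewrite [RHS](reindex_inj (mulgI t)).
  by apply: eq_bigr => s _; rewrite mulKg.
by rewrite exchange_big; apply: eq_bigr => s _; rewrite gmulE scaler_suml.
Qed.

Lemma ncactZ (A : choiceType) (p : ncpoly k A) b x :
  ncact p [ffun s => b * x s] = b *: ncact p x.
Proof.
rewrite !ncact_plin -plin_gZ; apply: eq_plin => w _; rewrite scaler_sumr.
by apply: eq_bigr => s _; rewrite ffunE scalerA.
Qed.

Lemma homogeneous_word (A : choiceType) (w : seq A) : homogeneous (size w) (ncword k w).
Proof. by move=> u; rewrite msuppU1 inE => /eqP ->. Qed.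

(** The product is read off from the successive actions on the word 12...n, which
    the first factor sends to a Lie polynomial, where the second one is scalar. *)
Lemma gmul_dperm l s : (0 < n)%N ->
  gmul (dperm n l) (dperm n l) s = dcoef n l [:: n] * dperm (k := k) n l s.
Proof.
move=> n0; have hw := @homogeneous_word 'I_n (perm_word (1%g : 'S_n)).
rewrite size_perm_word in hw.
rewrite -(ncact_idword_coef _ _ n0) -ncact_gmul // ncact_dperm_lie //.
- by rewrite mcoeffZ ncact_idword_coef.
- exact: ncact_dperm_free_lie.
exact: ncact_homogeneous.
Qed.
End GroupAlgebra.

(** With M = C R a factorisation through the rank, M M = 0 forces R C = 0, and
    the traces of C R and R C agree. *)
Lemma mx_sqr0_trace (F : fieldType) m (M : 'M[F]_m) : M *m M = 0 -> \tr M = 0.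
Proof.
move=> h; have [C hC] := row_fullP (col_base_full M).
have [D hD] := row_freeP (row_base_free M).
suff e : row_base M *m col_base M = 0 by rewrite -(mulmx_base M) mxtrace_mulC e mxtrace0.
have eM : M *m M = col_base M *m (row_base M *m col_base M) *m row_base M.
  by rewrite mulmxA -mulmxA !mulmx_base.
have : C *m (col_base M *m (row_base M *m col_base M) *m row_base M) *m D = 0.
  by rewrite -eM h mulmx0 mul0mx.
set X := row_base M *m col_base M.
have -> : C *m (col_base M *m X *m row_base M) *m D
    = (C *m col_base M) *m X *m (row_base M *m D) by rewrite !mulmxA.
by rewrite hC mul1mx hD mulmx1.
Qed.

(** The matrix of x in the regular representation has square zero, and its trace
    is n! times the coefficient of the identity. *)
Lemma gmul_sqr0 (F : numFieldType) n (x : galg F n) :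
  (forall s, gmul x x s = 0) -> x 1%g = 0.
Proof.
move=> h; pose N := #|{: 'S_n}|.
pose M : 'M[F]_N := \matrix_(i, j) x ((enum_val i)^-1 * enum_val j)%g.
have hM : \tr M = 0.
  apply: mx_sqr0_trace; apply/matrixP => i j; rewrite !mxE.
  rewrite -[RHS](h ((enum_val i)^-1 * enum_val j)%g) gmulE.
  rewrite (reindex_inj (mulgI (enum_val i)^-1)%g) /=.
  rewrite [RHS](reindex (fun a : 'I_N => enum_val a)) /=; last first.
    by apply: onW_bij; apply: enum_val_bij.
  by apply: eq_bigr => a _; rewrite !mxE invMg invgK -mulgA mulKVg mulrC.
have : \tr M = x 1%g *+ N.
  rewrite /mxtrace (eq_bigr (fun=> x 1%g)) => [|i _]; last by rewrite mxE mulVg.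
  by rewrite sumr_const card_ord.
rewrite hM => /esym/eqP; rewrite mulrn_eq0 => /orP[|/eqP //].
by rewrite /N card_Sn eqn0Ngt fact_gt0.
Qed.

Section QuasiIdempotent.
Context {k : numFieldType}.

Lemma dcoef_neq0 n l : (0 < n)%N -> is_partition n.-1 l ->
  dcoef n l [:: n] != 0 :> k.
Proof.
move=> n0 hl; apply/eqP => c0.
have : dperm (k := k) n l 1%g = 0.
  by apply: gmul_sqr0 => s; rewrite gmul_dperm // c0 mul0r.
rewrite dperm1 // => /eqP; rewrite pnatr_eq0.
by rewrite eqn0Ngt (@dperm1_count_gt0 k n l n0 hl).
Qed.

Lemma dperm_quasi n l : (0 < n)%N -> is_partition n.-1 l ->
  lie_quasi_idempotent (dperm (k := k) n l).
Proof.
move=> n0 hl; have c0 := dcoef_neq0 n0 hl; set c := dcoef n l [:: n] in c0.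
exists c^-1; first by rewrite invr_eq0.
split.
  apply/ffunP => s; rewrite gmulE ffunE.
  rewrite (eq_bigr (fun t => c^-1 * c^-1 *
     (dperm (k := k) n l (t^-1 * s)%g * dperm (k := k) n l t))) => [|t _].
    by rewrite -mulr_sumr -gmulE gmul_dperm // -/c mulrA mulfVK.
  by rewrite !ffunE mulrACA.
move=> A p; split=> [[hp lp]|[q hq ->]].
  by exists p => //; rewrite ncactZ ncact_dperm_lie // scalerA mulVf // scale1r.
split; first exact: ncact_homogeneous.
by rewrite ncactZ; apply/free_lieZ/ncact_dperm_free_lie.
Qed.
End QuasiIdempotent.

(** Distinct trees have distinct binary trees, so no element of the PBW basis is
    repeated in the sum for D_lambda. *)
Lemma fbt_inj : injective fbt.
Proof.
elim/forest_ind => [|H F IH IF] [|[H'] F'] //.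
by rewrite !fbt_cons => -[/IH -> /IF ->].
Qed.

Theorem mainTheorem1 (R : realType) :
  (forall phim phip : forest -> laurent (apoly R[i]),
     is_birkhoff (aphi R[i]) phim phip ->
     let CC := fun F => eval1 (phip F) in
     let DD := fun F => residue (phip F) in
     [/\ forall F, CC F = \sum_(G \in [set: forest]%classic)
                            aforest R[i] G * CX (apoly R[i]) G F,
         forall F, DD F = \sum_(T \in [set: ptree]%classic)
                            aforest R[i] [:: T] * CX (apoly R[i]) [:: T] F,
         forall n, in_Sym n (hcomp n CC)
       & forall n, in_Sym n (hcomp n DD)]) /\
  (forall (n : nat) (l : seq nat), (1 <= n)%N -> is_partition n.-1 l ->
     [/\ in_Sym n (Dpart R[i] n l),
         exists d : galg R[i] n,
           [/\ descent_image (Dpart R[i] n l) d,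
               lie_quasi_idempotent d
             & d = pbw_sum R[i] n l]
       & forall T T', trees_of_type R[i] n l T -> trees_of_type R[i] n l T' ->
           lie_tree T = lie_tree T' -> T = T']).
Proof.
split=> [phim phip /is_birkhoff_aplus e CC DD|n l n0 hl].
  have eC : CC = fun F => eval1 (@aplus R[i] F) by apply/funext => F; rewrite /CC e.
  have eD : DD = fun F => residue (@aplus R[i] F) by apply/funext => F; rewrite /DD e.
  split=> [F|F|n|n]; rewrite ?eC ?eD.
  - exact: eval1_aplus_CX.
  - exact: residue_aplus_CX.
  - exact: eval1_in_Sym.
  exact: residue_in_Sym.
split; first exact: Dpart_in_Sym.
  exists (dperm n l); split; [exact: dperm_image|exact: dperm_quasi|exact: dperm_pbw].
by move=> [H] [H'] _ _ /fbt_inj ->.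
Qed.
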